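(* Let $k\ge1$ be an integer. Let $G=\{G(x),x\in\mathbb{R}_+\}$, $G(0)=0$, be a mean zero Gaussian process with stationary increments and increments variance $\sigma^2$, where $\lim_{h\to0}\sigma^2(h)/h=0$ and $\sigma^2(s)$ has a second derivative at each $s\neq0$. Let $\rho(s)=\frac12\frac{d^2}{ds^2}\sigma^2(s)$, $s\ne0$, and assume that $\rho^k(x)$ is locally integrable and that $\rho(|x|)$ is bounded on $[\delta,M]$ for each $0<\delta<M<\infty$. Then for all $g\in\mathcal{B}_0(\mathbb{R}_+)$, $$\lim_{h\to0}\int:\left(\frac{G(x+h)-G(x)}{h}\right)^{k}:\,g(x)\,dx=\;:(G')^k:(g)\qquad\text{in }L^2.$$
   Context: The increments variance $\sigma^2$ is defined by $E(G(x)-G(y))^2=\sigma^2(x-y)=\sigma^2(|x-y|)$, regarded as an even function on $\mathbb{R}$. The condition $\sigma^2(h)/h\to0$ implies that $G$ has a version with continuous sample paths; this version is used. Here $h>0$. For a mean zero Gaussian random variable $X$, the $k$-th Wick power is $:X^k:=\sum_{j=0}^{[k/2]}(-1)^j\binom{k}{2j}E(X^{2j})X^{k-2j}$. $\mathcal{B}_0(\mathbb{R}_+)$ is the set of bounded Lebesgue measurable functions on $\mathbb{R}_+$ with compact support. Generalized derivative $G'$: for elementary $g=\sum_{i=1}^n g_iI_{(a_i,b_i]}$ set $G'(g)=\sum_i g_i(G(b_i)-G(a_i))$. When $\rho$ is locally integrable one has $E(G'(g)G'(\tilde g))=\int\int\rho(t-s)g(s)\tilde g(t)\,ds\,dt$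 for elementary $g,\tilde g$, and $G'$ extends by isometry (as $L^2$ limits) to the closure of the elementary functions in the norm $(\int\int\rho(t-s)g(s)g(t)\,ds\,dt)^{1/2}$, which contains $\mathcal{B}_0(\mathbb{R}_+)$. Wick power chaos: let $f_\delta$, $\delta\in(0,1]$, be a continuous approximate identity (continuous, nonnegative, symmetric, supported in $[-\delta,\delta]$, $\int f_\delta=1$), and $f_{x,\delta}(s)=f_\delta(s-x)$ (restricted to $s\in\mathbb{R}_+$). When $\rho^k$ is locally integrable, $:(G')^k:(g)=\lim_{\delta\to0}\int :(G'(f_{x,\delta}))^k:\,g(x)\,dx$, a limit in $L^2$, for $g\in\mathcal{B}_0(\mathbb{R}_+)$; it satisfies $E(:(G')^k:(g))^2=k!\int\int\rho^k(x-y)g(x)g(y)\,dx\,dy$. *)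

(* Defs.v *)
From HB Require Import structures.
From mathcomp Require Import all_boot all_order all_algebra.
From mathcomp Require Import all_classical all_reals all_analysis.

Set Implicit Arguments.
Unset Strict Implicit.
Unset Printing Implicit Defensive.

Import Order.TTheory GRing.Theory Num.Theory.
Import numFieldNormedType.Exports.

Local Open Scope classical_set_scope.
Local Open Scope ring_scope.

(* Processes and test functions on R_+ are represented by functions on R that
   are only ever inspected on this set. *)
Definition halfline (R : realType) : set R := `[0, +oo[.
Arguments halfline {R}.

Section Gaussian.
Context {d : measure_display} {T : measurableType d} {R : realType}.
Variable P : probability T R.

(* The degenerate case is explicit because [normal_prob m 0] is by convention
   the uniform law on [0, 1] rather than a point mass. *)
Definition gaussian_rv (X : T -> R) : Prop :=
  measurable_fun setT X /\
  exists m s : R, 0 <= s /\ forall A : set R, measurable A ->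
    P (X @^-1` A) = if s == 0 then dirac m A else normal_prob m s A.

Definition gaussian_process (G : R -> T -> R) : Prop :=
  forall (n : nat) (t c : 'I_n -> R), (forall i, 0 <= t i) ->
    gaussian_rv (fun w => \sum_(i < n) c i * G (t i) w).

Definition mean_zero (G : R -> T -> R) : Prop :=
  forall x, 0 <= x -> ('E_P[G x] = 0)%E.

(* Equality of the laws of (G (t i + h) - G h)_i and (G (t i) - G 0)_i is
   tested on measurable rectangles. *)
Definition stationary_increments (G : R -> T -> R) : Prop :=
  forall (h : R) (n : nat) (t : 'I_n -> R) (A : 'I_n -> set R),
    0 <= h -> (forall i, 0 <= t i) -> (forall i, measurable (A i)) ->
    P [set w | forall i, A i (G (t i + h) w - G h w)] =
    P [set w | forall i, A i (G (t i) w - G 0 w)].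

(* [x - y] ranges over all of R, so [sigma2] is determined by [G] and even. *)
Definition increments_variance (G : R -> T -> R) (sigma2 : R -> R) : Prop :=
  forall x y, 0 <= x -> 0 <= y ->
    ('E_P[(fun w => (G x w - G y w) ^+ 2)%R] = (sigma2 (x - y))%:E)%E.

Definition L2_cvg {I : Type} (F : set_system I) (X_ : I -> T -> R)
    (X : T -> R) : Prop :=
  [/\ (\forall i \near F, X_ i \in Lfun P 2%:E),
      X \in Lfun P 2%:E &
      ('N[P]_(2%:E)[EFin \o (X_ i \- X)%R] @[i --> F] --> 0)%E].

Definition wick_power (k : nat) (X : T -> R) (w : T) : R :=
  \sum_(j < k./2.+1)
    (-1) ^+ j * 'C(k, j.*2)%:R * fine ('E_P[(fun v => X v ^+ j.*2)%R])%E *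
    X w ^+ (k - j.*2).

End Gaussian.

Section TestFunctions.
Context {R : realType}.

(* Lebesgue (not Borel) measurability, hence the completed Lebesgue measure and
   its Caratheodory sigma-algebra. *)
Definition lebesgue_measurable_fun (D : set R) (g : R -> R) : Prop :=
  @measurable_fun _ _ (caratheodory_type (@wlength R idfun)^*%mu) R D g.

Definition B0 (g : R -> R) : Prop :=
  [/\ lebesgue_measurable_fun halfline g,
      exists M, forall x, 0 <= x -> `|g x| <= M &
      compact (closure [set x | 0 <= x /\ g x != 0])].

Definition lebesgue_int (D : set R) (f : R -> R) : R :=
  \int[@completed_lebesgue_measure R]_(x in D) f x.

(* The item (c, (a, b)) stands for c times the indicator of ]a, b]. *)
Definition elementary : Type := seq (R * (R * R)).

Definition elementary_on_halfline (u : elementary) : Prop :=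
  forall i, i \in u -> 0 <= i.2.1 <= i.2.2.

Definition elementary_fun (u : elementary) (s : R) : R :=
  \sum_(i <- u) i.1 * \1_(`]i.2.1, i.2.2]) s.

(* The value at 0 is never meaningful: 0 is excluded from the domain of rho. *)
Definition rho_of (sigma2 : R -> R) (s : R) : R := 2^-1 * (sigma2^`(2))%classic s.

Definition rho_form (rho : R -> R) (u v : R -> R) : R :=
  lebesgue_int halfline (fun t =>
    lebesgue_int halfline (fun s => rho (t - s) * u s * v t)).

Definition approximate_identity (f : R -> R -> R) : Prop :=
  forall delta, 0 < delta <= 1 ->
    [/\ continuous (f delta),
        forall s, 0 <= f delta s,
        forall s, f delta (- s) = f delta s,
        forall s, delta < `|s| -> f delta s = 0 &
        lebesgue_int setT (f delta) = 1].

End TestFunctions.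

Section WickChaos.
Context {d : measure_display} {T : measurableType d} {R : realType}.
Variable P : probability T R.

Definition deriv_elementary (G : R -> T -> R) (u : elementary) (w : T) : R :=
  \sum_(i <- u) i.1 * (G i.2.2 w - G i.2.1 w).

(* [Z] is a version of G'(phi), which is defined up to a null set only. *)
Definition is_gen_deriv (G : R -> T -> R) (rho phi : R -> R) (Z : T -> R)
    : Prop :=
  exists u : nat -> elementary,
    [/\ forall n, elementary_on_halfline (u n),
        rho_form rho (fun s => phi s - elementary_fun (u n) s)
                     (fun s => phi s - elementary_fun (u n) s)
          @[n --> \oo] --> (0 : R) &
        L2_cvg P \oo (fun n => deriv_elementary G (u n)) Z].

(* [X] is a version of :(G')^k:(g), relative to the approximate identity [f].
   The random variables G'(f_{x,delta}) are only defined almost surely for each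
   x separately, so the integral over x is that of a version [Y delta x] that is
   jointly measurable in x and w; by Fubini any two such versions give almost
   surely the same integral. *)
Definition is_wick_chaos (G : R -> T -> R) (rho : R -> R) (f : R -> R -> R)
    (k : nat) (g : R -> R) (X : T -> R) : Prop :=
  exists Y : R -> R -> T -> R,
    (forall delta, 0 < delta <= 1 ->
       measurable_fun (halfline `*` [set: T]) (fun p => Y delta p.1 p.2) /\
       forall x, 0 <= x ->
         is_gen_deriv G rho (fun s => f delta (s - x)) (Y delta x)) /\
    L2_cvg P 0^'+
      (fun delta w =>
         lebesgue_int halfline (fun x => wick_power P k (Y delta x) w * g x))
      X.

End WickChaos.

(* Main.v *)
Require Import Defs.
From HB Require Import structures.
From mathcomp Require Import all_boot all_order all_algebra.
From mathcomp Require Import all_classical all_reals all_analysis.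
From mathcomp Require Import measurable_realfun.
From mathcomp Require Import ring lra.

Set Implicit Arguments.
Unset Strict Implicit.
Unset Printing Implicit Defensive.

Import Order.TTheory GRing.Theory Num.Theory.
Import numFieldNormedType.Exports.

Local Open Scope classical_set_scope.
Local Open Scope ring_scope.

(* The random variables G'(f_{x,delta}) and (G(x + h) - G(x)) / h are both of the form G'(p(. - x)) for a
   probability density p of small support: p = f_delta, or p = h^-1 on ]0, h].  Write A_p for the integral of
   :G'(p(. - x))^k: g(x) dx.  For jointly Gaussian centred X and Y one has E(:X^k: :Y^k:) = k! E(XY)^k, so that
   E(A_p A_q) = k! \int\int K_{p,q}(x, y)^k g(x) g(y) dx dy, where K_{p,q}(x, y) is the average of rho(t - s)
   against p(s - x) q(t - y).  As the supports of p and q shrink this tends to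
   k! \int\int rho(x - y)^k g(x) g(y) dx dy: on a compact set rho is close in L^k to a bounded continuous
   function, for which the convergence is uniform away from the boundary of the square, and by Jensen's
   inequality the averages do not increase the L^k error.  Hence E(A_p - A_q)^2 = E(A_p^2) - 2 E(A_p A_q) + E(A_q^2)
   tends to 0, whichever of the two types p and q are: the A_{f_delta} converge in L^2, and the integrals of
   the difference quotients have the same limit.

   That the covariance of increments of G is given by rho follows by integrating
   sigma^2'' = 2 rho twice; the singularity at 0 is harmless since sigma^2(h) / h -> 0 makes
   sigma^2 differentiable at 0, and rho, being locally in L^k, is locally integrable. *)

(** * Lebesgue integration on the line *)

(** The covariance form needs [rho] only in L^1 on bounded sets, whereas k-th powers of covariances
    require closeness in L^k. Averages of [rho] are therefore compared with [rho] in L^k first, and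
    [power_difference_bound] then transfers the estimate to k-th powers. As a second derivative
    [rho] may be discontinuous, so its integral is recovered from difference quotients, which the
    bound away from 0 dominates. Kernels are cut off at the origin and lose mass when x is close to
    0; this is where the strips along the boundary of the square come from. Gaussianity enters
    through moments of linear combinations, a property that survives L^2 limits. For each x the
    variable G'(f_{x,delta}) is given only up to a null set. To integrate over x, a jointly
    measurable version is built as a pointwise upper limit of elementary approximations converging
    geometrically, uniformly in x. For an arbitrary version, covariances are computed by showing
    that every uniform step approximation of the kernel converges to it. The Lebesgue measurable [g]
    is replaced by a Borel function, so that Fubini's theorem is used on Borel products. *)

Section LebesgueTranslation.
Context {R : realType} (a : R).
Local Notation mu := (@lebesgue_measure R).
Local Open Scope ereal_scope.

Let tr := (fun x => x + a)%R : measurableTypeR R -> measurableTypeR R.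
Let mtr : measurable_fun setT tr.
Proof. exact: measurable_funD. Qed.
HB.instance Definition _ := isMeasurableFun.Build _ _ _ _ tr mtr.

Lemma pushforward_lebesgue_translation (A : set R) : measurable A ->
  pushforward mu tr A = mu A.
Proof.
move=> mA; apply/esym/lebesgue_measure_unique => //= _ [[u v]] _ <-.
rewrite /pushforward.
have -> : tr @^-1` `]u, v] = `](u - a)%R, (v - a)%R]%classic.
  by apply/seteqP; split => x /=; rewrite !in_itv/= ltrBlDr lerBrDr.
by rewrite !lebesgue_measure_itv/= !lte_fin ltrD2r; case: ifP => // _; rewrite -!EFinB; congr EFin; ring.
Qed.

Lemma ge0_integral_translation (f : R -> \bar R) :
  measurable_fun setT f -> (forall x, 0 <= f x) ->
  \int[mu]_x f (x + a)%R = \int[mu]_x f x.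
Proof.
move=> mf f0.
transitivity (\int[pushforward mu tr]_x f x); last first.
  by apply: eq_measure_integral => //= A mA _; exact: pushforward_lebesgue_translation.
by rewrite ge0_integral_pushforward.
Qed.

End LebesgueTranslation.

Lemma ge0_integral_reflection {R : realType} (a : R) (f : R -> \bar R) :
  measurable_fun setT f -> (forall x, 0 <= f x)%E ->
  (\int[lebesgue_measure]_x f (a - x)%R = \int[lebesgue_measure]_x f x)%E.
Proof.
move=> mf f0.
rewrite -[RHS](ge0_integral_translation a)//.
have mg : measurable_fun setT (fun x : R => f (x + a)%R).
  by apply: measurableT_comp => //; exact: measurable_funD.
transitivity (\int[pushforward lebesgue_measure (-%R : _ -> measurableTypeR R)]_x f (x + a)%R)%E; last first.
  by apply: eq_measure_integral => //= A mA _; exact: lebesgue_measureN.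
rewrite ge0_integral_pushforward//.
by apply: eq_integral => x _ /=; rewrite addrC.
Qed.

Section CompletedIntegral.
Context {R : realType}.
Local Notation mu := (@lebesgue_measure R).
Local Notation cR := (caratheodory_type (@wlength R idfun)^*%mu).
Local Notation cmu := (@completed_lebesgue_measure R).

Let id_c := (fun x : R => x) : cR -> measurableTypeR R.
Let mid_c : measurable_fun setT id_c.
Proof. by move=> _ A mA; rewrite setTI; exact: sub_caratheodory. Qed.

Lemma measurable_fun_completed d' (U : measurableType d') (D : set R) (f : R -> U) :
  measurable D -> measurable_fun D f -> @measurable_fun _ _ cR U D f.
Proof.
move=> mD mf _ A mA.
by apply: sub_caratheodory; apply: mf.
Qed.

(** Pushed forward along the identity to the Borel sigma-algebra, the completed measure is the Borel
    Lebesgue measure, so completion does not change the integral of a Borel function. *)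
Lemma ge0_integral_completed (D : set R) (f : R -> \bar R) :
  measurable D -> measurable_fun D f -> (forall x, D x -> 0 <= f x)%E ->
  (\int[cmu]_(x in D) f x = \int[mu]_(x in D) f x)%E.
Proof.
move=> mD mf f0.
transitivity (\int[pushforward cmu id_c]_(x in D) f x)%E; last first.
  by apply: eq_measure_integral => A mA _.
by rewrite (@ge0_integral_pushforward _ _ cR) // => x /set_mem; exact: f0.
Qed.

Lemma integral_completed (D : set R) (f : R -> \bar R) :
  measurable D -> measurable_fun D f ->
  (\int[cmu]_(x in D) f x = \int[mu]_(x in D) f x)%E.
Proof.
move=> mD mf; rewrite integralE [RHS]integralE; congr (_ - _)%E; apply: ge0_integral_completed => //.
  exact: measurable_funepos.
exact: measurable_funeneg.
Qed.

End CompletedIntegral.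

Section BorelVersion.
Context {R : realType}.
Local Notation mu := (@lebesgue_measure R).

(** The Caratheodory sigma-algebra is the completion of the Borel one: [A] is a Borel set together
    with a subset of a null Borel set [Z], and off [Z] only the Borel set is left. *)
Lemma caratheodory_Borel (A : set R) :
  (@wlength R idfun)^*%mu.-cara.-measurable A ->
  exists B Z : set R, [/\ measurable B, measurable Z, mu Z = 0%E &
    A `\` Z = B `\` Z].
Proof.
rewrite -completed_caratheodory_measurable g_sigma_completed_algebra_genE.
move=> [/= B mB [N [Z [mZ Z0 NZ]]] <-]; exists B, Z; split => //.
by apply/seteqP; split => x [] => [[Bx|/NZ]|Bx] // nZx; split => //; left.
Qed.

(** Rational levels suffice: [Z] collects the exceptional null sets of countably many superlevel
    sets of [g], and off [Z] each of these agrees with a Borel set. [gb] is [g] cut to [D] minus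
    [Z]. *)
Lemma lebesgue_measurable_fun_Borel (D : set R) (g : R -> R) :
  measurable D -> lebesgue_measurable_fun D g ->
  exists gb : R -> R, [/\ measurable_fun setT gb,
    (forall x, gb x = 0 \/ D x /\ gb x = g x) &
    exists Z, [/\ measurable Z, mu Z = 0%E &
      forall x, D x -> ~ Z x -> gb x = g x]].
Proof.
move=> mD mg.
have mcD : (@wlength R idfun)^*%mu.-cara.-measurable D by exact: sub_caratheodory.
pose A (q : rat) : set R := D `&` [set x | ratr q < g x].
have /choice[B] : forall q, exists B : set R * set R,
    [/\ measurable B.1, measurable B.2, mu B.2 = 0%E & A q `\` B.2 = B.1 `\` B.2].
  move=> q; have [|B [Z ?]] := @caratheodory_Borel (A q).
    rewrite /A -preimage_itvoy; apply: mg => //; exact: measurable_itv.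
  by exists (B, Z).
move=> HB.
pose Z : set R := \bigcup_n (if @unpickle rat n is Some q then (B q).2 else set0).
have mZ : measurable Z.
  by apply: bigcupT_measurable => n; case: unpickle => // q; have [] := HB q.
have muZ0 : mu Z = 0%E.
  apply/negligibleP => //; apply: negligible_bigcup => n.
  by case: unpickle => [q|]; apply/negligibleP => //; have [] := HB q.
have subZ q : (B q).2 `<=` Z.
  by move=> x Bx; exists (pickle q); [exact: I|rewrite pickleK].
pose gb x := if x \in D `\` Z then g x else 0.
exists gb; split.
- move=> _; apply: (measurability _ (RGenOInfty.measurableE R)) => //.
  move=> /= _ [_ [a ->] <-]; rewrite preimage_itvoy setTI.
  have mS : measurable (\bigcup_(q : rat) ((if (a < ratr q)%R then (B q).1 `\` Z else set0))).
    apply: bigcupT_measurable_rat => q; case: ifP => // _.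
    by apply: measurableD => //; have [] := HB q.
  have mDZ : measurable (~` (D `\` Z)) by apply: measurableC; exact: measurableD.
  have gbS x : (D `\` Z) x -> a < g x <-> (\bigcup_(q : rat) ((if (a < ratr q)%R then (B q).1 `\` Z else set0))) x.
    move=> [Dx Zx]; split.
      move=> /rat_in_itvoo[q]; rewrite in_itv/= => /andP[aq qg].
      exists q => //; rewrite aq; split => //.
      have [_ _ _ ABE] := HB q.
      have : (A q `\` (B q).2) x by split => // /subZ.
      by rewrite ABE => -[].
    move=> [q _]; case: ifPn => // aq [Bx _].
    have [_ _ _ ABE] := HB q.
    have : ((B q).1 `\` (B q).2) x by split => // /subZ.
    by rewrite -ABE => -[[_/=] qg _]; exact: lt_trans aq qg.
  (* Where [gb] is 0 by default it exceeds the level [a] exactly when [a < 0]; this decides whether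
     that region is added or removed. *)
  rewrite [X in measurable X](_ : _ = if (a < 0) then
      (\bigcup_(q : rat) ((if (a < ratr q)%R then (B q).1 `\` Z else set0))) `|` (~` (D `\` Z))
     else (\bigcup_(q : rat) ((if (a < ratr q)%R then (B q).1 `\` Z else set0))) `&` (D `\` Z)).
    case: ifP => _; [exact: measurableU|apply: measurableI => //; exact: measurableD].
  apply/seteqP; split => x /=; rewrite /gb.
    case: ifPn => [/set_mem DZx agx|].
      case: ifP => _; [left|split => //]; exact/gbS.
    by rewrite notin_setE => nDZ ->; right.
  case: ifP => a0; case: ifPn.
  - move=> /set_mem DZx [Sx|//]; exact/gbS.
  - by move=> _ _.
  - by move=> /set_mem DZx [Sx _]; exact/gbS.
  - by rewrite notin_setE => nDZ [_ /nDZ].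
- move=> x; rewrite /gb; case: ifPn; last by left.
  by move=> /set_mem[Dx _]; right.
- exists Z; split => // x Dx nZx; rewrite /gb ifT//.
  exact/mem_set.
Qed.

(** The integral identity is stated against Borel factors [F] only: the product with [gb] is then
    Borel, and its completed integral can be replaced by the Borel one. *)
Lemma B0_Borel (g : R -> R) : B0 g ->
  exists gb : R -> R, [/\ measurable_fun setT gb,
    (exists M, forall x, `|gb x| <= M),
    (exists2 N, 0 < N & forall x, gb x != 0 -> 0 <= x <= N) &
    forall F : R -> R, measurable_fun (@halfline R) F ->
      lebesgue_int halfline (fun x => F x * g x) =
      \int[mu]_(x in halfline) (F x * gb x)].
Proof.
move=> [mg [M gM] cpt].
have mH : measurable (@halfline R) by exact: measurable_itv.
have [gb [mgb gb0 [Z [mZ Z0 gbZ]]]] := lebesgue_measurable_fun_Borel mH mg.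
exists gb; split => //.
- exists `|M| => x; have [->|[Hx ->]] := gb0 x; first by rewrite normr0.
  apply: le_trans (gM x _) (ler_norm _).
  by move: Hx; rewrite /halfline/= in_itv/= andbT.
- have [N [Nr HN]] := compact_bounded cpt.
  exists (`|N| + 1); first by rewrite ltr_pwDr.
  move=> x; have [->|[Hx ->]] := gb0 x; first by rewrite eqxx.
  move=> gx; have x0 : 0 <= x by move: Hx; rewrite /halfline/= in_itv/= andbT.
  rewrite x0/=; apply: le_trans (ler_norm _) _.
  apply: (HN (`|N| + 1)); first by rewrite ltr_pwDr// ler_norm.
  exact: subset_closure.
- move=> F mF; rewrite /lebesgue_int /Rintegral; congr fine.
  rewrite -integral_completed//; last first.
    apply/measurable_EFinP; apply: measurable_funM => //.
    exact: measurable_funTS.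
  apply: ae_eq_integral.
  + exact: sub_caratheodory.
  + apply/measurable_EFinP.
    apply: (@measurable_funM _ (caratheodory_type (@wlength R idfun)^*%mu)) => //.
    exact: measurable_fun_completed.
  + apply: measurable_fun_completed => //.
    apply/measurable_EFinP; apply: measurable_funM => //.
    exact: measurable_funTS.
  + exists Z; split => //; first exact: sub_caratheodory.
    by move=> x /=; apply: contra_notP => nZx Hx; rewrite gbZ.
Qed.
End BorelVersion.

Section RFubini.
Context {d1 d2 : measure_display} {T1 : measurableType d1} {T2 : measurableType d2}
  {R : realType}.
Variables (m1 : {sigma_finite_measure set T1 -> \bar R})
          (m2 : {sigma_finite_measure set T2 -> \bar R}).

(** No integrability is required: the real integral is [fine] of a difference of two Tonelli
    integrals, both measurable in the parameter. *)
Lemma measurable_Rintegral2 (f : T1 * T2 -> R) : measurable_fun setT f ->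
  measurable_fun setT (fun x => \int[m2]_y f (x, y)).
Proof.
move=> mf; have mEf : measurable_fun setT (EFin \o f) by exact/measurable_EFinP.
apply: (@measurableT_comp _ _ _ _ _ _ fine) => //.
have -> : (fun x => \int[m2]_y (f (x, y))%:E)%E =
    (fun x => fubini_F m2 (EFin \o f)^\+ x - fubini_F m2 (EFin \o f)^\- x)%E.
  apply/funext => x; rewrite integralE; congr (_ - _)%E;
    by apply: eq_integral => y _; rewrite ?funeposE ?funenegE.
apply: emeasurable_funB; apply: measurable_fun_fubini_tonelli_F => //.
- exact: measurable_funepos.
- exact: measurable_funeneg.
Qed.

Lemma measurable_Rintegral1 (f : T1 * T2 -> R) : measurable_fun setT f ->
  measurable_fun setT (fun y => \int[m1]_x f (x, y)).
Proof.
move=> mf; have mEf : measurable_fun setT (EFin \o f) by exact/measurable_EFinP.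
apply: (@measurableT_comp _ _ _ _ _ _ fine) => //.
have -> : (fun y => \int[m1]_x (f (x, y))%:E)%E =
    (fun y => fubini_G m1 (EFin \o f)^\+ y - fubini_G m1 (EFin \o f)^\- y)%E.
  apply/funext => x; rewrite integralE; congr (_ - _)%E;
    by apply: eq_integral => y _; rewrite ?funeposE ?funenegE.
apply: emeasurable_funB; apply: measurable_fun_fubini_tonelli_G => //.
- exact: measurable_funepos.
- exact: measurable_funeneg.
Qed.

Variable f : T1 * T2 -> R.
Hypothesis fi : (m1 \x m2)%E.-integrable setT (EFin \o f).
Let mf : measurable_fun setT f.
Proof. by apply/measurable_EFinP; exact: measurable_int fi. Qed.

(** [fine] can alter the inner integral only where the section is not integrable, which is a null
    set of points. *)
Let fineK1 : ae_eq m1 setT (fun x => (\int[m2]_y f (x, y))%:E) (fubini_F m2 (EFin \o f)).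
Proof.
have := ae_integrable1 fi; apply: filterS => x ix _.
rewrite /Rintegral fineK//; exact: integrable_fin_num.
Qed.

Let fineK2 : ae_eq m2 setT (fun y => (\int[m1]_x f (x, y))%:E) (fubini_G m1 (EFin \o f)).
Proof.
have := ae_integrable2 fi; apply: filterS => x ix _.
rewrite /Rintegral fineK//; exact: integrable_fin_num.
Qed.

Lemma Rintegral12 : \int[m1]_x (\int[m2]_y f (x, y)) = \int[(m1 \x m2)%E]_z f z.
Proof.
rewrite /Rintegral -(integral12_prod_meas1 fi); congr fine.
apply: ae_eq_integral fineK1; first by [].
  by apply/measurable_EFinP; exact: measurable_Rintegral2.
exact: (measurable_fubini_F fi).
Qed.

Lemma Rintegral21 : \int[m2]_y (\int[m1]_x f (x, y)) = \int[(m1 \x m2)%E]_z f z.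
Proof.
rewrite /Rintegral -(integral21_prod_meas1 fi); congr fine.
apply: ae_eq_integral fineK2; first by [].
  by apply/measurable_EFinP; exact: measurable_Rintegral1.
exact: (measurable_fubini_G fi).
Qed.

End RFubini.

(** The right-hand side lies above the tangent of the power at [z]. For the induction, [z] times the
    hypothesis is added to the nonnegative product of [t - z] and [t ^+ n.+1 - z ^+ n.+1]. *)
Lemma ler_AGM_power {R : realFieldType} (n : nat) (t z : R) : 0 <= t -> 0 <= z ->
  n.+1%:R * t * z ^+ n <= t ^+ n.+1 + n%:R * z ^+ n.+1.
Proof.
move=> t0 z0; elim: n => [|n IH]; first by rewrite expr0 !mulr1 mul1r mul0r addr0 expr1.
have h : 0 <= (t - z) * (t ^+ n.+1 - z ^+ n.+1).
  have [tz|zt] := leP z t.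
    by apply: mulr_ge0; rewrite subr_ge0// lerXn2r.
  by apply: mulr_le0; rewrite subr_le0 ?lerXn2r//; exact: ltW.
have := ler_wpM2r z0 IH.
rewrite -!natr1 [t ^+ n.+2]exprS [z ^+ n.+2]exprS [z ^+ n.+1]exprS in h *.
move: h; move: (t ^+ n.+1) (z ^+ n) => p q; nra.
Qed.

(* Jensen's inequality for a weight of mass at most 1: integrate the tangent
   inequality [k t z^(k-1) <= t^k + (k-1) z^k] at [z := \int F * m]. *)
Lemma power_integral_weight {d : measure_display} {T : measurableType d} {R : realType}
    (mu : {measure set T -> \bar R}) (F w : T -> R) (k : nat) :
  measurable_fun setT F -> measurable_fun setT w ->
  (forall x, 0 <= w x) -> (\int[mu]_x (w x)%:E <= 1)%E -> (0 < k)%N ->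
  ((`|\int[mu]_x (F x * w x)| ^+ k)%:E <= \int[mu]_x (`|F x| ^+ k * w x)%:E)%E.
Proof.
case: k => // k mF mw w0 w1 _.
have mk : measurable_fun setT (fun x => `|F x| ^+ k.+1 * w x).
  by apply: measurable_funM => //; apply: measurable_funX; exact: measurableT_comp.
have k0 x : 0 <= `|F x| ^+ k.+1 * w x by rewrite mulr_ge0// exprn_ge0.
have [kfin|] := ltP (\int[mu]_x (`|F x| ^+ k.+1 * w x)%:E)%E +oo%E; last first.
  by rewrite leye_eq => /eqP ->; rewrite leey.
have iw : mu.-integrable setT (EFin \o w).
  apply/integrableP; split; first exact/measurable_EFinP.
  under eq_integral do rewrite /= ger0_norm//.
  exact: le_lt_trans w1 (ltry _).
have ik : mu.-integrable setT (EFin \o (fun x => `|F x| ^+ k.+1 * w x)).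
  apply/integrableP; split; first exact/measurable_EFinP.
  by under eq_integral do rewrite /= ger0_norm//.
have iFw : mu.-integrable setT (EFin \o (fun x => F x * w x)).
  have i1 : mu.-integrable setT (EFin \o (fun x => w x + `|F x| ^+ k.+1 * w x)).
    have := integrableD measurableT iw ik; exact: eq_integrable.
  apply: le_integrable i1 => //.
    by apply/measurable_EFinP; exact: measurable_funM.
  move=> x _ /=; rewrite lee_fin [leRHS]ger0_norm ?addr_ge0//.
  rewrite normrM (ger0_norm (w0 x)) -{2}[w x]mul1r -mulrDl; apply: ler_wpM2r => //.
  have [F1|F1] := leP `|F x| 1; first by rewrite ler_wpDr// exprn_ge0.
  by rewrite ler_wpDl// -[leLHS]expr1 ler_weXn2l// ltW.
pose z := \int[mu]_x (`|F x| * w x).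
have iaFw : mu.-integrable setT (EFin \o (fun x => `|F x| * w x)).
  have := integrable_norm iFw; apply: eq_integrable => // x _ /=.
  by rewrite normrM (ger0_norm (w0 x)).
have z0 : 0 <= z by apply: Rintegral_ge0 => x _; rewrite mulr_ge0.
have Fz : `|\int[mu]_x (F x * w x)| <= z.
  apply: le_trans (le_normr_Rintegral _ iFw) _ => //.
  rewrite le_eqVlt; apply/orP; left; apply/eqP; apply: eq_Rintegral => x _.
  by rewrite normrM (ger0_norm (w0 x)).
have iwR : \int[mu]_x w x <= 1.
  rewrite -lee_fin /Rintegral fineK//; exact: integrable_fin_num.
have H : k.+1%:R * z ^+ k * z <= \int[mu]_x (`|F x| ^+ k.+1 * w x) + k%:R * z ^+ k.+1 * \int[mu]_x w x.
  rewrite /z -RintegralZl// -[X in _ <= _ + X]RintegralZl// -RintegralD//; last first.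
    have := integrableZl measurableT (k%:R * z ^+ k.+1) iw; exact: eq_integrable.
  apply: le_Rintegral => //.
  - have := integrableZl measurableT (k.+1%:R * z ^+ k) iaFw; exact: eq_integrable.
  - have iz : mu.-integrable setT (EFin \o (fun x => k%:R * z ^+ k.+1 * w x)).
      have := integrableZl measurableT (k%:R * z ^+ k.+1) iw; exact: eq_integrable.
    have := integrableD measurableT ik iz; exact: eq_integrable.
  - move=> x _; rewrite -/z mulrA -mulrDl; apply: ler_wpM2r => //.
    by rewrite mulrAC; apply: ler_AGM_power.
rewrite -[leRHS]fineK; last by apply: integrable_fin_num.
rewrite lee_fin -/(Rintegral _ _ _).
apply: (@le_trans _ _ (z ^+ k.+1)); first by rewrite lerXn2r ?nnegrE.
have : k%:R * z ^+ k.+1 * \int[mu]_x w x <= k%:R * z ^+ k.+1.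
  by rewrite -[leRHS]mulr1; apply: ler_wpM2l => //; rewrite mulr_ge0// exprn_ge0.
move=> h; rewrite -(lerD2l (k%:R * z ^+ k.+1)).
apply: (@le_trans _ _ (k.+1%:R * z ^+ k * z)); first by rewrite -natr1 exprSr -mulrA mulrDl mul1r.
by apply: (le_trans H); rewrite addrC lerD2r.
Qed.

(** * Square-integrable random variables *)

Section L2space.
Context {d : measure_display} {T : measurableType d} {R : realType}.
Variable P : probability T R.
Local Notation L2 := (Lfun P 2%:E).
Implicit Types X Y Z : T -> R.

Lemma Lfun2P X : X \in L2 <->
  measurable_fun setT X /\ P.-integrable setT (EFin \o (fun w => X w ^+ 2)).
Proof.
split=> [X2|[mX iX]].
  split; last exact: Lfun2_integrable_sqr.
  by move: X2; rewrite inE => /andP[/[!inE]].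
rewrite inE; apply/andP; split; first by rewrite inE.
rewrite inE/= /finite_norm unlock poweR_lty//.
case/integrableP : iX => _; apply: le_lt_trans.
rewrite le_eqVlt; apply/orP; left; apply/eqP; apply: eq_integral => w _ /=.
by rewrite normrX powR_mulrn.
Qed.

Lemma Lfun2_measurable X : X \in L2 -> measurable_fun setT X.
Proof. by case/Lfun2P. Qed.

Lemma Lfun2_dominated X (B : T -> R) : measurable_fun setT X ->
  P.-integrable setT (EFin \o B) -> (forall w, X w ^+ 2 <= B w) -> X \in L2.
Proof.
move=> mX iB XB; apply/Lfun2P; split => //.
apply: le_integrable iB => //.
  by apply/measurable_EFinP; exact: measurable_funX.
move=> w _ /=; rewrite lee_fin ger0_norm ?sqr_ge0//.
by apply: le_trans (XB w) (ler_norm _).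
Qed.

Lemma Lfun2_mul_integrable X Y : X \in L2 -> Y \in L2 ->
  P.-integrable setT (EFin \o (fun w => X w * Y w)).
Proof. by move=> X2 Y2; apply/Lfun1_integrable; exact: Lfun2_mul_Lfun1. Qed.

Lemma Lfun2Z a X : X \in L2 -> (fun w => a * X w) \in L2.
Proof.
move=> /Lfun2P[mX iX]; apply/Lfun2P; split; first exact: measurable_funM.
have := integrableZl measurableT (a ^+ 2) iX.
apply: eq_integrable => // w _ /=; rewrite -EFinM; congr EFin; ring.
Qed.

Lemma Lfun2D X Y : X \in L2 -> Y \in L2 -> (fun w => X w + Y w) \in L2.
Proof.
move=> X2 Y2.
have mX := Lfun2_measurable X2; have mY := Lfun2_measurable Y2.
have [_ iX] := (Lfun2P X).1 X2; have [_ iY] := (Lfun2P Y).1 Y2.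
apply: (@Lfun2_dominated _ (fun w => 2 * (X w ^+ 2) + 2 * (Y w ^+ 2))).
- exact: measurable_funD.
- apply: (@eq_integrable _ _ _ _ _ measurableT ((fun w => 2%:E * (X w ^+ 2)%:E) \+ (fun w => 2%:E * (Y w ^+ 2)%:E))%E) => //.
  by apply: integrableD => //; apply: integrableZl.
- move=> w; rewrite -subr_ge0; have := sqr_ge0 (X w - Y w); congr (0 <= _); ring.
Qed.

Lemma Lfun2N X : X \in L2 -> (fun w => - X w) \in L2.
Proof. by move=> /(Lfun2Z (-1)); under eq_fun do rewrite mulN1r. Qed.

Lemma Lfun2B X Y : X \in L2 -> Y \in L2 -> (fun w => X w - Y w) \in L2.
Proof. by move=> X2 Y2; apply: Lfun2D => //; exact: Lfun2N. Qed.

Lemma Lfun2_0 : (fun _ => 0) \in L2.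
Proof.
by apply/Lfun2P; split => //; apply: finite_measure_integrable_cst.
Qed.

Lemma Lfun2_sum (I : Type) (r : seq I) (F : I -> T -> R) :
  (forall i, F i \in L2) -> (fun w => \sum_(i <- r) F i w) \in L2.
Proof.
move=> F2; elim: r => [|i r IH].
  by under eq_fun do rewrite big_nil; exact: Lfun2_0.
by under eq_fun do rewrite big_cons; exact: Lfun2D.
Qed.

Lemma Lfun2_integrable X : X \in L2 -> P.-integrable setT (EFin \o X).
Proof.
move=> X2; apply/Lfun1_integrable; apply: Lfun_subset12 => //.
exact: fin_num_measure.
Qed.

Definition ip X Y : R := \int[P]_w (X w * Y w).

Lemma ipC X Y : ip X Y = ip Y X.
Proof. by apply: eq_Rintegral => w _; rewrite mulrC. Qed.

Lemma ip_ge0 X : 0 <= ip X X.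
Proof. by apply: Rintegral_ge0 => w _; rewrite -expr2 sqr_ge0. Qed.

Lemma ipDl X Y Z : X \in L2 -> Y \in L2 -> Z \in L2 ->
  ip (fun w => X w + Y w) Z = ip X Z + ip Y Z.
Proof.
move=> X2 Y2 Z2; rewrite /ip -RintegralD//; [|exact: Lfun2_mul_integrable..].
by apply: eq_Rintegral => w _; rewrite mulrDl.
Qed.

Lemma ipZl a X Z : X \in L2 -> Z \in L2 -> ip (fun w => a * X w) Z = a * ip X Z.
Proof.
move=> X2 Z2; rewrite /ip -RintegralZl//; last exact: Lfun2_mul_integrable.
by apply: eq_Rintegral => w _; rewrite mulrA.
Qed.

Lemma ipBl X Y Z : X \in L2 -> Y \in L2 -> Z \in L2 ->
  ip (fun w => X w - Y w) Z = ip X Z - ip Y Z.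
Proof.
move=> X2 Y2 Z2; rewrite /ip -RintegralB//; [|exact: Lfun2_mul_integrable..].
by apply: eq_Rintegral => w _; rewrite mulrBl.
Qed.

Lemma ipDr X Y Z : X \in L2 -> Y \in L2 -> Z \in L2 ->
  ip Z (fun w => X w + Y w) = ip Z X + ip Z Y.
Proof. by move=> X2 Y2 Z2; rewrite ipC ipDl// !(ipC Z). Qed.

Lemma ipZr a X Z : X \in L2 -> Z \in L2 -> ip Z (fun w => a * X w) = a * ip Z X.
Proof. by move=> X2 Z2; rewrite ipC ipZl// (ipC Z). Qed.

Lemma ipBr X Y Z : X \in L2 -> Y \in L2 -> Z \in L2 ->
  ip Z (fun w => X w - Y w) = ip Z X - ip Z Y.
Proof. by move=> X2 Y2 Z2; rewrite ipC ipBl// !(ipC Z). Qed.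

Lemma ip_suml (I : Type) (r : seq I) (F : I -> T -> R) Z :
  (forall i, F i \in L2) -> Z \in L2 ->
  ip (fun w => \sum_(i <- r) F i w) Z = \sum_(i <- r) ip (F i) Z.
Proof.
move=> F2 Z2; elim: r => [|i r IH].
  rewrite big_nil /ip; under eq_Rintegral do rewrite big_nil mul0r.
  by rewrite Rintegral_cst//= mul0r.
rewrite big_cons -IH -ipDl//; last exact: Lfun2_sum.
by apply: eq_Rintegral => w _; rewrite big_cons.
Qed.

Lemma ip_CS X Y : X \in L2 -> Y \in L2 -> `|ip X Y| <= Num.sqrt (ip X X) * Num.sqrt (ip Y Y).
Proof.
move=> X2 Y2.
have Q s : 0 <= s ^+ 2 * ip X X - 2 * s * ip X Y + ip Y Y.
  have := ip_ge0 (fun w => s * X w - Y w).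
  rewrite ipBl ?ipBr ?ipZl ?ipZr// ?(ipC Y); try exact: Lfun2Z; try exact: Lfun2B (Lfun2Z _ _) _.
  by congr (0 <= _); ring.
have Xge := ip_ge0 X; have Yge := ip_ge0 Y.
rewrite -sqrtrM// -sqrtr_sqr ler_sqrt ?mulr_ge0//.
have [X0|X0] := eqVneq (ip X X) 0.
  have [->|XY0] := eqVneq (ip X Y) 0; first by rewrite expr0n mulr_ge0.
  (* When [ip X X = 0] the quadratic is affine in [s], and this value of [s] would make it equal to
     -1. *)
  have := Q ((ip Y Y + 1) / (2 * ip X Y)); rewrite X0 mulr0 add0r.
  rewrite (_ : 2 * _ * _ = ip Y Y + 1); last by field.
  by rewrite opprD addrAC addNr add0r oppr_ge0 ler10.
have := Q (ip X Y / ip X X).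
rewrite (_ : _ - _ + _ = (ip X X * ip Y Y - ip X Y ^+ 2) / ip X X); last by field.
by rewrite pmulr_lge0 ?invr_gt0 ?lt0r ?X0// subr_ge0.
Qed.

Definition nm X : R := Num.sqrt (ip X X).

Lemma nm_ge0 X : 0 <= nm X. Proof. exact: sqrtr_ge0. Qed.

Lemma nm_sqr X : nm X ^+ 2 = ip X X.
Proof. by rewrite sqr_sqrtr// ip_ge0. Qed.

Lemma nmD X Y : X \in L2 -> Y \in L2 -> nm (fun w => X w + Y w) <= nm X + nm Y.
Proof.
move=> X2 Y2.
rewrite -(@ler_pXn2r _ 2)// ?nnegrE ?addr_ge0 ?nm_ge0// nm_sqr.
rewrite ipDl// ?ipDr//; last exact: Lfun2D.
have := le_trans (ler_norm _) (ip_CS X2 Y2); rewrite -!/(nm _) -!nm_sqr (ipC Y X) => XY.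
by rewrite -subr_ge0; move: XY; rewrite -subr_ge0 => /(mulr_ge0 (ler0n R 2)); congr (0 <= _); ring.
Qed.

Lemma nmN X : nm (fun w => - X w) = nm X.
Proof. by congr Num.sqrt; apply: eq_Rintegral => w _; rewrite mulrNN. Qed.

Lemma nm_triangle X Y Z : X \in L2 -> Y \in L2 -> Z \in L2 ->
  nm (fun w => X w - Z w) <= nm (fun w => X w - Y w) + nm (fun w => Y w - Z w).
Proof.
move=> X2 Y2 Z2.
rewrite (_ : (fun w => X w - Z w) = (fun w => (X w - Y w) + (Y w - Z w))).
  by apply: nmD; exact: Lfun2B.
by apply/funext => w; rewrite addrA subrK.
Qed.

Lemma nm_distC X Y : nm (fun w => X w - Y w) = nm (fun w => Y w - X w).
Proof. by rewrite -nmN; congr nm; apply/funext => w; rewrite opprB. Qed.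

Lemma integral_sqr_nm X : X \in L2 ->
  (\int[P]_w (X w ^+ 2)%:E = (nm X ^+ 2)%:E)%E.
Proof.
move=> X2; have [_ iX] := (Lfun2P X).1 X2.
rewrite nm_sqr /ip /Rintegral; under [in RHS]eq_integral do rewrite -expr2.
by rewrite fineK//; exact: integrable_fin_num.
Qed.

Lemma Lnorm2_nm X : X \in L2 -> ('N[P]_(2%:E)[EFin \o X] = (nm X)%:E)%E.
Proof.
move=> X2; have iX := Lfun2_mul_integrable X2 X2.
rewrite unlock.
have -> : (\int[P]_x (`|(EFin \o X) x| `^ 2) = (ip X X)%:E)%E.
  rewrite /ip /Rintegral fineK; last exact: integrable_fin_num.
  apply: eq_integral => w _ /=.
  by rewrite powR_mulrn// real_normK// ?num_real// expr2.
by rewrite poweR_EFin /nm -powR12_sqrt// ip_ge0.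
Qed.

Lemma L2_cvgP {I : Type} (F : set_system I) {FF : Filter F} (X_ : I -> T -> R) X :
  L2_cvg P F X_ X <-> [/\ \forall i \near F, X_ i \in L2, X \in L2 &
    nm (fun w => X_ i w - X w) @[i --> F] --> (0 : R)].
Proof.
split => -[X_2 X2 XX]; split => //.
  have : fine ('N[P]_(2%:E)[EFin \o (X_ i \- X)%R]) @[i --> F] --> (0 : R).
    exact: fine_cvg XX.
  apply: cvg_trans; apply: near_eq_cvg.
  by near=> i; rewrite /= Lnorm2_nm//; apply: Lfun2B => //; near: i.
apply: (@cvg_EFin _ _ _ _ _ 0).
  by near=> i; rewrite Lnorm2_nm//; apply: Lfun2B => //; near: i.
move: XX; apply: cvg_trans; apply: near_eq_cvg.
by near=> i; rewrite /= Lnorm2_nm//; apply: Lfun2B => //; near: i.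
Unshelve. all: by end_near. Qed.

End L2space.

(** Fatou's lemma for a limit known only almost everywhere: [g] is replaced by the lower limit of
    the sequence, and a common bound on the integrals passes to it. *)
Lemma fatou_bound {d : measure_display} {T : measurableType d} {R : realType}
    (mu : {measure set T -> \bar R}) (f : nat -> T -> \bar R) (g : T -> \bar R)
    (c : \bar R) :
  (forall n, measurable_fun setT (f n)) -> (forall n x, 0 <= f n x)%E ->
  measurable_fun setT g -> (forall x, 0 <= g x)%E ->
  {ae mu, forall x, f n x @[n --> \oo] --> g x} ->
  (forall n, \int[mu]_x f n x <= c)%E -> (\int[mu]_x g x <= c)%E.
Proof.
move=> mf f0 mg g0 fg fc.
have := fatou mu measurableT mf (fun n x _ => f0 n x).
have -> : (\int[mu]_x limn_einf (f^~ x) = \int[mu]_x g x)%E.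
  apply: ae_eq_integral => //.
    apply: (@eq_measurable_fun _ _ _ _ _ (fun x => - limn_esup (fun n => - f n x))%E).
      by move=> x _; rewrite limn_esupN oppeK.
    apply: measurableT_comp => //; apply: measurable_fun_limn_esup => n.
    exact: measurableT_comp.
  apply: filterS fg => x fg _; by rewrite (cvg_limn_einf_sup fg).1.
move=> H; apply: le_trans H _.
rewrite limn_einf_lim; apply: lime_le; first exact: is_cvg_einfs.
apply: nearW => n; apply: le_trans (fc n).
by apply: ereal_inf_lbound; exists n => /=.
Qed.

Section RieszFischer.
Context {d : measure_display} {T : measurableType d} {R : realType}.
Variable P : probability T R.
Local Notation L2 := (Lfun P 2%:E).

(** An upper limit is defined at every point and is measurable whenever the terms are, jointly in
    any parameters; it is the limit wherever the sequence converges. Infinite values become 0 under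
    [fine]. *)
Definition limsup_fun (Z : nat -> T -> R) (w : T) : R :=
  fine (limn_esup (fun n => (Z n w)%:E)).

Lemma measurable_limsup_fun (D : set T) (Z : nat -> T -> R) :
  measurable D -> (forall n, measurable_fun D (Z n)) ->
  measurable_fun D (limsup_fun Z).
Proof.
move=> mD mZ; apply: (@measurableT_comp _ _ _ _ _ _ fine) => //.
by apply: measurable_fun_limn_esup => n; exact/measurable_EFinP.
Qed.

Lemma integral_abs_le_nm (X : T -> R) : X \in L2 ->
  (\int[P]_w `|X w|%:E <= (nm P X)%:E)%E.
Proof.
move=> X2; have iX := Lfun2_integrable X2.
have one2 : (fun _ : T => 1) \in L2.
  by apply/Lfun2P; split => //; apply: finite_measure_integrable_cst.
have aX2 : (fun w => `|X w|) \in L2.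
  have [mX sX] := (Lfun2P P X).1 X2.
  apply: (Lfun2_dominated _ sX); first exact: measurableT_comp.
  by move=> w; rewrite real_normK// num_real.
rewrite -[leLHS]fineK; last first.
  apply: integrable_fin_num => //; exact: (integrable_norm iX).
rewrite lee_fin.
have := le_trans (ler_norm _) (ip_CS aX2 one2).
rewrite [X in _ * Num.sqrt X](_ : _ = 1); last first.
  by rewrite /ip Rintegral_cst//= probability_setT/= !mulr1.
rewrite sqrtr1 mulr1 /ip.
rewrite [X in _ <= Num.sqrt X](_ : _ = ip P X X); last first.
  by apply: eq_Rintegral => w _; rewrite -normrM ger0_norm// -expr2 sqr_ge0.
by apply: le_trans; rewrite /Rintegral; under [in leRHS]eq_integral do rewrite mulr1.
Qed.

(** The L^1 norm is at most the L^2 norm, so the sum of the absolute differences of consecutive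
    terms has finite expectation. It is finite almost everywhere, and there the telescoping series
    converges absolutely. *)
Lemma cvg_ae_fast_cauchy (Z : nat -> T -> R) :
  (forall n, Z n \in L2) ->
  (forall n, nm P (fun w => Z n w - Z n.+1 w) <= 2 ^- n) ->
  {ae P, forall w, cvgn (fun n => Z n w)}.
Proof.
move=> Z2 Zn.
have mZ n := Lfun2_measurable (Z2 n).
pose h n w := `|Z n w - Z n.+1 w|.
have mh n : measurable_fun setT (fun w => (h n w)%:E).
  by apply/measurable_EFinP; apply: measurableT_comp => //; exact: measurable_funB.
have h0 n w : (0 <= (h n w)%:E)%E by rewrite lee_fin normr_ge0.
have Sfin : (\int[P]_w (\sum_(n <oo) (h n w)%:E) < +oo)%E.
  rewrite integral_nneseries//.
  (* The bound [2 ^- n] is rewritten as [2 / 2 ^ n.+1], the shape whose series [epsilon_trick0]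
     sums. *)
  apply: (@le_lt_trans _ _ (\sum_(n <oo) (2 / (2 ^ n.+1)%:R)%:E)%E).
    apply: lee_nneseries => [n _ _|n _]; first by apply: integral_ge0 => w _; rewrite lee_fin normr_ge0.
    apply: (le_trans (integral_abs_le_nm (Lfun2B (Z2 _) (Z2 _)))).
    rewrite lee_fin (le_trans (Zn n))// natrX exprS.
    by rewrite invfM mulrA divff ?mul1r// pnatr_eq0.
  by apply: le_lt_trans (epsilon_trick0 _ _) _; rewrite ?ltry.
have iS : P.-integrable setT (fun w => \sum_(n <oo) (h n w)%:E)%E.
  apply/integrableP; split; first by apply: ge0_emeasurable_sum => // n w _ _; rewrite lee_fin normr_ge0.
  rewrite (eq_integral (fun w => \sum_(n <oo) (h n w)%:E)%E); first exact: Sfin.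
  by move=> w _; rewrite gee0_abs//; apply: nneseries_ge0 => n _ _; rewrite lee_fin normr_ge0.
have := integrable_ae measurableT iS; apply: filterS => w /(_ I) Sw.
have cn : cvgn [normed series (fun n => Z n.+1 w - Z n w)].
  apply: nondecreasing_is_cvgn.
    by apply: nondecreasing_series => n _ _; exact: normr_ge0.
  exists (fine (\sum_(n <oo) (h n w)%:E)%E) => _ [n _ <-].
  rewrite -lee_fin fineK//.
  apply: le_trans (@nneseries_lim_ge _ _ _ 0%N n _); last by [].
  rewrite sumEFin lee_fin /normed_series_of /series/=; apply: ler_sum => i _.
  by rewrite /h distrC.
have /cvg_ex[l cl] := normed_cvg cn.
apply/cvg_ex; exists (Z 0%N w + l).
rewrite [X in X @ _](_ : _ = (fun n => Z 0%N w + series (telescope (fun n => Z n w)) n)).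
  by apply: cvgD; [exact: cvg_cst|exact: cl].
by apply/funext => n; rewrite -(eq_sum_telescope (fun n => Z n w)).
Qed.

(** The geometric rate makes the whole sequence converge almost everywhere, so the limit is the
    explicit [limsup_fun Z], with no passage to a subsequence; Fatou's lemma in [m] then gives the
    L^2 rate. *)
Lemma riesz_fischer (Z : nat -> T -> R) :
  (forall n, Z n \in L2) ->
  (forall n m, (n <= m)%N -> nm P (fun w => Z n w - Z m w) <= 2 ^- n) ->
  limsup_fun Z \in L2 /\
  forall n, nm P (fun w => Z n w - limsup_fun Z w) <= 2 ^- n.
Proof.
move=> Z2 Znm; set X := limsup_fun Z.
have mZ n := Lfun2_measurable (Z2 n).
have mX : measurable_fun setT X by exact: measurable_limsup_fun.
have ZX : {ae P, forall w, Z n w @[n --> \oo] --> X w}.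
  have := cvg_ae_fast_cauchy Z2 (fun n => Znm n _ (leqnSn n)).
  apply: filterS => w cZ.
  suff -> : X w = limn (fun n => Z n w) by [].
  rewrite /X /limsup_fun (cvg_limn_einf_sup (_ : _ --> (limn (fun n => Z n w))%:E)).2//.
  by apply: cvg_EFin => //; exact: nearW.
have bnd n : (\int[P]_w ((Z n w - X w) ^+ 2)%:E <= ((2 ^- n) ^+ 2)%:E)%E.
  apply: (@fatou_bound _ _ _ P (fun m w => ((Z n w - Z (m + n)%N w) ^+ 2)%:E)).
  - by move=> m; apply/measurable_EFinP; apply: measurable_funX; exact: measurable_funB.
  - by move=> m w; rewrite lee_fin sqr_ge0.
  - by apply/measurable_EFinP; apply: measurable_funX; exact: measurable_funB.
  - by move=> w; rewrite lee_fin sqr_ge0.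
  - apply: filterS ZX => w ZX.
    apply: cvg_EFin; first exact: nearW.
    have ZX' : (Z n w - Z (m + n)%N w) @[m --> \oo] --> Z n w - X w.
      by apply: cvgB; [exact: cvg_cst|rewrite (cvg_shiftn n (fun m => Z m w))].
    rewrite /= expr2; under eq_fun do rewrite /= expr2.
    exact: cvgM.
  - move=> m.
    have L2B := Lfun2B (Z2 n) (Z2 (m + n)%N).
    rewrite integral_sqr_nm// lee_fin lerXn2r ?nnegrE ?nm_ge0 ?invr_ge0 ?exprn_ge0//.
    exact: Znm (leq_addl _ _).
have ZX2 n : (fun w => Z n w - X w) \in L2.
  apply/Lfun2P; split; first exact: measurable_funB.
  apply/integrableP; split.
    by apply/measurable_EFinP; apply: measurable_funX; exact: measurable_funB.
  under eq_integral do rewrite /= ger0_norm ?sqr_ge0//.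
  exact: le_lt_trans (bnd n) (ltry _).
split.
  have := Lfun2B (Z2 0%N) (ZX2 0%N).
  by under eq_fun do rewrite opprB addrC subrK.
move=> n; rewrite -(@ler_pXn2r _ 2)// ?nnegrE ?nm_ge0 ?invr_ge0 ?exprn_ge0//.
by rewrite -lee_fin -integral_sqr_nm//; exact: bnd.
Qed.

End RieszFischer.

(** * Gaussian moments and Wick powers *)

Section NormalMoments.
Context {R : realType}.
Local Notation mu := (@lebesgue_measure R).

Lemma integral_is_derive (f F : R -> R) (a b : R) : a <= b ->
  (forall x : R, is_derive x 1 F (f x)) -> continuous f ->
  \int[mu]_(x in `[a, b]) f x = F b - F a.
Proof.
rewrite le_eqVlt => /predU1P[->|ab] dF cf.
  by rewrite set_itv1 Rintegral_set1 subrr.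
rewrite /Rintegral (@continuous_FTC2 _ f F a b ab) ?EFinB//.
- exact: continuous_subspaceT.
- have dF1 (x : R) : derivable F x 1 by have [] := dF x.
  have cF (x : R) : F y @[y --> x] --> F x.
    exact/differentiable_continuous/derivable1_diffP.
  split.
  + by move=> x _; exact: dF1.
  + exact/cvg_at_right_filter/cF.
  + exact/cvg_at_left_filter/cF.
- by move=> x _; rewrite derive1E; apply: (@derive_val _ _ _ _ _ _ _ (dF x)).
Qed.

Lemma cvg_integral_expanding (f : R -> R) (a : R) :
  mu.-integrable setT (EFin \o f) ->
  \int[mu]_(x in `[a - n%:R, a + n%:R]) f x @[n --> \oo] --> \int[mu]_x f x.
Proof.
move=> fi.
have mf : measurable_fun setT f by apply/measurable_EFinP; case/integrableP: fi.
pose f_ n x := (f x * \1_(`[a - n%:R, a + n%:R]%classic : set R) x)%:E.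
have mf_ n : measurable_fun setT (f_ n).
  by apply/measurable_EFinP; apply: measurable_funM => //; exact: measurable_indic.
have [|||||_ _] := @dominated_convergence _ _ _ mu setT measurableT f_ (EFin \o f) (fun x => `|f x|%:E).
- exact: mf_.
- exact/measurable_EFinP.
- apply: aeW => x _; apply: cvg_near_cst.
  near=> n; rewrite /f_ indicE mem_set ?mulr1// /= in_itv/=.
  have : `|x - a| <= n%:R by near: n; exact: nbhs_infty_ger.
  by rewrite ler_norml => /andP[? ?]; apply/andP; split; lra.
- exact: (integrable_norm fi).
- apply: aeW => x n _; rewrite /f_ /= lee_fin normrM -[leRHS]mulr1.
  by apply: ler_wpM2l => //; rewrite indicE; case: (_ \in _); rewrite ?normr1 ?normr0.
have E : (EFin \o f) = (fun x => (f x)%:E) by [].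
rewrite (_ : (\int[mu]_x (EFin \o f) x)%E = (\int[mu]_x f x)%:E); last first.
  by rewrite /Rintegral fineK//; exact: integrable_fin_num.
move=> /fine_cvg; apply: cvg_trans; apply: near_eq_cvg; apply: nearW => n /=.
rewrite Rintegral_mkcond /Rintegral; congr fine; apply: eq_integral => x _.
by rewrite /f_ patchE indicE; case: (x \in _); rewrite ?mulr1 ?mulr0.
Unshelve. all: by end_near. Qed.

(** The moments of the standard normal law: (n - 1)!! for even [n] and 0 for odd [n]. *)
Fixpoint gauss_moment (n : nat) : nat :=
  match n with
  | 0 => 1
  | 1 => 0
  | n'.+2 => n'.+1 * gauss_moment n'
  end%N.

Variables (m s : R).
Hypothesis s0 : 0 < s.

Let F n (x : R) : R := (x - m) ^+ n * normal_pdf m s x.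

Let contF n : continuous (F n).
Proof.
move=> x; apply: cvgM; last by apply: continuous_normal_pdf; rewrite gt_eqF.
apply: (@continuous_comp _ _ _ (fun x => x - m) (fun x => x ^+ n)).
  by apply: cvgB; [exact: cvg_id|exact: cvg_cst].
exact: exprn_continuous.
Qed.

Lemma expr_le_fact_expR (n : nat) (x : R) : 0 <= x -> x ^+ n <= n`!%:R * expR x.
Proof.
case: n => [|n] x0; first by rewrite expr0 fact0 mul1r -[leLHS]addr0 (le_trans _ (expR_ge1Dx _))// lerD2l.
have := expR_ge1Dxn n x0.
rewrite -ler_pdivrMl ?ltr0n ?fact_gt0// => /(le_trans _); apply.
by rewrite mulrC ler_wpDl.
Qed.

Let boundF n : exists C : R, forall x, `|F n x| <= C * normal_pdf m (2 * s) x.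
Proof.
(* The exponential of -u^2/(2 s^2) is split into that of -u^2/c and the one with deviation [2 * s],
   since 1/(2 s^2) - 1/(8 s^2) = 3/(8 s^2). The first factor absorbs the polynomial; the final
   factor 2 is the ratio of the two peaks. *)
pose c := 8 / 3 * s ^+ 2.
have c0 : 0 < c by rewrite mulr_gt0 ?exprn_gt0//; lra.
exists ((1 + n`!%:R * c ^+ n) * 2) => x.
have s1 : s != 0 by rewrite gt_eqF.
have s2 : 2 * s != 0 by rewrite mulf_neq0 ?pnatr_eq0.
rewrite /F !normal_pdfE//.
have pk : normal_peak s = 2 * normal_peak (2 * s).
  rewrite /normal_peak (_ : (2 * s) ^+ 2 * pi *+ 2 = 2 ^+ 2 * (s ^+ 2 * pi *+ 2)); last by ring.
  rewrite sqrtrM ?sqr_ge0//.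
  by rewrite sqrtr_sqr ger0_norm// invfM mulrA divff ?mul1r ?pnatr_eq0.
rewrite pk /normal_fun.
set p := normal_peak (2 * s); have p0 : 0 <= p by exact: normal_peak_ge0.
set u := x - m.
have -> : expR (- u ^+ 2 / (s ^+ 2 *+ 2)) =
   expR (- (u ^+ 2 / c)) * expR (- u ^+ 2 / ((2 * s) ^+ 2 *+ 2)).
  by rewrite -expRD; congr expR; rewrite /c; field.
rewrite !normrM (ger0_norm (expR_ge0 _)) [`|expR (- u ^+ 2 / _)|]ger0_norm ?expR_ge0//.
rewrite [`|2|]ger0_norm// (ger0_norm p0).
set E2 := expR (- u ^+ 2 / _); have E20 : 0 <= E2 by exact: expR_ge0.
rewrite (_ : _ * (2 * p * _) = (`|u ^+ n| * expR (- (u ^+ 2 / c))) * (2 * p * E2)); last by ring.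
rewrite (_ : _ * 2 * (p * E2) = (1 + n`!%:R * c ^+ n) * (2 * p * E2)); last by ring.
apply: ler_wpM2r; first by rewrite !mulr_ge0.
rewrite -ler_pdivlMr ?expR_gt0// -expRN opprK.
have v0 : 0 <= u ^+ 2 / c by rewrite divr_ge0 ?sqr_ge0 ?ltW.
have h1 : `|u ^+ n| <= 1 + (u ^+ 2) ^+ n.
  rewrite -exprM mulnC exprM -real_normK ?num_real//.
  set z := `|u ^+ n|; have := sqr_ge0 (z - 1); have : 0 <= z by exact: normr_ge0.
  nra.
apply: (le_trans h1); rewrite mulrDl mul1r; apply: lerD.
  by rewrite -expR0 ler_expR.
rewrite -mulrA [c ^+ n * _]mulrC mulrA -ler_pdivrMr ?exprn_gt0//.
rewrite -expr_div_n; exact: expr_le_fact_expR.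
Qed.

Lemma integrable_normal_moment n : mu.-integrable setT (EFin \o F n).
Proof.
have [C HC] := boundF n.
have iC := integrableZl measurableT C (integrable_normal_pdf m (2 * s)).
apply: le_integrable iC => //.
  by apply/measurable_EFinP; exact: continuous_measurable_fun.
move=> x _; rewrite /= lee_fin; apply: le_trans (HC x) (ler_norm _).
Qed.

(** Since [F n.+1 (m + y) = y * F n (m + y)] and [F n.+1] is bounded, [F n] is at most a constant
    over [k] at distance [k] from [m]. *)
Let F_cvg0 n : F n (m + k%:R) - F n (m - k%:R) @[k --> \oo] --> (0 : R).
Proof.
have [C HC] := boundF n.+1.
have [C0 HC0] : exists C0, forall x, `|F n.+1 x| <= C0.
  exists (`|C| * normal_peak (2 * s)) => x; apply: (le_trans (HC x)).
  have s2 : 2 * s != 0 by rewrite mulf_neq0 ?pnatr_eq0// gt_eqF.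
  apply: (@le_trans _ _ (`|C| * normal_pdf m (2 * s) x)).
    by apply: ler_wpM2r; [exact: normal_pdf_ge0|exact: ler_norm].
  by apply: ler_wpM2l => //; exact: normal_pdf_ub.
apply/cvgrPdist_le => e e0; near=> k.
have k0 : 0 < k%:R :> R by near: k; exact: nbhs_infty_gtr.
have kC : 2 * C0 / e <= k%:R by near: k; exact: nbhs_infty_ger.
rewrite sub0r normrN.
have B y : `|y| = k%:R -> `|F n (m + y)| <= C0 / k%:R.
  move=> yk; rewrite ler_pdivlMr// -yk -normrM; apply: le_trans (HC0 (m + y)).
  by rewrite le_eqVlt; apply/orP; left; apply/eqP; congr `|_|; rewrite /F exprS (addrC m) addrK; ring.
apply: (le_trans (ler_normB _ _)).
apply: (@le_trans _ _ (C0 / k%:R + C0 / k%:R)).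
  by apply: lerD; apply: B; rewrite ?normrN ger0_norm// ltW.
move: kC; rewrite ler_pdivrMr// => kC.
rewrite -mulrDl ler_pdivrMr//; lra.
Unshelve. all: by end_near. Qed.

Let derF n (x : R) : is_derive x 1 (F n) (n%:R * F n.-1 x - s ^- 2 * F n.+1 x).
Proof.
have s1 : s != 0 by rewrite gt_eqF.
rewrite /F normal_pdfE//.
have dpdf : is_derive x 1 (fun x => normal_peak s * normal_fun m s x)
    (- (x - m) / s ^+ 2 * (normal_peak s * normal_fun m s x)).
  have dq : is_derive x 1 (fun x : R => - (x - m) ^+ 2 / (s ^+ 2 *+ 2)) (- (x - m) / s ^+ 2).
    have dsub : is_derive x 1 (fun x : R => x - m) 1.
      by apply: is_derive_eq; rewrite subr0.
    have := @is_deriveX _ _ (fun x : R => x - m) 2 x 1 1 dsub.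
    move=> dX.
    have := @is_deriveM _ _ _ _ x 1 _ _ (is_deriveN dX) (is_derive_cst ((s ^+ 2 *+ 2)^-1 : R) x 1).
    move=> d; apply: (is_derive_eq d).
    by rewrite scaler0 add0r /= /GRing.scale/= expr1; field.
  have := @is_derive1_comp _ expR (fun x => - (x - m) ^+ 2 / (s ^+ 2 *+ 2)) x _ _ (is_derive_expR _) dq.
  move=> dE.
  have := @is_deriveM _ _ _ _ x 1 _ _ (is_derive_cst (normal_peak s : R) x 1) dE.
  move=> d; have d' : is_derive x 1 (fun x => normal_peak s * normal_fun m s x) _ := d.
  apply: (is_derive_eq d').
  by rewrite scaler0 addr0 /GRing.scale/= /normal_fun; ring.
have dsub : is_derive x 1 (fun x : R => x - m) 1.
  by apply: is_derive_eq; rewrite subr0.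
have dX := @is_deriveX _ _ (fun x : R => x - m) n x 1 1 dsub.
rewrite exprfctE in dX.
have := @is_deriveM _ _ _ _ x 1 _ _ dX dpdf.
move=> d; have d' : is_derive x 1 (fun x => (x - m) ^+ n * (normal_peak s * normal_fun m s x)) _ := d.
apply: (is_derive_eq d').
rewrite /GRing.scale/= [(x - m) ^+ n.+1]exprS; by field.
Qed.

(** Integration by parts: [derF] is integrated over growing intervals centred at [m], the boundary
    terms vanish, and the moments of orders [k.-1] and [k.+1] are linked. For [k = 0] this says that
    the first moment is 0. *)
Lemma integral_normal_moment n :
  \int[mu]_x F n x = (gauss_moment n)%:R * s ^+ n.
Proof.
have iF := integrable_normal_moment.
have step k : k%:R * (\int[mu]_x F k.-1 x) = s ^- 2 * \int[mu]_x F k.+1 x.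
  apply/eqP; rewrite -subr_eq0; apply/eqP.
  have iA : mu.-integrable setT (EFin \o (fun x => k%:R * F k.-1 x)).
    have := integrableZl measurableT k%:R (iF k.-1).
    by apply: eq_integrable.
  have iB : mu.-integrable setT (EFin \o (fun x => s ^- 2 * F k.+1 x)).
    have := integrableZl measurableT (s ^- 2) (iF k.+1).
    by apply: eq_integrable.
  rewrite -!RintegralZl// -RintegralB//.
  have iAB : mu.-integrable setT (EFin \o (fun x => k%:R * F k.-1 x - s ^- 2 * F k.+1 x)).
    have := integrableB measurableT iA iB.
    by apply: eq_integrable.
  have E : (fun j : nat => \int[mu]_(x in `[m - j%:R, m + j%:R])
      (k%:R * F k.-1 x - s ^- 2 * F k.+1 x)) =
      (fun j : nat => F k (m + j%:R) - F k (m - j%:R)).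
    apply/funext => j; apply: integral_is_derive.
    - by rewrite lerBlDr -addrA lerDl addr_ge0.
    - exact: derF.
    - by move=> x; apply: cvgB; (apply: cvgM; [exact: cvg_cst|exact: contF]).
  have := cvg_integral_expanding m iAB; rewrite E => H.
  exact: (cvg_unique _ H (@F_cvg0 k)).
have s1 : s != 0 by rewrite gt_eqF.
elim/ltn_ind: n => -[|[|n]] IH.
- rewrite mulr1 /F; under eq_Rintegral do rewrite mul1r.
  by rewrite /Rintegral integral_normal_pdf.
- have := step 0%N; rewrite mul0r => /esym/eqP; rewrite mulf_eq0 invr_eq0 expf_eq0/= (negbTE s1)/=.
  by move=> /eqP ->; rewrite mul0r.
- have := step n.+1; rewrite /= IH//= => E.
  have -> : \int[mu]_x F n.+2 x = s ^+ 2 * (n.+1%:R * ((gauss_moment n)%:R * s ^+ n)).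
    by rewrite E mulrA divff ?mul1r// expf_neq0.
  rewrite natrM !exprS; ring.
Qed.

End NormalMoments.

(** The Radon-Nikodym derivative of the normal law and [normal_pdf] have the same integral over
    every measurable set, so they agree almost everywhere. *)
Lemma ge0_integral_normal_prob {R : realType} (m s : R) (f : R -> \bar R) :
  measurable_fun setT f -> (forall x, 0 <= f x)%E ->
  (\int[normal_prob m s]_x f x =
   \int[lebesgue_measure]_x (f x * (normal_pdf m s x)%:E))%E.
Proof.
move=> mf f0.
have dom := normal_prob_dominates m s.
rewrite -(Radon_Nikodym_SigmaFinite.change_of_variables dom)//.
have iRN := Radon_Nikodym_SigmaFinite.f_integrable dom.
have mpdf : measurable_fun setT (fun x : R => (normal_pdf m s x)%:E).
  by apply/measurable_EFinP; exact: measurable_normal_pdf.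
apply: ae_eq_integral => //.
- by apply: emeasurable_funM => //; exact: measurable_int iRN.
- exact: emeasurable_funM.
- apply: ae_eqe_mul2l; apply: integral_ae_eq => // E _ mE.
  by rewrite -(Radon_Nikodym_SigmaFinite.f_integral dom).
Qed.

Section GaussianMoments.
Context {d : measure_display} {T : measurableType d} {R : realType}.
Variable P : probability T R.
Implicit Types X : T -> R.

(** A centred Gaussian variable is recorded by its moments instead of its law: this treats the
    degenerate case like the others, suffices for Wick powers, and passes to L^2 limits. *)
Definition gauss_moments X : Prop := measurable_fun setT X /\
  forall n, P.-integrable setT (EFin \o (fun w => X w ^+ n)) /\
    \int[P]_w (X w ^+ n) = (gauss_moment n)%:R * nm P X ^+ n.

Lemma integral_normal_law X (m s : R) (h : R -> R) : measurable_fun setT X ->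
  (forall A, measurable A -> P (X @^-1` A) = normal_prob m s A) ->
  measurable_fun setT h ->
  lebesgue_measure.-integrable setT (EFin \o (fun x => h x * normal_pdf m s x)) ->
  P.-integrable setT (EFin \o (fun w => h (X w))) /\
  \int[P]_w h (X w) = \int[lebesgue_measure]_x (h x * normal_pdf m s x).
Proof.
move=> mX PX mh ih.
have ge0_case (g : R -> \bar R) : measurable_fun setT g -> (forall x, 0 <= g x)%E ->
    (\int[P]_w g (X w) = \int[lebesgue_measure]_x (g x * (normal_pdf m s x)%:E))%E.
  move=> mg g0.
  have mX' : @measurable_fun _ _ T (measurableTypeR R) setT X by exact: mX.
  pose X' : {mfun T >-> measurableTypeR R} := HB.pack X
    (isMeasurableFun.Build d ((R.-ocitv).-measurable).-sigma%mdisp T (measurableTypeR R) X mX').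
  rewrite -ge0_integral_normal_prob//.
  transitivity (\int[pushforward P X']_x g x)%E.
    by rewrite ge0_integral_pushforward.
  by apply: eq_measure_integral => A mA _; exact: PX.
have pdf0 x : (0 <= (normal_pdf m s x)%:E)%E by rewrite lee_fin normal_pdf_ge0.
have meh : measurable_fun setT (EFin \o h) by exact/measurable_EFinP.
have mehX : measurable_fun setT (EFin \o (fun w => h (X w))).
  by apply/measurable_EFinP; exact: measurableT_comp.
split.
  apply/integrableP; split => //.
  have -> : (\int[P]_w `|(h (X w))%:E| =
      \int[lebesgue_measure]_x ((`|h x|)%:E * (normal_pdf m s x)%:E))%E.
    rewrite -(ge0_case (fun x => (`|h x|)%:E))//.
    by apply/measurable_EFinP; exact: measurableT_comp.
  case/integrableP : ih => _; apply: le_lt_trans.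
  rewrite le_eqVlt; apply/orP; left; apply/eqP; apply: eq_integral => x _ /=.
  by rewrite normrM EFinM (ger0_norm (normal_pdf_ge0 _ _ _)).
rewrite /Rintegral; congr fine; rewrite integralE [RHS]integralE; congr (_ - _)%E.
- rewrite (eq_integral (fun w => (EFin \o h)^\+ (X w))%E); last by move=> w _; rewrite !funeposE.
  rewrite ge0_case//; last exact: measurable_funepos.
  apply: eq_integral => x _; rewrite !funeposE.
  by rewrite maxe_pMl// mul0e.
- rewrite (eq_integral (fun w => (EFin \o h)^\- (X w))%E); last by move=> w _; rewrite !funenegE.
  rewrite ge0_case//; last exact: measurable_funeneg.
  apply: eq_integral => x _; rewrite !funenegE.
  by rewrite maxe_pMl// mul0e mulNe.
Qed.

(** The law in [gaussian_rv] may have any mean; the vanishing expectation forces [m = 0], and the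
    second moment then identifies the norm of [X] with [s]. *)
Lemma gaussian_rv_moments X : gaussian_rv P X -> ('E_P[X] = 0)%E ->
  gauss_moments X.
Proof.
move=> [mX [m [s [s0 PX]]]] EX0; split => //.
have EX : \int[P]_w X w = 0 by move: EX0; rewrite unlock /Rintegral => ->.
have [s_eq0|s_neq0] := eqVneq s 0.
  rewrite s_eq0 eqxx in PX.
  have Xm : {ae P, forall w, X w = m}.
    exists (~` (X @^-1` [set m])); split => //.
    - by apply: measurableC; rewrite -[X in measurable X]setTI; exact: mX.
    - rewrite probability_setC; last by rewrite -[X in measurable X]setTI; exact: mX.
      by rewrite PX//= /dirac indicE mem_set//= subee.
  have key (h : R -> R) : measurable_fun setT h ->
      P.-integrable setT (EFin \o (fun w => h (X w))) /\ \int[P]_w h (X w) = h m.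
    move=> mh; have mhX : measurable_fun setT (EFin \o (fun w => h (X w))).
      by apply/measurable_EFinP; exact: measurableT_comp.
    have hXm : ae_eq P setT (EFin \o (fun w => h (X w))) (EFin \o cst (h m)).
      by apply: filterS Xm => w Xw _ /=; rewrite Xw.
    split; last first.
      transitivity (\int[P]_(_ in setT) h m); last first.
        by rewrite Rintegral_cst//= probability_setT/= mulr1.
      by congr fine; apply: ae_eq_integral.
    have ic : P.-integrable setT (EFin \o cst (h m)) by exact: finite_measure_integrable_cst.
    apply/integrableP; split => //.
    rewrite (ae_eq_integral (fun w => `|(EFin \o cst (h m)) w|)%E)//.
    - by have /integrableP[] := ic.
    - exact: measurableT_comp.
    - exact: (@measurable_cst _ _ _ _ _ (`|(h m)%:E|%E)).
    - by apply: filterS Xm => w Xw _ /=; rewrite Xw.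
  have m0 : m = 0 by rewrite -EX; have [_ ->] := key id (@measurable_id _ _ _).
  have nm0 : nm P X = 0.
    rewrite /nm; have -> : ip P X X = 0.
      rewrite /ip; under eq_Rintegral do rewrite -expr2.
      by have [_ ->] := key (fun x => x ^+ 2) (exprn_measurable _); rewrite m0 expr0n.
    by rewrite sqrtr0.
  have gm0 k : 0 ^+ k = (gauss_moment k)%:R * 0 ^+ k :> R.
    by case: k => [|k]; rewrite ?expr0 ?mulr1// expr0n mulr0.
  move=> n; have [iXn ->] := key (fun x => x ^+ n) (exprn_measurable _); split => //.
  by rewrite m0 nm0.
rewrite (negbTE s_neq0) in PX.
have s_gt0 : 0 < s by rewrite lt0r s_neq0.
have mxm n : measurable_fun setT (fun x : R => (x - m) ^+ n).
  by apply: measurable_funX; exact: measurable_funB.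
have key n := integral_normal_law mX PX (mxm n) (integrable_normal_moment m s_gt0 n).
have m0 : m = 0.
  have [i1] := key 1%N; rewrite integral_normal_moment//= mul0r.
  have iX : P.-integrable setT (EFin \o X).
    have icst : P.-integrable setT (EFin \o cst m) by exact: finite_measure_integrable_cst.
    have := integrableD measurableT i1 icst.
    by apply: eq_integrable => // w _ /=; rewrite -EFinD expr1 subrK.
  under eq_Rintegral do rewrite expr1.
  rewrite RintegralB//; last exact: finite_measure_integrable_cst.
  rewrite EX Rintegral_cst//= probability_setT/= mulr1 sub0r => /eqP.
  by rewrite oppr_eq0 => /eqP.
have key' n : P.-integrable setT (EFin \o (fun w => X w ^+ n)) /\
    \int[P]_w (X w ^+ n) = (gauss_moment n)%:R * s ^+ n.
  have := key n; rewrite integral_normal_moment// m0.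
  by under eq_fun do rewrite subr0.
have -> : nm P X = s.
  rewrite /nm /ip; under eq_Rintegral do rewrite -expr2.
  by have [_ ->] := key' 2%N; rewrite /= muln1 mul1r sqrtr_sqr ger0_norm.
exact: key'.
Qed.

End GaussianMoments.

Lemma polyP_eval {R : numFieldType} (p q : {poly R}) : (forall x, p.[x] = q.[x]) -> p = q.
Proof.
move=> pq; apply/eqP; rewrite -subr_eq0; apply/eqP.
(* The first [size (p - q)] natural numbers are distinct roots, one more than the degree allows. *)
apply: (@roots_geq_poly_eq0 _ _ (map (fun n : nat => n%:R) (iota 0 (size (p - q))))).
- by apply/allP => x _; rewrite rootE hornerD hornerN pq subrr.
- by rewrite map_inj_uniq ?iota_uniq// => m n /eqP; rewrite eqr_nat => /eqP.
- by rewrite size_map size_iota.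
Qed.

(** * Hermite polynomials of a given variance *)

Section HermitePoly.
Context {R : numFieldType} (v : R).

(** At a centred Gaussian variable of variance [v] these polynomials give the Wick powers. The
    three-term recursion, unlike the explicit sum, combines well with integration by parts. *)
Fixpoint hermite (k : nat) : {poly R} :=
  match k with
  | 0 => 1
  | 1 => 'X
  | (k'.+1 as k1).+1 => 'X * hermite k1 - (k1%:R * v) *: hermite k'
  end.

#[local] Arguments hermite : simpl never.

Lemma hermite0 : hermite 0 = 1. Proof. by []. Qed.
Lemma hermite1 : hermite 1 = 'X. Proof. by []. Qed.

Lemma hermiteSS k : hermite k.+2 = 'X * hermite k.+1 - (k.+1%:R * v) *: hermite k.
Proof. by []. Qed.

Lemma hermiteS k : hermite k.+1 = 'X * hermite k - (k%:R * v) *: hermite k.-1.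
Proof. by case: k => [|k]//; rewrite hermite1 hermite0 mul0r scale0r subr0 mulr1. Qed.

Lemma deriv_hermite k : (hermite k)^`() = k%:R *: hermite k.-1.
Proof.
elim/ltn_ind: k => -[|[|k]] IH.
- by rewrite hermite0 derivC scale0r.
- by rewrite hermite1 derivX scale1r.
- rewrite hermiteSS derivB derivM derivX mul1r derivZ !IH//= hermiteS.
  rewrite -!mul_polyC !polyCM -[k.+2%:R]natr1 -[k.+1%:R]natr1 !polyCD polyC1; ring.
Qed.

Let u k j : R := (-1) ^+ j * 'C(k, j.*2)%:R * (gauss_moment j.*2)%:R * v ^+ j.

(** The number [N] of terms is left free so that both terms of the recursion can be expanded over
    matching ranges. Surplus terms vanish through the binomial coefficient, whatever the truncated
    exponent [k - j.*2] is. *)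
Lemma hermite_horner k N (x : R) : (k < N.*2)%N ->
  (hermite k).[x] = \sum_(j < N) u k j * x ^+ (k - j.*2).
Proof.
have u0 k' : u k' 0 = 1 by rewrite /u bin0 !mul1r.
have ubig k' j : (k' < j.*2)%N -> u k' j = 0.
  by move=> kj; rewrite /u bin_small// mulr0 !mul0r.
elim/ltn_ind: k N => -[|[|k]] IH [|N]//.
- move=> _; rewrite hermite0 hornerC big_ord_recl u0 big1 ?addr0 ?mulr1//.
  by move=> i _; rewrite ubig ?mul0r.
- move=> _; rewrite hermite1 hornerX big_ord_recl u0 mul1r big1 ?addr0 ?mulr1//.
  by move=> i _; rewrite ubig ?mul0r.
- rewrite doubleS !ltnS => kN.
  rewrite hermiteSS !hornerE (IH k.+1 _ N.+1)//; last by rewrite doubleS !ltnS ltnW.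
  rewrite (IH k _ N)//.
  rewrite mulr_sumr big_ord_recl [RHS]big_ord_recl !u0 -addrA; congr (_ + _).
    by rewrite !subn0 mul1r mul1r -exprS.
  rewrite mulr_sumr -sumrB; apply: eq_bigr => j _.
  rewrite lift0 doubleS !subSS.
  (* Pascal's rule splits the binomial coefficient. In the second part the factor 2j+1 gained by the
     Gaussian moment is absorbed through (2j+1) C(k+1, 2j+1) = (k+1) C(k, 2j). *)
  have E : u k.+2 j.+1 = u k.+1 j.+1 - k.+1%:R * v * u k j.
    rewrite /u doubleS binS natrD /= natrM !exprS.
    have := mul_bin_diag k.+1 j.*2; move=> /(congr1 (fun n => n%:R : R)); rewrite /= !natrM => E.
    have E' : 'C(k.+1, j.*2.+1)%:R * j.*2.+1%:R = k.+1%:R * 'C(k, j.*2)%:R :> R by rewrite mulrC -E.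
    transitivity (-1 * (-1) ^+ j * ('C(k.+1, j.*2.+2)%:R) * (j.*2.+1%:R * (gauss_moment j.*2)%:R) * (v * v ^+ j) - (-1) ^+ j * ('C(k.+1, j.*2.+1)%:R * j.*2.+1%:R) * (gauss_moment j.*2)%:R * (v * v ^+ j)); first by ring.
    by rewrite E'; ring.
  rewrite E mulrBl; congr (_ - _); last by rewrite mulrA.
  case: (ltnP k j.*2.+1) => kj; first by rewrite ubig ?doubleS// !mul0r mulr0.
  by rewrite mulrCA -exprS -subSn.
Qed.

End HermitePoly.

(** * Covariance of the Wick powers of two jointly Gaussian variables *)

Section WickIsometry.
Context {d : measure_display} {T : measurableType d} {R : realType}.
Variable P : probability T R.
Local Notation L2 := (Lfun P 2%:E).

Lemma gauss_moments_Lfun2 (X : T -> R) : gauss_moments P X -> X \in L2.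
Proof. by move=> [mX gX]; apply/Lfun2P; split => //; have [] := gX 2%N. Qed.

Variables X Y : T -> R.
Hypothesis gXY : forall s t : R, gauss_moments P (fun w => s * X w + t * Y w).

Let gX : gauss_moments P X.
Proof. by have := gXY 1 0; under eq_fun do rewrite mul1r mul0r addr0. Qed.
Let gY : gauss_moments P Y.
Proof. by have := gXY 0 1; under eq_fun do rewrite mul1r mul0r add0r. Qed.

Let mX : measurable_fun setT X. Proof. by case: gX. Qed.
Let mY : measurable_fun setT Y. Proof. by case: gY. Qed.
Let X2 : X \in L2. Proof. exact: gauss_moments_Lfun2. Qed.
Let Y2 : Y \in L2. Proof. exact: gauss_moments_Lfun2. Qed.

Let a := ip P X X.
Let b := ip P Y Y.
Let c := ip P X Y.
Let M i j := \int[P]_w (X w ^+ i * Y w ^+ j).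

Let iM i j : P.-integrable setT (EFin \o (fun w => X w ^+ i * Y w ^+ j)).
Proof.
have iXY : P.-integrable setT (EFin \o (fun w => X w ^+ (2 * i) + Y w ^+ (2 * j))).
  have := integrableD measurableT (proj2 gX (2 * i)%N).1 (proj2 gY (2 * j)%N).1.
  by apply: eq_integrable.
apply: le_integrable iXY => //.
  by apply/measurable_EFinP; apply: measurable_funM; exact: measurable_funX.
move=> w _; rewrite /= lee_fin normrM.
rewrite mulnC exprM mulnC exprM -[X in X + _]real_normK ?num_real// -[X in _ + X]real_normK ?num_real//.
rewrite [leRHS]ger0_norm; last by rewrite addr_ge0 ?sqr_ge0.
set x := `|_|; set y := `|_|.
have := sqr_ge0 (x - y); have := sqr_ge0 x; have := sqr_ge0 y; nra.
Qed.

Lemma nm_linear_sqr s : nm P (fun w => s * X w + 1 * Y w) ^+ 2 = a * s ^+ 2 + 2 * c * s + b.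
Proof.
rewrite nm_sqr; under [fun w => _]eq_fun do rewrite mul1r.
rewrite ipDl ?ipDr ?ipZl ?ipZr//; try exact: Lfun2Z; try exact: Lfun2D (Lfun2Z _ _) _.
by rewrite (ipC P Y X) -/a -/b -/c; ring.
Qed.

Let Vp : {poly R} := a *: 'X^2 + (2 * c) *: 'X + b%:P.
Let Pp n : {poly R} := \sum_(i < n.+1) ('C(n, i)%:R * M i (n - i)) *: 'X^i.

(** Both sides are the n-th moment of [s * X + Y] as a polynomial in [s]: by the binomial formula on
    the left, and on the right because the combination is Gaussian with variance [Vp]. For odd [n]
    the moment is 0, so the rounding in [n./2] is harmless. *)
Let PpE n : Pp n = (gauss_moment n)%:R *: Vp ^+ (n./2).
Proof.
apply: polyP_eval => s.
rewrite hornerZ horner_exp /Vp !hornerE.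
transitivity (\int[P]_w ((s * X w + 1 * Y w) ^+ n)).
  rewrite /Pp horner_sum.
  have -> : \int[P]_w ((s * X w + 1 * Y w) ^+ n) =
      \int[P]_w (\sum_(i < n.+1) ('C(n, i)%:R * s ^+ i) * (X w ^+ i * Y w ^+ (n - i))).
    apply: eq_Rintegral => w _; rewrite mul1r addrC exprDn; apply: eq_bigr => i _.
    by rewrite exprMn -mulr_natl; ring.
  have isum (r : seq 'I_n.+1) : P.-integrable setT (EFin \o (fun w => \sum_(i <- r) ('C(n, i)%:R * s ^+ i) * (X w ^+ i * Y w ^+ (n - i)))) /\
     \int[P]_w (\sum_(i <- r) ('C(n, i)%:R * s ^+ i) * (X w ^+ i * Y w ^+ (n - i))) =
     \sum_(i <- r) (('C(n, i)%:R * M i (n - i)) *: 'X^i).[s].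
    elim: r => [|i r [IH1 IH2]].
      rewrite big_nil; split.
        by under eq_fun do rewrite big_nil; exact: finite_measure_integrable_cst.
      by under eq_Rintegral do rewrite big_nil; rewrite Rintegral_cst//= mul0r.
    have ii : P.-integrable setT (EFin \o (fun w => ('C(n, i)%:R * s ^+ i) * (X w ^+ i * Y w ^+ (n - i)))).
      have := integrableZl measurableT ('C(n, i)%:R * s ^+ i) (iM i (n - i)).
      by apply: eq_integrable.
    split.
      under eq_fun do rewrite big_cons.
      have := integrableD measurableT ii IH1.
      by apply: eq_integrable.
    under eq_Rintegral do rewrite big_cons.
    rewrite RintegralD// IH2 RintegralZl// big_cons; congr (_ + _).
    by rewrite hornerZ hornerXn -/(M _ _); ring.
  by have [_ ->] := isum (index_enum 'I_n.+1).
have [_ /(_ n)[_ ->]] := gXY s 1.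
have [n_odd|n_even] := boolP (odd n).
  suff -> : gauss_moment n = 0%N by rewrite !mul0r.
  have -> : n = n./2.*2.+1 by rewrite -[LHS]odd_double_half n_odd.
  by elim: (n./2) => //= k IH; rewrite IH muln0.
congr (_ * _).
rewrite -{1}[n](even_halfK n_even) -mul2n exprM nm_linear_sqr.
by rewrite expr2 mulrA.
Qed.

(** Differentiating a power of [Vp], whose derivative is twice [a *: 'X + c%:P], lowers the exponent
    by one, and [gauss_moment n.+2 = n.+1 * gauss_moment n] turns the rest back into [Pp n]. *)
Let Pp_deriv n : (Pp n.+2)^`() = (n.+2%:R * n.+1%:R) *: ((a *: 'X + c%:P) * Pp n).
Proof.
rewrite !PpE derivZ deriv_exp /= natrM.
have -> : Vp^`() = 2%:P * (a *: 'X + c%:P).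
  rewrite /Vp !derivD !derivZ derivXn derivX derivC addr0 /=.
  by rewrite -!mul_polyC ?expr1 !polyCM ?polyC_natr; ring.
have [n_odd|n_even] := boolP (odd n).
  suff -> : gauss_moment n = 0%N by rewrite mulr0 !scale0r mulr0 scaler0.
  have -> : n = n./2.*2.+1 by rewrite -[LHS]odd_double_half n_odd.
  by elim: (n./2) => //= k IH; rewrite IH muln0.
have -> : n.+2%:R = 2 * (n./2).+1%:R :> R.
  by rewrite -natrM mul2n doubleS even_halfK.
rewrite -!mul_polyC -[_ *+ (n./2).+1]mulr_natr !polyCM ?polyC_natr; ring.
Qed.

(* Comparing coefficients of s in the moments of s X + Y gives all mixed moments; differentiating in s gives a recursion. *)
Let M_rec i j : M i.+1 j = a * i%:R * M i.-1 j + c * j%:R * M i j.-1.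
Proof.
have [/eqP|ij0] := eqVneq (i + j)%N 0%N.
  rewrite addn_eq0 => /andP[/eqP -> /eqP ->].
  rewrite !mulr0 !mul0r addr0 /M; have [_ /(_ 1%N)[_]] := gX.
  rewrite /= mul0r => <-; apply: eq_Rintegral => w _; by rewrite expr0 mulr1.
have [n nE] : exists n, (i + j)%N = n.+1 by exists (i + j).-1; rewrite prednK ?lt0n.
have in1 : (i <= n.+1)%N by rewrite -nE leq_addr.
have jE : j = (n.+1 - i)%N by rewrite -nE addKn.
have coefP m k : (k <= m)%N -> (Pp m)`_k = 'C(m, k)%:R * M k (m - k).
  move=> km; rewrite /Pp coef_sum (bigD1 (Ordinal (km : k < m.+1)%N))//=.
  rewrite coefZ coefXn eqxx mulr1 big1 ?addr0// => l lk.
  rewrite coefZ coefXn [_ == _]negbTE ?mulr0//.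
  by apply: contraNN lk => /eqP kl; apply/eqP/val_inj.
have coefP0 m k : (m < k)%N -> (Pp m)`_k = 0.
  move=> km; rewrite /Pp coef_sum big1// => l _.
  rewrite coefZ coefXn [_ == _]negbTE ?mulr0//.
  by rewrite neq_ltn (leq_trans (ltn_ord l) km) orbT.
have := congr1 (fun p : {poly R} => p`_i) (Pp_deriv n).
have cr : ((a *: 'X + c%:P) * Pp n)`_i = a * (if i == 0%N then 0 else (Pp n)`_i.-1) + c * (Pp n)`_i.
  by rewrite mulrDl coefD -scalerAl coefZ coefXM coefCM.
rewrite /= coef_deriv coefP// subSS -jE coefZ cr.
have Cp : 'C(n.+1, i)%:R != 0 :> R by rewrite pnatr_eq0 -lt0n bin_gt0.
have e1 : i.+1%:R * 'C(n.+2, i.+1)%:R = n.+2%:R * 'C(n.+1, i)%:R :> R.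
  by rewrite -!natrM -(mul_bin_diag n.+2).
have e2 : n.+1%:R * (if i == 0%N then 0 else (Pp n)`_i.-1) = i%:R * 'C(n.+1, i)%:R * M i.-1 j.
  case: i in1 jE {nE Cp e1 ij0 cr} => [|i] in1 jE; first by rewrite mulr0 !mul0r.
  by rewrite /= coefP// mulrA -!natrM (mul_bin_diag n.+1) jE subSS.
have e3 : n.+1%:R * (Pp n)`_i = j%:R * 'C(n.+1, i)%:R * M i j.-1.
  move: in1; rewrite leq_eqVlt => /predU1P[iE|in1].
    by rewrite jE iE subnn coefP0// ?mulr0 ?mul0r// -iE.
  rewrite coefP// jE subSn//= mulrA -!natrM; congr (_%:R * _).
  by have := mul_bin_down n.+1 i; rewrite /= subSn// => <-; rewrite mulnC.
move=> E; apply: (mulfI Cp); apply: (mulfI (_ : n.+2%:R != 0 :> R)); first by rewrite pnatr_eq0.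
transitivity ('C(n.+2, i.+1)%:R * M i.+1 j *+ i.+1).
  by rewrite -[RHS]mulr_natl !mulrA e1.
rewrite E.
transitivity (n.+2%:R * (a * (n.+1%:R * (if i == 0%N then 0 else (Pp n)`_i.-1)) + c * (n.+1%:R * (Pp n)`_i))); first by ring.
by rewrite e2 e3; ring.
Qed.

Let L (p q : {poly R}) := \int[P]_w (p.[X w] * q.[Y w]).

Lemma integrable_poly2 (p q : {poly R}) :
  P.-integrable setT (EFin \o (fun w => p.[X w] * q.[Y w])).
Proof.
have main : P.-integrable setT (fun w => \sum_(i <- index_enum 'I_(size p)) \sum_(j <- index_enum 'I_(size q))
    (p`_i * q`_j * (X w ^+ i * Y w ^+ j))%:E)%E.
  apply: integrable_sum => // i _; apply: integrable_sum => // j _.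
  have := integrableZl measurableT (p`_i * q`_j) (iM i j).
  by apply: eq_integrable.
apply: eq_integrable main => // w _ /=.
rewrite !horner_coef mulr_suml -sumEFin; apply: eq_bigr => i _.
rewrite mulr_sumr -sumEFin; apply: eq_bigr => j _; congr EFin; ring.
Qed.

Let LDl p p' q : L (p + p') q = L p q + L p' q.
Proof.
rewrite /L -RintegralD//; [|exact: integrable_poly2..].
by apply: eq_Rintegral => w _; rewrite hornerD mulrDl.
Qed.

Let LDr p q q' : L p (q + q') = L p q + L p q'.
Proof.
rewrite /L -RintegralD//; [|exact: integrable_poly2..].
by apply: eq_Rintegral => w _; rewrite hornerD mulrDr.
Qed.

Let LZl k p q : L (k *: p) q = k * L p q.
Proof.
rewrite /L -RintegralZl//; last exact: integrable_poly2.
by apply: eq_Rintegral => w _; rewrite hornerZ mulrA.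
Qed.

Let LZr k p q : L p (k *: q) = k * L p q.
Proof.
rewrite /L -RintegralZl//; last exact: integrable_poly2.
by apply: eq_Rintegral => w _; rewrite hornerZ mulrCA.
Qed.

Let L0l q : L 0 q = 0.
Proof. by rewrite -(scale0r 0) LZl mul0r. Qed.

Let L0r p : L p 0 = 0.
Proof. by rewrite -(scale0r 0) LZr mul0r. Qed.

(** Gaussian integration by parts for the pair. Both sides are bilinear in the two polynomials, so
    monomials are enough, and there the identity is [M_rec]. *)
Let stein p q : L ('X * p) q = a * L p^`() q + c * L p q^`().
Proof.
have add_p q' (p1 p2 : {poly R}) :
    L ('X * p1) q' = a * L p1^`() q' + c * L p1 q'^`() ->
    L ('X * p2) q' = a * L p2^`() q' + c * L p2 q'^`() ->
    L ('X * (p1 + p2)) q' = a * L (p1 + p2)^`() q' + c * L (p1 + p2) q'^`().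
  by move=> e1 e2; rewrite mulrDr derivD !LDl e1 e2; ring.
have add_q p' (q1 q2 : {poly R}) :
    L ('X * p') q1 = a * L p'^`() q1 + c * L p' q1^`() ->
    L ('X * p') q2 = a * L p'^`() q2 + c * L p' q2^`() ->
    L ('X * p') (q1 + q2) = a * L p'^`() (q1 + q2) + c * L p' (q1 + q2)^`().
  by move=> e1 e2; rewrite derivD !LDr e1 e2; ring.
rewrite -[p]coefK -[q]coefK !poly_def.
elim/big_ind : _ => [|p1 p2|i _].
- by rewrite mulr0 linear0 !L0l !mulr0 addr0.
- exact: add_p.
elim/big_ind : _ => [|q1 q2|j _].
- by rewrite linear0 !L0r !mulr0 addr0.
- exact: add_q.
rewrite -scalerAr !derivZ !LZl !LZr -exprS !derivXn -(scaler_nat i) -(scaler_nat j) LZl LZr.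
have LX k l : L 'X^k 'X^l = M k l.
  by apply: eq_Rintegral => w _; rewrite !hornerXn.
by rewrite !LX M_rec; ring.
Qed.

(** Integration by parts replaces the factor ['X] of the recursion by derivatives, which lower the
    index. The term with [a] cancels the second term of the recursion, so orthogonality of different
    degrees never comes up; what remains is [c * k.+1] times the previous case. *)
Let L_hermite k : L (hermite a k) (hermite b k) = k`!%:R * c ^+ k.
Proof.
elim: k => [|k IH].
  rewrite mulr1 /L; under eq_Rintegral do rewrite !hornerC mulr1.
  by rewrite Rintegral_cst//= probability_setT/= mulr1.
rewrite hermiteS.
have -> : 'X * hermite a k - (k%:R * a) *: hermite a k.-1 = 'X * hermite a k + (- (k%:R * a)) *: hermite a k.-1.
  by rewrite scaleNr.
rewrite LDl LZl stein !deriv_hermite LZl LZr /= IH factS natrM exprS; ring.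
Qed.

Let wick_hermite k (Z : T -> R) : gauss_moments P Z ->
  wick_power P k Z = fun w => (hermite (ip P Z Z) k).[Z w].
Proof.
move=> [mZ gZ]; apply/funext => w.
rewrite (@hermite_horner _ _ _ (k./2.+1)); last first.
  by rewrite doubleS -{1}(odd_double_half k); case: (odd k).
apply: eq_bigr => j _; congr (_ * _); rewrite -!mulrA; congr (_ * (_ * _)).
rewrite unlock -/(Rintegral _ _ _); have [_ ->] := gZ j.*2.
by rewrite -[X in _ * _ ^+ X = _]mul2n exprM nm_sqr.
Qed.

Lemma wick_power_ip k :
  ip P (wick_power P k X) (wick_power P k Y) = k`!%:R * ip P X Y ^+ k.
Proof. by rewrite !wick_hermite//; exact: L_hermite. Qed.

Lemma wick_power_Lfun2 k : wick_power P k X \in L2.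
Proof.
rewrite wick_hermite//; apply/Lfun2P; split.
  have -> : (fun w => (hermite (ip P X X) k).[X w]) =
     (fun w => \sum_(i < size (hermite (ip P X X) k)) (hermite (ip P X X) k)`_i * X w ^+ i).
    by apply/funext => w; rewrite horner_coef.
  by apply: measurable_sum => i; apply: measurable_funM => //; exact: measurable_funX.
have := integrable_poly2 (hermite (ip P X X) k ^+ 2) 1.
by apply: eq_integrable => // w _ /=; rewrite hornerC mulr1 horner_exp.
Qed.

End WickIsometry.

(** * Reflected integrals, and the integral of a derivative that need not be continuous *)

Lemma integral_reflection {R : realType} (a : R) (f : R -> R) :
  measurable_fun setT f ->
  \int[lebesgue_measure]_x f (a - x) = \int[lebesgue_measure]_x f x.
Proof.
move=> mf; rewrite /Rintegral; congr fine; rewrite integralE [RHS]integralE.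
have mEf : measurable_fun setT (EFin \o f) by exact/measurable_EFinP.
congr (_ - _)%E.
- rewrite -[RHS](ge0_integral_reflection a)//; last exact: measurable_funepos.
  by apply: eq_integral => x _; rewrite !funeposE.
- rewrite -[RHS](ge0_integral_reflection a)//; last exact: measurable_funeneg.
  by apply: eq_integral => x _; rewrite !funenegE.
Qed.

Lemma integral_reflection_itv {R : realType} (t a b : R) (f : R -> R) :
  measurable_fun setT f ->
  \int[lebesgue_measure]_(s in `[a, b]) f (t - s) =
  \int[lebesgue_measure]_(u in `[t - b, t - a]) f u.
Proof.
move=> mf; rewrite Rintegral_mkcond [RHS]Rintegral_mkcond -[RHS](integral_reflection t).
  apply: eq_Rintegral => s _; rewrite !patchE !mem_setE !in_itv/=.
  by rewrite lerD2l lerN2 andbC lerD2l lerN2.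
by apply: (measurable_restrictT f (measurable_itv `[t - b, t - a])).1; exact: measurable_funTS.
Qed.

Lemma derivable_cvg_harmonic {R : realType} (f : R -> R) (x : R) : derivable f x 1 ->
  n.+1%:R * (f (x + n.+1%:R^-1) - f x) @[n --> \oo] --> f^`()%classic x.
Proof.
move=> df.
have H : h^-1 *: (f (h + x) - f x) @[h --> 0^'] --> f^`()%classic x.
  have := df; rewrite /derivable => /cvg_ex[l].
  under eq_fun do rewrite [_%:A]mulr1.
  by move=> fl; rewrite /derive1 (cvg_lim _ fl).
have hn : n.+1%:R^-1 @[n --> \oo] --> (0 : R)^'.
  move=> A HA; have [N _ HN] := @cvg_harmonic R _ HA.
  by exists N => // n Nn; apply: (HN n Nn); rewrite gt_eqF// invr_gt0.
have := cvg_comp _ _ hn H; apply: cvg_trans; apply: near_eq_cvg; apply: nearW => n /=.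
by rewrite /GRing.scale/= invrK [_ + x]addrC.
Qed.

(** Since [r] may be discontinuous, the difference quotients of [F] are integrated instead: they
    tend to [r] pointwise and are bounded by [C] through the mean value theorem. Their integrals are
    explicit in the primitive [G] of [F] and tend to the increment of [F]. The margin up to [b + 1]
    leaves room for steps of length at most 1. *)
Lemma integral_second_derivative {R : realType} (G F r : R -> R) (a b : R) : a <= b ->
  (forall x, a <= x <= b + 1 -> is_derive x 1 G (F x)) ->
  (forall x, a <= x <= b + 1 -> is_derive x 1 F (r x)) ->
  measurable_fun `[a, b] r ->
  (exists C, forall x, a <= x <= b + 1 -> `|r x| <= C) ->
  \int[lebesgue_measure]_(x in `[a, b]) r x = F b - F a.
Proof.
rewrite le_eqVlt => /predU1P[->|ab] dG dF mr [C rC].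
  by rewrite set_itv1 Rintegral_set1 subrr.
have cF x : a <= x <= b + 1 -> {for x, continuous F}.
  move=> xab; apply: differentiable_continuous; apply/derivable1_diffP.
  by have [] := dF x xab.
have cG x : a <= x <= b + 1 -> {for x, continuous G}.
  move=> xab; apply: differentiable_continuous; apply/derivable1_diffP.
  by have [] := dG x xab.
pose h n : R := n.+1%:R^-1.
have h0 n : 0 < h n by rewrite invr_gt0.
have h1 n : h n <= 1 by rewrite invf_le1// ler1n.
pose q n x := n.+1%:R * (F (x + h n) - F x).
have wcF u v : a <= u -> v <= b + 1 -> {within `[u, v], continuous F}.
  move=> au vb; apply: continuous_in_subspaceT => x; rewrite inE/= in_itv/= => /andP[ux xv].
  by apply: cF; rewrite (le_trans au ux) (le_trans xv vb).
have wcFh n : {within `[a, b], continuous (fun x => F (x + h n))}.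
  apply: continuous_in_subspaceT => x; rewrite inE/= in_itv/= => /andP[ax xb].
  apply: (@continuous_comp _ _ _ (fun x => x + h n) F).
    by apply: cvgD; [exact: cvg_id|exact: cvg_cst].
  by apply: cF; have := h0 n; have := h1 n => ? ?; apply/andP; split; lra.
have mq n : measurable_fun `[a, b] (q n).
  apply: measurable_funM => //; apply: measurable_funB.
    by apply: subspace_continuous_measurable_fun; [exact: measurable_itv|exact: wcFh].
  by apply: subspace_continuous_measurable_fun; [exact: measurable_itv|apply: wcF => //; lra].
have qr x : `[a, b]%classic x -> q n x @[n --> \oo] --> r x.
  rewrite /= in_itv/= => /andP[ax xb].
  have xab : a <= x <= b + 1 by apply/andP; split; lra.
  have [dFx dFxE] := dF x xab.
  by rewrite -dFxE -derive1E; exact: derivable_cvg_harmonic.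
have qC n x : `[a, b]%classic x -> `|q n x| <= C.
  rewrite /= in_itv/= => /andP[ax xb].
  have hn0 := h0 n; have hn1 := h1 n.
  have xxh : x < x + h n by lra.
  have dFx (y : R) : y \in `]x, x + h n[ -> is_derive y 1 F (r y).
    by rewrite in_itv/= => /andP[xy yx]; apply: dF; apply/andP; split; lra.
  have [|c] := MVT xxh dFx; first by apply: wcF => //; lra.
  rewrite in_itv/= => /andP[xc cx] E.
  rewrite /q E [x + _ - x]addrAC subrr add0r mulrCA /h divff ?mulr1 ?pnatr_eq0//.
  by apply: rC; apply/andP; split; lra.
have iC : lebesgue_measure.-integrable (`[a, b] : set R) (EFin \o cst C).
  by apply: continuous_compact_integrable; [exact: segment_compact|apply: continuous_subspaceT => x; exact: cvg_cst].
have [|||||_ _] := @dominated_convergence _ _ _ lebesgue_measure `[a, b]%classic (measurable_itv _) (fun n => EFin \o q n) (EFin \o r) (EFin \o cst C).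
- by move=> n; apply/measurable_EFinP; exact: mq.
- by apply/measurable_EFinP; exact: mr.
- by apply: aeW => x xab; apply: cvg_EFin; [exact: nearW|exact: qr].
- exact: iC.
- by apply: aeW => x n xab; rewrite /= lee_fin; exact: qC.
have ir : lebesgue_measure.-integrable (`[a, b] : set R) (EFin \o r).
  apply: le_integrable iC; [exact: measurable_itv|by apply/measurable_EFinP; exact: mr|].
  move=> x; rewrite /= in_itv/= => /andP[ax xb]; rewrite lee_fin.
  by apply: le_trans (ler_norm _); apply: rC; apply/andP; split; lra.
have -> : (\int[lebesgue_measure]_(x in `[a, b]) (EFin \o r) x =
   (\int[lebesgue_measure]_(x in `[a, b]) r x)%:E)%E.
  by rewrite /Rintegral fineK//; exact: integrable_fin_num.
move=> /fine_cvg H.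
have FTC u v : a <= u -> u < v -> v <= b + 1 -> \int[lebesgue_measure]_(x in `[u, v]) F x = G v - G u.
  move=> au uv vb; rewrite /Rintegral (@continuous_FTC2 _ F G u v uv) ?EFinB//.
  - exact: wcF.
  - have cGx x : u <= x <= v -> G y @[y --> x] --> G x.
      by move=> /andP[ux xv]; apply: cG; apply/andP; split; lra.
    split.
    + move=> x; rewrite in_itv/= => /andP[ux xv].
      by have [] := dG x; first by apply/andP; split; lra.
    + by apply: cvg_at_right_filter; apply: cGx; rewrite lexx ltW.
    + by apply: cvg_at_left_filter; apply: cGx; rewrite lexx ltW.
  - move=> x; rewrite in_itv/= => /andP[ux xv].
    have xab : a <= x <= b + 1 by apply/andP; split; lra.
    by rewrite derive1E; apply: (@derive_val _ _ _ _ _ _ _ (dG x xab)).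
have E n : \int[lebesgue_measure]_(x in `[a, b]) q n x =
    n.+1%:R * (G (b + h n) - G b) - n.+1%:R * (G (a + h n) - G a).
  have hn0 := h0 n; have hn1 := h1 n.
  have iF : lebesgue_measure.-integrable (`[a, b] : set R) (EFin \o F).
    by apply: continuous_compact_integrable; [exact: segment_compact|apply: wcF => //; lra].
  have iFh : lebesgue_measure.-integrable (`[a, b] : set R) (EFin \o (fun x => F (x + h n))).
    by apply: continuous_compact_integrable; [exact: segment_compact|exact: wcFh].
  rewrite RintegralZl//; last first.
    have := @integrableB _ _ _ lebesgue_measure `[a, b]%classic (measurable_itv _) _ _ iFh iF.
    by apply: eq_integrable.
  rewrite RintegralB// FTC//; last by lra.
  have -> : \int[lebesgue_measure]_(x in `[a, b]) F (x + h n) = G (b + h n) - G (a + h n).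
    rewrite /Rintegral (@continuous_FTC2 _ _ (fun x => G (x + h n)) a b ab) ?EFinB//.
    - have cGx x : a <= x <= b -> G (y + h n) @[y --> x] --> G (x + h n).
        move=> /andP[ax xb].
        apply: (@continuous_comp _ _ _ (fun x => x + h n) G).
          by apply: cvgD; [exact: cvg_id|exact: cvg_cst].
        by apply: cG; apply/andP; split; lra.
      have dGh x : a < x < b -> is_derive x 1 (fun x => G (x + h n)) (F (x + h n)).
        move=> /andP[ax xb].
        have dG' : is_derive (x + h n) 1 G (F (x + h n)) by apply: dG; apply/andP; split; lra.
        have ds : is_derive x 1 (fun x : R => x + h n) 1.
          by apply: is_derive_eq; rewrite addr0.
        have := @is_derive1_comp _ G (fun x => x + h n) x _ _ dG' ds.
        by rewrite mulr1.
      split.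
      + move=> x; rewrite in_itv/= => xab; by have [] := dGh x xab.
      + by apply: cvg_at_right_filter; apply: cGx; rewrite lexx ltW.
      + by apply: cvg_at_left_filter; apply: cGx; rewrite lexx ltW.
    - move=> x; rewrite in_itv/= => /andP[ax xb].
      have dG' : is_derive (x + h n) 1 G (F (x + h n)) by apply: dG; apply/andP; split; lra.
      have ds : is_derive x 1 (fun x : R => x + h n) 1.
        by apply: is_derive_eq; rewrite addr0.
      have := @is_derive1_comp _ G (fun x => x + h n) x _ _ dG' ds.
      rewrite mulr1 => dGh; rewrite derive1E; exact: (@derive_val _ _ _ _ _ _ _ dGh).
  ring.
have lim2 : n.+1%:R * (G (b + h n) - G b) - n.+1%:R * (G (a + h n) - G a) @[n --> \oo] --> F b - F a.
  have lim1 x : a <= x <= b + 1 -> n.+1%:R * (G (x + h n) - G x) @[n --> \oo] --> F x.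
    move=> xab; have [dGx dGxE] := dG x xab.
    by rewrite -dGxE -derive1E; exact: derivable_cvg_harmonic.
  by apply: cvgB; apply: lim1; apply/andP; split; lra.
move: lim2; under eq_cvg do rewrite -E.
by move=> lim2; exact: (cvg_unique _ H lim2).
Qed.

Lemma cvg_dnbhs_right_left {R : realType} (f : R -> R) (p l : R) :
  f x @[x --> p^'+] --> l -> f x @[x --> p^'-] --> l -> f x @[x --> p^'] --> l.
Proof.
move=> fr fl A HA.
have H1 : \forall u \near p, p < u -> A (f u) by exact: fr A HA.
have H2 : \forall u \near p, u < p -> A (f u) by exact: fl A HA.
have H : \forall u \near p, u != p -> A (f u).
  near=> u => up; have [pu|pu|pu] := ltgtP p u.
  - by move: pu; near: u; exact: H1.
  - by move: pu; near: u; exact: H2.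
  - by rewrite pu eqxx in up.
exact: H.
Unshelve. all: by end_near. Qed.

(** * The second derivative of the increments variance *)

Section IncrementsVariance.
Context {R : realType}.
Local Notation mu := (@lebesgue_measure R).
Variables (sigma2 : R -> R) (k : nat).
Hypothesis k_ge1 : (1 <= k)%N.
Hypothesis sigma2_even : forall s, sigma2 (- s) = sigma2 s.
Hypothesis sigma2_0 : sigma2 0 = 0.
Hypothesis sigma2_small : sigma2 h / h @[h --> 0^'+] --> (0 : R).
Hypothesis sigma2_diff : forall s : R, s != 0 ->
  derivable sigma2 s 1 /\ derivable (sigma2^`())%classic s 1.
Hypothesis rho_locint : locally_integrable setT (fun x => rho_of sigma2 x ^+ k).
Hypothesis rho_bounded : forall delta M : R, 0 < delta -> delta < M ->
  exists C : R, forall x, delta <= x <= M -> `|rho_of sigma2 `|x| | <= C.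

Local Notation rho := (rho_of sigma2).
Let F := (sigma2^`())%classic.

Lemma is_derive_sigma2_0 : is_derive (0 : R) 1 sigma2 0.
Proof.
have H : h^-1 *: (sigma2 (h + 0) - sigma2 0) @[h --> 0^'] --> (0 : R).
  apply: cvg_dnbhs_right_left.
    apply: cvg_trans sigma2_small; apply: near_eq_cvg; apply: nearW => h /=.
    by rewrite addr0 sigma2_0 subr0 mulrC.
  apply/cvg_at_leftNP; rewrite oppr0.
  have H : - (sigma2 h / h) @[h --> 0^'+] --> (0 : R) by rewrite -[X in _ --> X]oppr0; apply: cvgN.
  apply: cvg_trans H; apply: near_eq_cvg; apply: nearW => h /=.
  by rewrite addr0 sigma2_0 subr0 sigma2_even invrN scaleNr mulrC.
have D : derivable sigma2 (0 : R) 1.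
  apply/cvg_ex; exists 0; move: H; apply: cvg_trans; apply: near_eq_cvg; apply: nearW => h /=.
  by rewrite [_%:A]mulr1.
split => //; rewrite -derive1E /derive1; exact: cvg_lim H.
Qed.

Lemma is_derive_sigma2 (x : R) : is_derive x 1 sigma2 (F x).
Proof.
have [->|x0] := eqVneq x 0.
  have := is_derive_sigma2_0; rewrite /F derive1E => -[D E]; rewrite E; split => //.
have [D _] := sigma2_diff x0; apply: DeriveDef => //.
by rewrite /F derive1E.
Qed.

Let F0 : F 0 = 0.
Proof. by rewrite /F derive1E; have [_ ->] := is_derive_sigma2_0. Qed.

Let is_derive_opp (x : R) : is_derive x 1 (fun x : R => - x) (-1).
Proof. exact: is_deriveN. Qed.

Let F_odd x : F (- x) = - F x.
Proof.
have := @is_derive1_comp _ sigma2 (fun x => - x) x _ _ (is_derive_sigma2 (- x)) (is_derive_opp x).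
have -> : sigma2 \o (fun x => - x) = sigma2 by apply/funext => y /=.
move=> [_ E1]; have [_ E2] := is_derive_sigma2 x.
by rewrite -E2 E1 mulrN1 opprK.
Qed.

Let is_derive_F (x : R) : x != 0 -> is_derive x 1 F (2 * rho x).
Proof.
move=> x0; have [_ D] := sigma2_diff x0; apply: DeriveDef => //.
by rewrite /rho_of mulrA divff// mul1r -derive1E.
Qed.

Lemma rho_even x : rho (- x) = rho x.
Proof.
have [->|x0] := eqVneq x 0; first by rewrite oppr0.
have mx0 : - x != 0 by rewrite oppr_eq0.
have := @is_derive1_comp _ F (fun x => - x) x _ _ (is_derive_F mx0) (is_derive_opp x).
have -> : F \o (fun x => - x) = (fun x => - F x) by apply/funext => y /=; rewrite F_odd.
move=> [_ E1]; have [_ E2] := is_deriveN (is_derive_F x0).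
have : 2 * rho (- x) * -1 = - (2 * rho x) by rewrite -E1 -E2.
by rewrite mulrN1 => /oppr_inj /(mulfI _); apply; rewrite pnatr_eq0.
Qed.

Let contF_neq0 (x : R) : x != 0 -> {for x, continuous F}.
Proof.
move=> x0; apply: differentiable_continuous; apply/derivable1_diffP.
by have [] := is_derive_F x0.
Qed.

(** On the positive axis [rho] is a pointwise limit of continuous difference quotients; evenness
    carries this over to the negative axis. *)
Lemma measurable_rho : measurable_fun setT rho.
Proof.
pose D : set R := `]0, +oo[%classic.
have mD : measurable D by exact: measurable_itv.
have mFD (h : R) : 0 <= h -> measurable_fun D (fun x => F (x + h)).
  move=> h0; apply: open_continuous_measurable_fun; first exact: interval_open.
  move=> x; rewrite inE /D/= in_itv/= andbT => x0.
  apply: (@continuous_comp _ _ _ (fun x => x + h) F).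
    by apply: cvgD; [exact: cvg_id|exact: cvg_cst].
  by apply: contF_neq0; rewrite gt_eqF// ltr_pwDl.
have mrD : measurable_fun D rho.
  apply: (@measurable_fun_cvg _ _ R D (fun (n : nat) (x : R) => 2^-1 * (n.+1%:R * (F (x + n.+1%:R^-1) - F x))) rho).
    move=> n; apply: measurable_funM => //; apply: measurable_funM => //.
    apply: measurable_funB; first by apply: mFD; rewrite invr_ge0.
    by have := mFD 0 (lexx _); under eq_fun do rewrite addr0.
  move=> x; rewrite /D/= in_itv/= andbT => x0.
  have xn0 : x != 0 by rewrite gt_eqF.
  have [dF dFE] := is_derive_F xn0.
  have := derivable_cvg_harmonic dF => H.
  apply: cvgM; first exact: cvg_cst.
  exact: H.
have mg := (measurable_restrictT _ mD).1 mrD.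
(* At 0 the restricted function takes the default value [point]; the last term restores [rho 0]. *)
rewrite (_ : rho = (fun x => (rho \_ D) `|x| + (rho 0 - point) * \1_[set (0 : R)] x)).
  apply: measurable_funD; first by apply: measurableT_comp => //.
  by apply: measurable_funM => //; apply: measurable_indic; exact: measurable_set1.
apply/funext => x.
have xD : (`|x| \in D) = (x != 0) by rewrite /D mem_setE in_itv/= andbT normr_gt0.
have x0E : (x \in [set (0 : R)]) = (x == 0).
  by apply/idP/eqP => [/set_mem//|->]; exact: mem_set.
rewrite patchE xD indicE x0E.
have [->|x0] := eqVneq x 0; first by rewrite /= mulr1 addrC subrK.
rewrite /= mulr0 addr0.
have [x_ge0|x_lt0] := leP 0 x; first exact: (congr1 rho (esym (ger0_norm x_ge0))).
by rewrite (ltr0_norm x_lt0) rho_even.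
Qed.

Lemma integrable_rho (N : R) : mu.-integrable `[- N, N] (EFin \o rho).
Proof.
have mN : measurable (`[- N, N]%classic : set (measurableTypeR R)) by exact: measurable_itv.
have [mk _ /(_ `[- N, N]%classic (@subsetT _ _) (@segment_compact _ _ _)) fk] := rho_locint.
have ik : mu.-integrable `[- N, N] (fun x => (1 + `|rho x ^+ k|)%:E).
  have i1 : mu.-integrable (`[- N, N] : set R) (EFin \o cst 1).
    by apply: continuous_compact_integrable; [exact: segment_compact|apply: continuous_subspaceT => x; exact: cvg_cst].
  have i2 : mu.-integrable (`[- N, N] : set R) (EFin \o (fun x => `|rho x ^+ k|)).
    apply/integrableP; split.
      apply/measurable_EFinP; apply: measurableT_comp => //.
      by apply: measurable_funTS; exact: mk.
    by under eq_integral do rewrite /= normr_id; exact: fk.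
  have := @integrableD _ _ _ mu `[- N, N]%classic mN _ _ i1 i2.
  by apply: eq_integrable.
apply: le_integrable ik; first exact: mN.
  by apply/measurable_EFinP; apply: measurable_funTS; exact: measurable_rho.
move=> x _ /=; rewrite lee_fin [leRHS]ger0_norm ?addr_ge0// normrX.
have [r1|r1] := leP `|rho x| 1; first by rewrite ler_wpDr// exprn_ge0.
by rewrite ler_wpDl// -[leLHS]expr1 ler_weXn2l// ltW.
Qed.

Let FB a b : 0 < a -> a <= b -> \int[mu]_(x in `[a, b]) rho x = 2^-1 * F b - 2^-1 * F a.
Proof.
move=> a0 ab.
have gt0 x : a <= x <= b + 1 -> x != 0.
  by move=> /andP[ax _]; rewrite gt_eqF// (lt_le_trans a0).
apply: (@integral_second_derivative _ (fun x => 2^-1 * sigma2 x) (fun x => 2^-1 * F x) rho) => //.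
- move=> x _; have := @is_deriveZ _ _ _ sigma2 2^-1 x 1 (F x) (is_derive_sigma2 x).
  by move=> d; apply: (is_derive_eq d).
- move=> x /gt0 x0; have := @is_deriveZ _ _ _ F 2^-1 x 1 _ (is_derive_F x0).
  by move=> d; apply: (is_derive_eq d); rewrite /GRing.scale/= mulrA mulVf// mul1r.
- by apply: measurable_funTS; exact: measurable_rho.
- have [|C HC] := rho_bounded a0 (_ : a < b + 1); first by rewrite (le_lt_trans ab)// ltrDl.
  exists C => x xab; have /andP[ax _] := xab.
  have x0 : 0 <= x by exact: le_trans (ltW a0) ax.
  by have := HC x xab; rewrite (ger0_norm x0).
Qed.

(** Integrability of [rho] up to 0 shows that a limit [l] exists. By the mean value theorem
    [sigma2 h / h] equals [F c] for some [c] between 0 and [h]; since it tends to 0, [l] must be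
    0. *)
Let F_right : 2^-1 * F x @[x --> 0^'+] --> (0 : R).
Proof.
have i1 : mu.-integrable (`[0, 1] : set R) (EFin \o rho).
  apply: (integrableS _ _ _ (integrable_rho 1)); [exact: measurable_itv|exact: measurable_itv|].
  by apply: subset_itvr; rewrite bnd_simp; lra.
pose l := 2^-1 * F 1 - \int[mu]_(x in `[0, 1]) rho x.
have Fl : 2^-1 * F x @[x --> 0^'+] --> l.
  have H : l + \int[mu]_(x in `[0, x]) rho x @[x --> 0^'+] --> l.
    rewrite -[X in _ --> X]addr0; apply: cvgD; first exact: cvg_cst.
    by apply: cvg_at_right_filter; exact: (parameterized_integral_cvg_left ltr01 i1).
  apply: cvg_trans H; apply: near_eq_cvg; near=> x.
  have x0 : 0 < x by near: x; exact: nbhs_right_gt.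
  have x1 : x < 1 by near: x; exact: nbhs_right_lt.
  have := @Rintegral_itvB _ rho (BLeft 0) (BRight 1) x i1.
  rewrite !bnd_simp => /(_ (ltW x0) (ltW x1)).
  rewrite Rintegral_itv_obnd_cbnd; last first.
    apply: (integrableS _ _ _ i1); [exact: measurable_itv|exact: measurable_itv|].
    by apply: subset_itvr; rewrite bnd_simp.
  by rewrite (FB x0 (ltW x1)) /l => E; rewrite -addrA [- _ + _]addrC -opprB E subKr.
suff l0 : l = 0 by rewrite -[X in _ --> X]l0.
apply: contrapT => /eqP l_neq0.
have e0 : 0 < `|l| / 2 by rewrite divr_gt0 ?normr_gt0.
move/cvgrPdist_lt : Fl => /(_ _ e0) [d /= d0 Hd].
move/cvgrPdist_lt : sigma2_small => /(_ _ e0) [d' /= d'0 Hd'].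
pose h := Num.min (d / 2) (d' / 2).
have h0 : 0 < h by rewrite lt_min !divr_gt0.
have hd : h < d by rewrite gt_min ltr_pdivrMr// ltr_pMr// ltr1n.
have hd' : h < d' by rewrite gt_min [X in _ || X]ltr_pdivrMr// ltr_pMr// ltr1n orbT.
have [c] : exists2 c, c \in `]0, h[ & sigma2 h - sigma2 0 = F c * (h - 0).
  apply: MVT => // [x _|]; first exact: is_derive_sigma2.
  apply: continuous_subspaceT => x; apply: differentiable_continuous; apply/derivable1_diffP.
  by have [] := is_derive_sigma2 x.
rewrite in_itv/= !subr0 => /andP[c0 ch] E; rewrite sigma2_0 subr0 in E.
have h1 : `|l - 2^-1 * F c| < `|l| / 2.
  by apply: Hd => //=; rewrite sub0r normrN gtr0_norm// (lt_trans ch).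
have h2 : `|0 - sigma2 h / h| < `|l| / 2.
  by apply: Hd' => //=; rewrite sub0r normrN gtr0_norm.
move: h2; rewrite sub0r normrN E mulfK ?gt_eqF// => h2.
have : `|l| <= `|l - 2^-1 * F c| + `|2^-1 * F c|.
  by rewrite -{1}(subrK (2^-1 * F c) l) ler_normD.
rewrite [`|2^-1 * _|]normrM (ger0_norm (_ : 0 <= 2^-1 :> R)) ?invr_ge0//.
have : 0 <= `|F c| by []. move: e0 h1 h2.
move: `|l| `|F c| `|l - _| => u v w; lra.
Unshelve. all: by end_near. Qed.

Definition half_dsigma2 (x : R) : R := 2^-1 * F x.
Local Notation R1 := half_dsigma2.

Lemma continuous_half_dsigma2 : continuous R1.
Proof.
move=> x; have [->|x0] := eqVneq x 0; last first.
  by apply: cvgM; [exact: cvg_cst|exact: contF_neq0].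
have R10 : R1 0 = 0 by rewrite /R1 F0 mulr0.
have H : R1 y @[y --> 0^'] --> R1 0.
  rewrite R10; apply: cvg_dnbhs_right_left => //.
  apply/cvg_at_leftNP; rewrite oppr0.
  have H : - (2^-1 * F x) @[x --> 0^'+] --> (0 : R) by rewrite -[X in _ --> X]oppr0; apply: cvgN.
  apply: cvg_trans H; apply: near_eq_cvg; apply: nearW => h /=.
  by rewrite /R1 F_odd mulrN.
by apply/continuous_withinNx.
Qed.

Definition half_sigma2 (x : R) : R := 2^-1 * sigma2 x.
Local Notation S2 := half_sigma2.

Lemma is_derive_half_sigma2 (x : R) : is_derive x 1 S2 (R1 x).
Proof.
have := @is_deriveZ _ _ _ sigma2 2^-1 x 1 (F x) (is_derive_sigma2 x).
by move=> d; apply: (is_derive_eq d).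
Qed.

(** The difference of the two sides, as a function of the upper bound, is constant on []0, b]] by
    [FB] and tends to 0 at 0. *)
Let integral_rho_0 b : 0 <= b -> \int[mu]_(x in `[0, b]) rho x = R1 b - R1 0.
Proof.
have R10 : R1 0 = 0 by rewrite /R1 F0 mulr0.
rewrite le_eqVlt => /predU1P[<-|b0].
  by rewrite set_itv1 Rintegral_set1 R10 subrr.
have ib : mu.-integrable (`[0, b] : set R) (EFin \o rho).
  apply: (integrableS _ _ _ (integrable_rho b)); [exact: measurable_itv|exact: measurable_itv|].
  by apply: subset_itvr; rewrite bnd_simp; lra.
rewrite R10 subr0.
pose D x := R1 x - \int[mu]_(t in `[0, x]) rho t.
have D0 : D x @[x --> 0^'+] --> (0 : R).
  rewrite -[X in _ --> X](subr0 0); apply: cvgB; first exact: F_right.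
  by apply: cvg_at_right_filter; exact: (parameterized_integral_cvg_left b0 ib).
have Dcst : D x @[x --> 0^'+] --> D b.
  apply: cvg_near_cst; near=> x.
  have x0 : 0 < x by near: x; exact: nbhs_right_gt.
  have xb : x < b by near: x; exact: nbhs_right_lt.
  have := @Rintegral_itvB _ rho (BLeft 0) (BRight b) x ib.
  rewrite !bnd_simp => /(_ (ltW x0) (ltW xb)).
  rewrite Rintegral_itv_obnd_cbnd; last first.
    apply: (integrableS _ _ _ ib); [exact: measurable_itv|exact: measurable_itv|].
    by apply: subset_itvr; rewrite bnd_simp.
  rewrite (FB x0 (ltW xb)) /D -/(R1 b) -/(R1 x) => E.
  apply/eqP; rewrite -subr_eq0; apply/eqP.
  transitivity ((\int[mu]_(t in `[0, b]) rho t - \int[mu]_(t in `[0, x]) rho t) - (R1 b - R1 x)); first by ring.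
  by rewrite E subrr.
have /eqP : D b = 0 by exact: (cvg_unique _ Dcst D0).
by rewrite subr_eq0 => /eqP.
Unshelve. all: by end_near. Qed.

Let integral_rho_split a b : a <= 0 -> 0 <= b ->
  \int[mu]_(x in `[a, b]) rho x = \int[mu]_(x in `[a, 0]) rho x + \int[mu]_(x in `[0, b]) rho x.
Proof.
move=> a0 b0.
have iab : mu.-integrable (`[a, b] : set R) (EFin \o rho).
  pose N := Num.max (- a) b.
  apply: (integrableS _ _ _ (integrable_rho N)); [exact: measurable_itv|exact: measurable_itv|].
  move=> x; rewrite /= !in_itv/= => /andP[ax xb]; rewrite lerNl !le_max xb orbT andbT lerN2 ax//.
have := @Rintegral_itvB _ rho (BLeft a) (BRight b) 0 iab.
rewrite !bnd_simp => /(_ a0 b0).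
rewrite Rintegral_itv_obnd_cbnd; last first.
  apply: (integrableS _ _ _ iab); [exact: measurable_itv|exact: measurable_itv|].
  by apply: subset_itvr; rewrite bnd_simp.
by move=> <-; rewrite addrC subrK.
Qed.

Let integral_rho_opp a b : \int[mu]_(x in `[a, b]) rho x = \int[mu]_(x in `[- b, - a]) rho x.
Proof.
have := @integral_reflection_itv _ 0 a b rho measurable_rho.
rewrite !sub0r => <-; apply: eq_Rintegral => x _; by rewrite sub0r rho_even.
Qed.

Lemma half_dsigma2_odd x : R1 (- x) = - R1 x.
Proof. by rewrite /R1 F_odd mulrN. Qed.

Lemma integral_rho a b : a <= b -> \int[mu]_(x in `[a, b]) rho x = R1 b - R1 a.
Proof.
have R10 : R1 0 = 0 by rewrite /R1 F0 mulr0.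
have pos u v : 0 <= u -> u <= v -> \int[mu]_(x in `[u, v]) rho x = R1 v - R1 u.
  rewrite le_eqVlt => /predU1P[<-|u0] uv; first exact: integral_rho_0.
  exact: FB.
move=> ab; have [a0|a0] := leP 0 a; first exact: pos.
have [b0|b0] := leP 0 b.
  rewrite integral_rho_split// ?ltW// integral_rho_opp oppr0.
  rewrite !integral_rho_0// ?oppr_ge0 ?ltW// half_dsigma2_odd R10; ring.
have nb0 : 0 <= - b by rewrite oppr_ge0 ltW.
have nba : - b <= - a by rewrite lerN2.
by rewrite integral_rho_opp (pos _ _ nb0 nba) !half_dsigma2_odd; ring.
Qed.

(** [half_dsigma2] is a primitive of [rho], and [half_sigma2] one of [half_dsigma2]. The right-hand
    side is the covariance of the increments of the process over the two intervals, as
    [ip_increments] will show. *)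
Lemma integral2_rho a b a' b' : a <= b -> a' <= b' ->
  \int[mu]_(t in `[a', b']) (\int[mu]_(s in `[a, b]) rho (t - s)) =
  S2 (b' - a) - S2 (a' - a) - S2 (b' - b) + S2 (a' - b).
Proof.
move=> ab ab'.
have E t : \int[mu]_(s in `[a, b]) rho (t - s) = R1 (t - a) - R1 (t - b).
  rewrite (integral_reflection_itv _ _ _ measurable_rho) integral_rho//.
  by rewrite lerD2l lerN2.
under eq_Rintegral do rewrite E.
have dS c (t : R) : is_derive t 1 (fun t : R => S2 (t - c)) (R1 (t - c)).
  have ds : is_derive t 1 (fun x : R => x - c) 1 by apply: is_derive_eq; rewrite subr0.
  have := @is_derive1_comp _ S2 (fun x => x - c) t _ _ (is_derive_half_sigma2 (t - c)) ds.
  by rewrite mulr1.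
have cR c : continuous (fun t : R => R1 (t - c)).
  move=> t; apply: (@continuous_comp _ _ _ (fun x => x - c) R1).
    by apply: cvgB; [exact: cvg_id|exact: cvg_cst].
  exact: continuous_half_dsigma2.
rewrite (@integral_is_derive _ _ (fun t => S2 (t - a) - S2 (t - b)))//; first by ring.
by move=> t; apply: cvgB; exact: cR.
Qed.

End IncrementsVariance.

(** * The covariance form and the generalized derivative *)

Section Form.
Context {R : realType}.
Local Notation mu := (@lebesgue_measure R).
Local Notation rR := (measurableTypeR R).

Lemma integral2_difference (psi w : R -> \bar R) :
  measurable_fun setT psi -> (forall x, 0 <= psi x)%E ->
  measurable_fun setT w -> (forall x, 0 <= w x)%E ->
  (\int[mu]_s \int[mu]_t (psi (t - s)%R * w s) = (\int[mu]_u psi u) * (\int[mu]_s w s))%E.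
Proof.
move=> mpsi psi0 mw w0.
rewrite -ge0_integralZl//; last exact: integral_ge0.
apply: eq_integral => s _.
rewrite ge0_integralZr//; last first.
  by apply: measurableT_comp => //; apply: measurable_funD.
by rewrite (ge0_integral_translation (- s)).
Qed.

Definition itv_ind (a b : R) : R -> R := \1_(`[a, b] : set R).

Lemma itv_indE (a b x : R) : itv_ind a b x = (((a <= x) && (x <= b))%R : bool)%:R.
Proof. by rewrite /itv_ind indicE mem_setE in_itv. Qed.

Lemma measurable_itv_ind (a b : R) : measurable_fun setT (itv_ind a b).
Proof. by apply: measurable_indic; exact: measurable_itv. Qed.

Lemma integrable_itv_ind (a b : R) : mu.-integrable setT (EFin \o itv_ind a b).
Proof.
apply/integrableP; split; first by apply/measurable_EFinP; exact: measurable_itv_ind.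
under eq_integral do rewrite /= ger0_norm//.
rewrite (@integral_indic _ _ _ mu setT measurableT `[a, b]%classic (measurable_itv _)).
have H : (@lebesgue_measure R `[a, b]%classic < +oo)%E.
  by rewrite lebesgue_measure_itv/=; case: ifP => _; rewrite ?ltry.
by rewrite setIT; exact: H.
Qed.

Lemma le_itv_ind (a b a' b' x : R) : a' <= a -> b <= b' -> itv_ind a b x <= itv_ind a' b' x.
Proof.
move=> aa bb; rewrite !itv_indE ler_nat; case: (boolP (a <= x <= b)) => // /andP[ax xb].
by rewrite (le_trans aa ax) (le_trans xb bb).
Qed.

Lemma itv_ind_ge0 (a b x : R) : 0 <= itv_ind a b x.
Proof. by rewrite itv_indE. Qed.

(** Bounded Borel functions with bounded support, on which the form is finite for any locally
    integrable [rho]; a single inequality carries both the bound and the support. *)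
Definition test_function (v : R -> R) : Prop := measurable_fun setT v /\
  exists M N : R, [/\ 0 <= M, 0 <= N & forall s, `|v s| <= M * itv_ind (- N) N s].

Lemma test_function_intro (v : R -> R) (M a b : R) : measurable_fun setT v ->
  0 <= M -> (forall s, `|v s| <= M * itv_ind a b s) -> test_function v.
Proof.
move=> mv M0 vM; split => //; exists M, (`|a| + `|b|); split => //.
move=> s; apply: (le_trans (vM s)); apply: ler_wpM2l => //; apply: le_itv_ind.
  by rewrite lerNl (le_trans (ler_norm (- a)))// normrN lerDl.
by rewrite (le_trans (ler_norm b))// lerDr.
Qed.

Lemma test_functionD v w : test_function v -> test_function w -> test_function (fun s => v s + w s).
Proof.
move=> [mv [M [N [M0 N0 vM]]]] [mw [M' [N' [M'0 N'0 wM]]]]; split; first exact: measurable_funD.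
exists (M + M'), (N + N'); split; [exact: addr_ge0|exact: addr_ge0|].
move=> s; apply: (le_trans (ler_normD _ _)); rewrite mulrDl; apply: lerD.
  by apply: (le_trans (vM s)); apply: ler_wpM2l => //; apply: le_itv_ind; lra.
by apply: (le_trans (wM s)); apply: ler_wpM2l => //; apply: le_itv_ind; lra.
Qed.

Lemma test_functionZ c v : test_function v -> test_function (fun s => c * v s).
Proof.
move=> [mv [M [N [M0 N0 vM]]]]; split; first exact: measurable_funM.
exists (`|c| * M), N; split => //; first exact: mulr_ge0.
by move=> s; rewrite normrM -mulrA; apply: ler_wpM2l.
Qed.

Lemma test_functionB v w : test_function v -> test_function w -> test_function (fun s => v s - w s).
Proof.
move=> tv tw; have := test_functionD tv (test_functionZ (-1) tw).
by under eq_fun do rewrite mulN1r.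
Qed.

Lemma test_function0 : test_function (fun _ => 0).
Proof.
by apply: (@test_function_intro _ 0 0 0) => // s; rewrite ?normr0 ?mul0r.
Qed.

Lemma test_function_sum (I : Type) (r : seq I) (v : I -> R -> R) : (forall i, test_function (v i)) ->
  test_function (fun s => \sum_(i <- r) v i s).
Proof.
move=> tv; elim: r => [|i r IH].
  by under eq_fun do rewrite big_nil; exact: test_function0.
by under eq_fun do rewrite big_cons; exact: test_functionD.
Qed.

Lemma measurable_difference (psi : R -> R) : measurable_fun setT psi ->
  measurable_fun setT (fun z : rR * rR => psi (z.2 - z.1)).
Proof.
move=> mpsi; apply: (@measurableT_comp _ _ _ _ _ _ psi) => //.
by apply: measurable_funB; [exact: measurable_snd|exact: measurable_fst].
Qed.

Lemma measurable_comp_fst (v : R -> R) : measurable_fun setT v ->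
  measurable_fun setT (fun z : rR * rR => v z.1).
Proof. by move=> mv; apply: (@measurableT_comp _ _ _ _ _ _ v) => //; exact: measurable_fst. Qed.

Lemma measurable_comp_snd (v : R -> R) : measurable_fun setT v ->
  measurable_fun setT (fun z : rR * rR => v z.2).
Proof. by move=> mv; apply: (@measurableT_comp _ _ _ _ _ _ v) => //; exact: measurable_snd. Qed.

(** In the variables [t - s] and [s] the integrand is a product. Integrability on the plane is later
    obtained by domination by functions of this kind. *)
Lemma integrable_difference (psi w : R -> R) :
  mu.-integrable setT (EFin \o psi) -> mu.-integrable setT (EFin \o w) ->
  (mu \x mu)%E.-integrable setT (EFin \o (fun z : rR * rR => psi (z.2 - z.1) * w z.1)).
Proof.
move=> ipsi iw.
have mpsi : measurable_fun setT psi by apply/measurable_EFinP; exact: measurable_int ipsi.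
have mw : measurable_fun setT w by apply/measurable_EFinP; exact: measurable_int iw.
apply/integrable12ltyP.
  apply/measurable_EFinP; apply: measurable_funM; first exact: measurable_difference.
  exact: measurable_comp_fst.
rewrite (_ : (\int[mu]_x \int[mu]_y _)%E =
  ((\int[mu]_u `|(EFin \o psi) u|) * (\int[mu]_s `|(EFin \o w) s|))%E); last first.
  rewrite -(@integral2_difference (fun u => `|(EFin \o psi) u|)%E (fun s => `|(EFin \o w) s|)%E); [|  |by move=> x; exact: abse_ge0| |by move=> x; exact: abse_ge0].
  - apply: eq_integral => s _; apply: eq_integral => t _ /=.
    by rewrite normrM.
  - by apply: measurableT_comp => //; exact/measurable_EFinP.
  - by apply: measurableT_comp => //; exact/measurable_EFinP.
have /integrableP[_ p] := ipsi; have /integrableP[_ q] := iw.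
by apply: lte_mul_pinfty => //; [exact: integral_ge0|rewrite ge0_fin_numE//; exact: integral_ge0].
Qed.

Variable rho : R -> R.
Hypothesis mrho : measurable_fun setT rho.
Hypothesis irho : forall N, mu.-integrable `[- N, N] (EFin \o rho).

Lemma integrable_rho_ind N : mu.-integrable setT (EFin \o (fun u => `|rho u| * itv_ind (- N) N u)).
Proof.
apply/integrableP; split.
  apply/measurable_EFinP; apply: measurable_funM; first exact: measurableT_comp.
  exact: measurable_itv_ind.
have /integrableP[_] := irho N; rewrite integral_mkcond; apply: le_lt_trans.
rewrite le_eqVlt; apply/orP; left; apply/eqP; apply: eq_integral => u _.
rewrite patchE /itv_ind /= indicE normrM normr_id; case: (u \in _); rewrite ?normr1 ?mulr1 ?normr0 ?mulr0//.
Qed.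

Definition form_kernel (v w : R -> R) (z : rR * rR) : R := rho (z.2 - z.1) * v z.1 * w z.2.

Lemma measurable_form_kernel (v w : R -> R) : measurable_fun setT v -> measurable_fun setT w ->
  measurable_fun setT (form_kernel v w).
Proof.
move=> mv mw; apply: measurable_funM; first apply: measurable_funM.
- exact: measurable_difference.
- exact: measurable_comp_fst.
- exact: measurable_comp_snd.
Qed.

(** Two points of [[a, b]] differ by at most [L]. Trading the indicator of the second variable for
    one of the difference gives a majorant that becomes a product after translation. *)
Lemma form_kernel_bound v w M M' a b L : b - a <= L -> 0 <= M -> 0 <= M' ->
  (forall s, `|v s| <= M * itv_ind a b s) -> (forall s, `|w s| <= M' * itv_ind a b s) ->
  forall z, `|form_kernel v w z| <=
    M * M' * (`|rho (z.2 - z.1)| * itv_ind (- L) L (z.2 - z.1) * itv_ind a b z.1).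
Proof.
move=> abL M0 M'0 vM wM [s t]; rewrite /form_kernel/= !normrM.
apply: (@le_trans _ _ (`|rho (t - s)| * (M * itv_ind a b s) * (M' * itv_ind a b t))).
  by apply: ler_pM => //; exact: ler_wpM2l.
rewrite !itv_indE; case: (boolP (a <= s <= b)) => [/andP[s0 sN]|_]; last by rewrite !(mulr0, mul0r).
case: (boolP (a <= t <= b)) => [/andP[t0 tN]|_]; last first.
  by rewrite !mulr0 mulr1 mulr_ge0 ?mulr_ge0.
rewrite (_ : (_ <= _ <= _) = true) ?mulr1; last by apply/andP; split; lra.
by rewrite le_eqVlt; apply/orP; left; apply/eqP; ring.
Qed.

Lemma integrable_form v w : test_function v -> test_function w ->
  (mu \x mu)%E.-integrable setT (EFin \o form_kernel v w).
Proof.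
move=> tv tw; have [mv [M [N [M0 N0 vM]]]] := tv.
have [mw [M' [N' [M'0 N'0 wM]]]] := tw.
pose K := N + N'; pose L := K - - K.
have vM' s : `|v s| <= M * itv_ind (- K) K s.
  by apply: (le_trans (vM s)); apply: ler_wpM2l => //; apply: le_itv_ind; rewrite /K; lra.
have wM' s : `|w s| <= M' * itv_ind (- K) K s.
  by apply: (le_trans (wM s)); apply: ler_wpM2l => //; apply: le_itv_ind; rewrite /K; lra.
have id := integrable_difference (integrable_rho_ind L) (integrable_itv_ind (- K) K).
have id' : (mu \x mu)%E.-integrable setT (EFin \o (fun z : rR * rR => M * M' * (`|rho (z.2 - z.1)| * itv_ind (- L) L (z.2 - z.1) * itv_ind (- K) K z.1))).
  have := integrableZl measurableT (M * M') id; exact: eq_integrable.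
apply: le_integrable id' => //.
  by apply/measurable_EFinP; exact: measurable_form_kernel.
move=> z _; rewrite /= lee_fin.
by apply: le_trans (ler_norm _); exact: form_kernel_bound.
Qed.

Definition form v w : R := \int[(mu \x mu)%E]_z form_kernel v w z.

Lemma formDl v v' w : test_function v -> test_function v' -> test_function w ->
  form (fun s => v s + v' s) w = form v w + form v' w.
Proof.
move=> tv tv' tw; rewrite /form -RintegralD//; [|exact: integrable_form..].
by apply: eq_Rintegral => z _; rewrite /form_kernel mulrDr mulrDl.
Qed.

Lemma formDr v w w' : test_function v -> test_function w -> test_function w' ->
  form v (fun s => w s + w' s) = form v w + form v w'.
Proof.
move=> tv tw tw'; rewrite /form -RintegralD//; [|exact: integrable_form..].
by apply: eq_Rintegral => z _; rewrite /form_kernel mulrDr.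
Qed.

Lemma formZl c v w : test_function v -> test_function w -> form (fun s => c * v s) w = c * form v w.
Proof.
move=> tv tw; rewrite /form -RintegralZl//; last exact: integrable_form.
by apply: eq_Rintegral => z _; rewrite /form_kernel mulrCA !mulrA.
Qed.

Lemma formZr c v w : test_function v -> test_function w -> form v (fun s => c * w s) = c * form v w.
Proof.
move=> tv tw; rewrite /form -RintegralZl//; last exact: integrable_form.
by apply: eq_Rintegral => z _; rewrite /form_kernel mulrCA !mulrA.
Qed.

Lemma formBl v v' w : test_function v -> test_function v' -> test_function w ->
  form (fun s => v s - v' s) w = form v w - form v' w.
Proof.
move=> tv tv' tw; under eq_fun do rewrite -mulN1r.
by rewrite formDl ?formZl ?mulN1r//; exact: test_functionZ.
Qed.

Lemma formBr v w w' : test_function v -> test_function w -> test_function w' ->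
  form v (fun s => w s - w' s) = form v w - form v w'.
Proof.
move=> tv tw tw'; under eq_fun do rewrite -mulN1r.
by rewrite formDr ?formZr ?mulN1r//; exact: test_functionZ.
Qed.

Lemma integral_itv_ind a b : a <= b -> \int[mu]_x itv_ind a b x = b - a.
Proof.
move=> ab; rewrite /Rintegral (@integral_indic _ _ _ mu setT measurableT `[a, b]%classic (measurable_itv _)).
have H : (@lebesgue_measure R `[a, b]%classic = (b - a)%:E)%E.
  rewrite lebesgue_measure_itv/= lte_fin; case: ltP => [_|ba]; first by rewrite EFinB.
  by rewrite (@le_anti _ _ a b) ?ab// subrr.
by rewrite setIT; exact: (congr1 fine H).
Qed.

Definition abs_rho_mass L : R := \int[mu]_u (`|rho u| * itv_ind (- L) L u).

Lemma abs_rho_mass_ge0 L : 0 <= abs_rho_mass L.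
Proof. by apply: Rintegral_ge0 => u _; rewrite mulr_ge0// itv_indE. Qed.

Lemma integrable_translation (a : R) (f : R -> R) : mu.-integrable setT (EFin \o f) ->
  mu.-integrable setT (EFin \o (fun x => f (x + a))).
Proof.
move=> /integrableP[mf fi]; have mf' : measurable_fun setT f by apply/measurable_EFinP.
apply/integrableP; split.
  by apply/measurable_EFinP; apply: (@measurableT_comp _ _ _ _ _ _ f) => //; exact: measurable_funD.
move: fi; congr (_ < _)%E; apply/esym.
apply: (@ge0_integral_translation _ a (fun x => `|(f x)%:E|)%E) => [|x]; last exact: abse_ge0.
by apply: measurableT_comp.
Qed.

Lemma Rintegral_translation (a : R) (f : R -> R) : measurable_fun setT f -> (forall x, 0 <= f x) ->
  \int[mu]_x f (x + a) = \int[mu]_x f x.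
Proof.
move=> mf f0; rewrite /Rintegral; congr fine.
apply: (@ge0_integral_translation _ a (fun x => (f x)%:E)) => [|x]; last by rewrite lee_fin.
exact/measurable_EFinP.
Qed.

(* The constant is invariant under a common translation of [v] and [w]. *)
Lemma form_bound v w M M' a b L : a <= b -> b - a <= L -> 0 <= M -> 0 <= M' -> test_function v -> test_function w ->
  (forall s, `|v s| <= M * itv_ind a b s) -> (forall s, `|w s| <= M' * itv_ind a b s) ->
  `|form v w| <= M * M' * (b - a) * abs_rho_mass L.
Proof.
move=> ab abL M0 M'0 tv tw vM wM.
have id := integrable_difference (integrable_rho_ind L) (integrable_itv_ind a b).
have -> : M * M' * (b - a) * abs_rho_mass L =
   \int[(mu \x mu)%E]_z (M * M' * (`|rho (z.2 - z.1)| * itv_ind (- L) L (z.2 - z.1) * itv_ind a b z.1)).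
  rewrite RintegralZl// -(Rintegral12 id)/=.
  rewrite -mulrA; congr (_ * _); rewrite -(integral_itv_ind ab).
  rewrite -RintegralZr//; last exact: integrable_itv_ind.
  apply: eq_Rintegral => s _; rewrite RintegralZr//; last first.
    exact: integrable_translation (- s) _ (integrable_rho_ind L).
  rewrite mulrC; congr (_ * _).
  apply/esym; apply: (@Rintegral_translation (- s) (fun u => `|rho u| * itv_ind (- L) L u)) => [|u].
    by apply: measurable_funM; [exact: measurableT_comp|exact: measurable_itv_ind].
  by rewrite mulr_ge0// itv_indE.
apply: (le_trans (le_normr_Rintegral measurableT (integrable_form tv tw))).
apply: le_Rintegral => //.
- exact: (integrable_norm (integrable_form tv tw)).
- have := integrableZl measurableT (M * M') id; exact: eq_integrable.
by move=> z _; exact: form_kernel_bound.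
Qed.

(** The open half-line is chosen because the intervals []a, b]] with [0 <= a] miss 0: the
    restriction leaves elementary functions on the half-line unchanged. *)
Definition restrict_half (u : R -> R) (s : R) : R := u s * \1_(`]0, +oo[ : set R) s.

Lemma measurable_halfline : measurable (@halfline R).
Proof. exact: measurable_itv. Qed.

Lemma lebesgue_int_halfline (f : R -> R) : measurable_fun halfline f ->
  lebesgue_int halfline f = \int[mu]_x (f x * \1_(`]0, +oo[ : set R) x).
Proof.
move=> mf; rewrite /lebesgue_int /Rintegral; congr fine.
have mo : measurable (`]0, +oo[%classic : set rR) by exact: measurable_itv.
rewrite integral_completed//; [|exact: measurable_halfline|exact/measurable_EFinP].
transitivity (\int[mu]_(x in (`]0%R, +oo[%classic : set R)) (f x)%:E)%E.
  apply/esym; apply: integral_itv_obnd_cbnd; apply/measurable_EFinP.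
  apply: measurable_funS mf; first exact: measurable_halfline.
  by apply: subset_itvr; rewrite bnd_simp.
rewrite [LHS]integral_mkcond; apply: eq_integral => x _.
by rewrite patchE indicE; case: (x \in _); rewrite ?mulr1 ?mulr0.
Qed.

(** The nested integrals over the closed half-line become one integral over the plane by Fubini's
    theorem, the point 0 being negligible. *)
Lemma rho_formE u v : measurable_fun halfline u -> measurable_fun halfline v ->
  test_function (restrict_half u) -> test_function (restrict_half v) ->
  rho_form rho u v = form (restrict_half u) (restrict_half v).
Proof.
move=> mu_ mv_ tu tv; rewrite /rho_form /form -Rintegral21; last exact: integrable_form.
have inner t : lebesgue_int halfline (fun s => rho (t - s) * u s * v t) =
    \int[mu]_s (rho (t - s) * restrict_half u s * v t).
  rewrite lebesgue_int_halfline.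
    by apply: eq_Rintegral => s _; rewrite /restrict_half; ring.
  apply: measurable_funM => //; apply: measurable_funM => //.
  apply: measurable_funTS; apply: (@measurableT_comp _ _ _ _ _ _ rho) => //.
  exact: measurable_funB.
(* Nothing is known about [v] off the half-line, so measurability of the inner integral in [t] is
   proved for this extension by 0. *)
pose vh t := v t * \1_(@halfline R) t.
have mvh : measurable_fun setT vh.
  have -> : vh = (v \_ halfline)%function.
    by apply/funext => t; rewrite /vh patchE indicE; case: (t \in _); rewrite ?mulr1 ?mulr0.
  exact/(measurable_restrictT _ measurable_halfline).
pose g t := \int[mu]_s (form_kernel (restrict_half u) vh (s, t)).
have mg : measurable_fun setT g.
  apply: (@measurable_Rintegral1 _ _ rR rR R mu (form_kernel (restrict_half u) vh)).
  by apply: measurable_form_kernel => //; case: tu.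
have Hg t : halfline t -> lebesgue_int halfline (fun s => rho (t - s) * u s * v t) = g t.
  move=> Ht; rewrite inner; apply: eq_Rintegral => s _.
  by rewrite /form_kernel/= /vh indicE mem_set// mulr1.
rewrite lebesgue_int_halfline; last first.
  apply: (@eq_measurable_fun _ _ _ _ _ g); last exact: measurable_funTS.
  by move=> t /set_mem Ht; rewrite Hg.
apply: eq_Rintegral => t _; rewrite indicE; case: (boolP (t \in _)) => [/set_mem Ht|tH].
  have Ht' : halfline t by move: Ht; rewrite /halfline /= !in_itv/= !andbT => /ltW.
  have e1 : \1_(@halfline R) t = 1 :> R by rewrite indicE mem_set.
  have e2 : \1_(`]0, +oo[ : set R) t = 1 :> R by rewrite indicE mem_set.
  rewrite mulr1 (Hg _ Ht') /g; apply: eq_Rintegral => s _.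
  by rewrite /form_kernel/= /vh [restrict_half v t]/restrict_half e1 e2.
rewrite mulr0 /form_kernel/= [restrict_half v t]/restrict_half indicE (negbTE tH) mulr0.
under eq_Rintegral do rewrite mulr0.
by rewrite Rintegral_cst//= mul0r.
Qed.

End Form.

(** * Uniform approximation by elementary functions *)

Section StepApprox.
Context {R : realType}.
Local Notation mu := (@lebesgue_measure R).

Lemma test_function_elementary (u : elementary (R := R)) : test_function (elementary_fun u).
Proof.
apply: test_function_sum => i; apply: test_functionZ.
apply: (@test_function_intro _ _ 1 i.2.1 i.2.2) => // s.
rewrite mul1r itv_indE indicE ger0_norm// ler_nat.
case: (boolP (s \in _)) => // /set_mem/=; rewrite in_itv/= => /andP[a b].
by rewrite (ltW a) b.
Qed.

(** Uniform convergence with errors supported in one bounded interval: easily checked for concrete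
    kernels, and strong enough for convergence of [form] with any locally integrable [rho]. *)
Definition step_approx (v : R -> R) (u : nat -> elementary) : Prop :=
  test_function v /\ exists a b : R, exists e : nat -> R,
    [/\ forall n, elementary_on_halfline (u n), e n @[n --> \oo] --> (0 : R) &
    forall n s, `|v s - elementary_fun (u n) s| <= e n * itv_ind a b s].

Lemma step_approx_cst (u : elementary) : elementary_on_halfline u ->
  step_approx (elementary_fun u) (fun _ => u).
Proof.
move=> hu; split; first exact: test_function_elementary.
exists 0, 0, (fun=> 0); split => //; first exact: cvg_cst.
by move=> n s; rewrite subrr normr0 mul0r.
Qed.

Definition scale_elementary (c : R) (u : elementary) : elementary :=
  [seq (c * i.1, i.2) | i <- u].

Lemma elementary_fun_cat (u v : elementary (R := R)) s :
  elementary_fun (u ++ v) s = elementary_fun u s + elementary_fun v s.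
Proof. by rewrite /elementary_fun big_cat. Qed.

Lemma elementary_fun_scale (c : R) (u : elementary) s :
  elementary_fun (scale_elementary c u) s = c * elementary_fun u s.
Proof. by rewrite /elementary_fun big_map mulr_sumr; apply: eq_bigr => i _; rewrite mulrA. Qed.

Lemma elementary_on_halfline_cat (u v : elementary (R := R)) :
  elementary_on_halfline u -> elementary_on_halfline v -> elementary_on_halfline (u ++ v).
Proof. by move=> hu hv i; rewrite mem_cat => /orP[/hu|/hv]. Qed.

Lemma elementary_on_halfline_scale (c : R) (u : elementary) :
  elementary_on_halfline u -> elementary_on_halfline (scale_elementary c u).
Proof. by move=> hu i /mapP[j /hu ? ->]. Qed.

Variable rho : R -> R.
Hypothesis mrho : measurable_fun setT rho.
Hypothesis irho : forall N, mu.-integrable `[- N, N] (EFin \o rho).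
Local Notation form := (form rho).

Lemma form_cvg (v w : R -> R) (vn wn : nat -> R -> R) (a b : R) (e e' : nat -> R) :
  test_function v -> test_function w -> (forall n, test_function (vn n)) -> (forall n, test_function (wn n)) ->
  (forall n s, `|v s - vn n s| <= e n * itv_ind a b s) ->
  (forall n s, `|w s - wn n s| <= e' n * itv_ind a b s) ->
  e n @[n --> \oo] --> (0 : R) -> e' n @[n --> \oo] --> (0 : R) ->
  form (vn n) (wn n) @[n --> \oo] --> form v w.
Proof.
move=> tv tw tvn twn ve we e0 e'0.
have [mv [M [N [M0 N0 vM]]]] := tv; have [mw [M' [N' [M'0 N'0 wM]]]] := tw.
(* One interval contains all supports, so that a single constant [C] serves every term. *)
pose K := N + N' + `|a| + `|b|; pose L := K - - K.
have K0 : 0 <= K by rewrite /K !addr_ge0.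
have aK : - K <= a.
  by rewrite lerNl (le_trans (ler_norm (- a)))// normrN /K; have := normr_ge0 b; lra.
have bK : b <= K by rewrite (le_trans (ler_norm b))// /K; have := normr_ge0 a; lra.
have vK s : `|v s| <= M * itv_ind (- K) K s.
  apply: (le_trans (vM s)); apply: ler_wpM2l => //.
  by have := normr_ge0 a; have := normr_ge0 b; move=> ? ?; apply: le_itv_ind; rewrite /K; lra.
have wK s : `|w s| <= M' * itv_ind (- K) K s.
  apply: (le_trans (wM s)); apply: ler_wpM2l => //.
  by have := normr_ge0 a; have := normr_ge0 b; move=> ? ?; apply: le_itv_ind; rewrite /K; lra.
have eK n s : `|v s - vn n s| <= `|e n| * itv_ind (- K) K s.
  apply: (le_trans (ve n s)); apply: (@le_trans _ _ (`|e n| * itv_ind a b s)).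
    by apply: ler_wpM2r; [exact: itv_ind_ge0|exact: ler_norm].
  by apply: ler_wpM2l => //; exact: le_itv_ind.
have e'K n s : `|w s - wn n s| <= `|e' n| * itv_ind (- K) K s.
  apply: (le_trans (we n s)); apply: (@le_trans _ _ (`|e' n| * itv_ind a b s)).
    by apply: ler_wpM2r; [exact: itv_ind_ge0|exact: ler_norm].
  by apply: ler_wpM2l => //; exact: le_itv_ind.
pose C := (K - - K) * abs_rho_mass rho L.
have KK : - K <= K by lra.
have bound p q m m' : 0 <= m -> 0 <= m' -> test_function p -> test_function q ->
   (forall s, `|p s| <= m * itv_ind (- K) K s) -> (forall s, `|q s| <= m' * itv_ind (- K) K s) ->
   `|form p q| <= m * m' * C.
  move=> m0 m'0 tp tq pm qm.
  have := @form_bound _ rho mrho irho p q m m' (- K) K L KK (lexx _) m0 m'0 tp tq pm qm.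
  by rewrite /C mulrA.
have E n : `|form v w - form (vn n) (wn n)| <= (`|e n| * M' + M * `|e' n| + `|e n| * `|e' n|) * C.
  have td := test_functionB tv (tvn n); have td' := test_functionB tw (twn n).
  (* Expanding around the limits leaves only [v], [w] and the two errors, all of which [form_bound]
     controls. *)
  have -> : form v w - form (vn n) (wn n) = form (fun s => v s - vn n s) w
     + form v (fun s => w s - wn n s) - form (fun s => v s - vn n s) (fun s => w s - wn n s).
    by rewrite !formBl// !formBr//; ring.
  rewrite 2!mulrDl; apply: (le_trans (ler_normB _ _)); apply: lerD; last exact: bound.
  by apply: (le_trans (ler_normD _ _)); apply: lerD; exact: bound.
apply/cvgrPdist_le => eps eps0.
have e0' : `|e n| @[n --> \oo] --> (0:R) by rewrite -(normr0 R); exact: cvg_norm.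
have e'0' : `|e' n| @[n --> \oo] --> (0:R) by rewrite -(normr0 R); exact: cvg_norm.
have lim : (`|e n| * M' + M * `|e' n| + `|e n| * `|e' n|) * C @[n --> \oo] --> (0 : R).
  rewrite [X in _ --> X](_ : 0 = (0 * M' + M * 0 + 0 * 0) * C); last by ring.
  apply: cvgMl; apply: cvgD; last exact: cvgM.
  by apply: cvgD; [exact: cvgMl|exact: cvgMr].
move/cvgrPdist_le : lim => /(_ _ eps0); apply: filterS => n.
rewrite sub0r normrN => /(le_trans (ler_norm _)); exact: le_trans.
Qed.

Lemma step_approx_common v u : step_approx v u -> exists N e, 
  [/\ forall n, elementary_on_halfline (u n), e n @[n --> \oo] --> (0 : R) &
    forall K, N <= K -> forall n s, `|v s - elementary_fun (u n) s| <= e n * itv_ind (- K) K s].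
Proof.
move=> [tv [a [b [e [hu e0 ve]]]]]; exists (`|a| + `|b|), (fun n => `|e n|); split => //.
  by rewrite -(normr0 R); exact: cvg_norm.
move=> K NK n s; apply: (le_trans (ve n s)); apply: (@le_trans _ _ (`|e n| * itv_ind a b s)).
  by apply: ler_wpM2r; [exact: itv_ind_ge0|exact: ler_norm].
have := normr_ge0 a; have := normr_ge0 b => b0 a0.
apply: ler_wpM2l => //; apply: le_itv_ind.
  by rewrite lerNl (le_trans (ler_norm (- a)))// normrN; lra.
by rewrite (le_trans (ler_norm b))//; lra.
Qed.

Lemma form_step_approx v w u u' : step_approx v u -> step_approx w u' ->
  form (elementary_fun (u n)) (elementary_fun (u' n)) @[n --> \oo] --> form v w.
Proof.
move=> su su'; have [N [e [_ e0 ve]]] := step_approx_common su.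
have [N' [e' [_ e'0 we]]] := step_approx_common su'.
apply: (@form_cvg _ _ _ _ (- Num.max N N') (Num.max N N') e e') => //.
- by case: su.
- by case: su'.
- by move=> n; exact: test_function_elementary.
- by move=> n; exact: test_function_elementary.
- by apply: ve; rewrite le_max lexx.
- by apply: we; rewrite le_max lexx orbT.
Qed.

Lemma step_approxB v w u u' : step_approx v u -> step_approx w u' ->
  step_approx (fun s => v s - w s) (fun n => u n ++ scale_elementary (-1) (u' n)).
Proof.
move=> su su'; have [N [e [hu e0 ve]]] := step_approx_common su.
have [N' [e' [hu' e'0 we]]] := step_approx_common su'.
split; first by apply: test_functionB; [case: su|case: su'].
exists (- Num.max N N'), (Num.max N N'), (fun n => e n + e' n); split.
- by move=> n; apply: elementary_on_halfline_cat => //; exact: elementary_on_halfline_scale.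
- by rewrite -(addr0 0); exact: cvgD.
- move=> n s; rewrite elementary_fun_cat elementary_fun_scale mulrDl.
  rewrite (_ : _ - _ = (v s - elementary_fun (u n) s) - (w s - elementary_fun (u' n) s)); last by ring.
  apply: (le_trans (ler_normB _ _)); apply: lerD.
    by apply: ve; rewrite le_max lexx.
  by apply: we; rewrite le_max lexx orbT.
Qed.

End StepApprox.

(** * The Gaussian process and the covariance of its increments *)

Section GaussianField.
Context {d : measure_display} {T : measurableType d} {R : realType}.
Variable P : probability T R.
Variables (G : R -> T -> R) (sigma2 : R -> R).
Hypothesis G_gaussian : gaussian_process P G.
Hypothesis G_mean_zero : mean_zero P G.
Hypothesis G0 : forall w, G 0 w = 0.
Hypothesis G_sigma2 : increments_variance P G sigma2.
Local Notation L2 := (Lfun P 2%:E).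
Local Notation D := (deriv_elementary G).

Lemma increments_variance_even s : sigma2 (- s) = sigma2 s.
Proof.
have pos x : 0 <= x -> sigma2 (- x) = sigma2 x.
  move=> x0; have := G_sigma2 x0 (lexx 0); have := G_sigma2 (lexx 0) x0.
  rewrite subr0 sub0r => A B; apply: EFin_inj; rewrite -A -B; congr (expectation P _).
  by apply/funext => w; ring.
have [s0|s0] := leP 0 s; first exact: pos.
by have := pos (- s); rewrite opprK oppr_ge0 => -> //; exact: ltW.
Qed.

Lemma increments_variance_0 : sigma2 0 = 0.
Proof.
have := G_sigma2 (lexx 0) (lexx 0); rewrite subr0.
have -> : (fun w => (G 0 w - G 0 w) ^+ 2) = cst 0.
  by apply/funext => w; rewrite subrr expr0n.
rewrite expectation_cst => /esym H; exact: (EFin_inj H).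
Qed.

Lemma gauss_moments_process_Lfun2 x : 0 <= x -> G x \in L2.
Proof.
move=> x0; apply: gauss_moments_Lfun2; apply: gaussian_rv_moments; last exact: G_mean_zero.
have := @G_gaussian 1%N (fun=> x) (fun=> 1) (fun=> x0).
by under eq_fun do rewrite big_ord1 mul1r.
Qed.

Lemma gauss_moments_process (s : seq (R * R)) : (forall i, i \in s -> 0 <= i.2) ->
  gauss_moments P (fun w => \sum_(i <- s) i.1 * G i.2 w).
Proof.
move=> s0; apply: gaussian_rv_moments.
  have := @G_gaussian (size s) (fun i => (tnth (in_tuple s) i).2) (fun i => (tnth (in_tuple s) i).1).
  have H i : 0 <= (tnth (in_tuple s) i).2 by apply: s0; exact: mem_tnth.
  move=> /(_ H); congr (gaussian_rv P _); apply/funext => w.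
  by rewrite [RHS]big_tnth.
suff [_ E0] : (fun w => \sum_(i <- s) i.1 * G i.2 w) \in L2 /\
    expectation P (fun w => \sum_(i <- s) i.1 * G i.2 w) = 0%E by [].
elim: s s0 => [|i s IH] s0.
  under eq_fun do rewrite big_nil; split; first exact: Lfun2_0.
  by rewrite expectation_cst.
have s0' j : j \in s -> 0 <= j.2 by move=> js; apply: s0; rewrite inE js orbT.
have [sL2 E0] := IH s0'.
have iL2 : G i.2 \in L2 by apply: gauss_moments_process_Lfun2; apply: s0; rewrite mem_head.
have L1 X : X \in L2 -> X \in Lfun P 1 by move=> /Lfun2_integrable /Lfun1_integrable.
under eq_fun do rewrite big_cons.
split; first by apply: Lfun2D => //; exact: Lfun2Z.
rewrite (@expectationD _ _ _ P (fun w => i.1 * G i.2 w)); [|exact/L1/Lfun2Z|exact: L1].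
have -> : (expectation P (fun w => i.1 * G i.2 w)%R = i.1%:E * expectation P (G i.2))%E.
  rewrite -(expectationZl _ (L1 _ iL2)); congr (expectation P _).
  by apply/funext => w /=; rewrite mulrC.
rewrite E0 adde0.
by rewrite G_mean_zero ?mule0//; apply: s0; rewrite mem_head.
Qed.

Lemma deriv_elementaryE (u : elementary) w : D u w =
  \sum_(i <- [seq (i.1, i.2.2) | i <- u] ++ [seq (- i.1, i.2.1) | i <- u]) i.1 * G i.2 w.
Proof.
rewrite big_cat !big_map /= -big_split /=; apply: eq_bigr => i _ /=.
by rewrite mulrBr mulNr.
Qed.

Lemma deriv_elementary_cat (u v : elementary) w : D (u ++ v) w = D u w + D v w.
Proof. by rewrite /deriv_elementary big_cat. Qed.

Lemma deriv_elementary_scale c (u : elementary) w :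
  D (scale_elementary c u) w = c * D u w.
Proof. by rewrite /deriv_elementary big_map mulr_sumr; apply: eq_bigr => i _; rewrite mulrA. Qed.

Lemma gauss_moments_deriv_elementary (u : elementary) : elementary_on_halfline u ->
  gauss_moments P (D u).
Proof.
move=> hu; rewrite (funext (deriv_elementaryE u)).
apply: gauss_moments_process => i; rewrite mem_cat => /orP[] /mapP[j ju ->] /=.
  by have /andP[a b] := hu j ju; exact: le_trans b.
by have /andP[] := hu j ju.
Qed.

Lemma deriv_elementary_Lfun2 (u : elementary) : elementary_on_halfline u -> D u \in L2.
Proof. by move=> /gauss_moments_deriv_elementary/gauss_moments_Lfun2. Qed.

(** Polarization: as [G 0 = 0], the variance of [G x] is [sigma2 x], and the cross term is read off
    from the variance of [G x - G y]. *)
Lemma ip_process x y : 0 <= x -> 0 <= y ->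
  ip P (G x) (G y) = 2^-1 * (sigma2 x + sigma2 y - sigma2 (x - y)).
Proof.
move=> x0 y0; have Gx := gauss_moments_process_Lfun2 x0; have Gy := gauss_moments_process_Lfun2 y0.
have V a b : 0 <= a -> 0 <= b -> ip P (fun w => G a w - G b w) (fun w => G a w - G b w) = sigma2 (a - b).
  move=> a0 b0; have := G_sigma2 a0 b0; rewrite unlock => H.
  rewrite /ip /Rintegral; under eq_integral do rewrite -expr2.
  by rewrite H.
have V0 a : 0 <= a -> ip P (G a) (G a) = sigma2 a.
  move=> a0; have := V a 0 a0 (lexx 0); rewrite subr0 => <-.
  by congr ip; apply/funext => w; rewrite G0 subr0.
have := V x y x0 y0; rewrite ipBl ?ipBr//; last exact: Lfun2B.
rewrite !V0// (ipC P (G y)) => <-; by field.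
Qed.

Lemma ip_increments a b a' b' : 0 <= a -> 0 <= b -> 0 <= a' -> 0 <= b' ->
  ip P (fun w => G b w - G a w) (fun w => G b' w - G a' w) =
  2^-1 * (sigma2 (b' - a) - sigma2 (a' - a) - sigma2 (b' - b) + sigma2 (a' - b)).
Proof.
move=> a0 b0 a'0 b'0.
have [Ga Gb Ga' Gb'] := And4 (gauss_moments_process_Lfun2 a0) (gauss_moments_process_Lfun2 b0)
  (gauss_moments_process_Lfun2 a'0) (gauss_moments_process_Lfun2 b'0).
rewrite ipBl//; last exact: Lfun2B.
rewrite !ipBr// !ip_process//.
rewrite -(increments_variance_even (b' - a)) -(increments_variance_even (a' - a)).
rewrite -(increments_variance_even (b' - b)) -(increments_variance_even (a' - b)) !opprB.
by ring.
Qed.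

Variable k : nat.
Hypothesis k_ge1 : (1 <= k)%N.
Hypothesis sigma2_small : sigma2 h / h @[h --> 0^'+] --> (0 : R).
Hypothesis sigma2_diff : forall s : R, s != 0 ->
  derivable sigma2 s 1 /\ derivable (sigma2^`())%classic s 1.
Hypothesis rho_locint : locally_integrable setT (fun x => rho_of sigma2 x ^+ k).
Hypothesis rho_bounded : forall delta M : R, 0 < delta -> delta < M ->
  exists C : R, forall x, delta <= x <= M -> `|rho_of sigma2 `|x| | <= C.
Local Notation rho := (rho_of sigma2).
Local Notation mu := (@lebesgue_measure R).

Let sigma2_even := increments_variance_even.
Let sigma2_0 := increments_variance_0.

Lemma measurable_rho_of : measurable_fun setT rho.
Proof. exact: (measurable_rho sigma2_even sigma2_0 sigma2_small sigma2_diff). Qed.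

Lemma integrable_rho_of N : mu.-integrable `[- N, N] (EFin \o rho).
Proof. exact: (integrable_rho k_ge1 sigma2_even sigma2_0 sigma2_small sigma2_diff rho_locint). Qed.

Local Notation mrho := measurable_rho_of.
Local Notation irho := integrable_rho_of.

Lemma Rintegral_indic_itv (a b : R) (h : R -> R) : measurable_fun setT h ->
  \int[mu]_x (\1_(`]a, b] : set R) x * h x) = \int[mu]_(x in `[a, b]) h x.
Proof.
move=> mh; rewrite /Rintegral; congr fine.
rewrite -integral_itv_obnd_cbnd; last exact/measurable_EFinP/measurable_funTS.
rewrite [RHS]integral_mkcond; apply: eq_integral => x _.
by rewrite patchE indicE; case: (x \in _); rewrite ?mul1r ?mul0r.
Qed.

Lemma form_indic (a b a' b' : R) : a <= b -> a' <= b' ->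
  form rho (\1_(`]a, b] : set R)) (\1_(`]a', b'] : set R)) =
  2^-1 * (sigma2 (b' - a) - sigma2 (a' - a) - sigma2 (b' - b) + sigma2 (a' - b)).
Proof.
move=> ab ab'.
have tf (x y : R) : test_function (\1_(`]x, y] : set R)).
  have := test_function_elementary [:: (1, (x, y))].
  by rewrite (_ : elementary_fun _ = \1_(`]x, y] : set R))//; apply/funext => s; rewrite /elementary_fun big_seq1 mul1r.
have mi (x y : R) : measurable_fun setT (\1_(`]x, y] : set R) : R -> R) by case: (tf x y).
rewrite /form -Rintegral21; last by apply: integrable_form => //; [exact: mrho|exact: irho].
transitivity (\int[mu]_t (\1_(`]a', b'] : set R) t * \int[mu]_(s in `[a, b]) rho (t - s))).
  apply: eq_Rintegral => t _; rewrite /form_kernel/=.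
  rewrite -Rintegral_indic_itv; last first.
    apply: (@measurableT_comp _ _ _ _ _ _ rho); first exact: mrho.
    exact: measurable_funB.
  have [->|->] : \1_(`]a', b'] : set R) t = 0 :> R \/ \1_(`]a', b'] : set R) t = 1 :> R.
  - by rewrite indicE; case: (t \in _); [right|left].
  - rewrite mul0r; under eq_Rintegral do rewrite mulr0.
    by rewrite Rintegral_cst//= mul0r.
  - by rewrite mul1r; apply: eq_Rintegral => s _; rewrite mulr1 mulrC.
rewrite Rintegral_indic_itv; last first.
  have -> : (fun t => \int[mu]_(s in `[a, b]) rho (t - s)) = fun t =>
      \int[mu]_s form_kernel rho (\1_(`]a, b] : set R)) (fun=> 1) (s, t).
    apply/funext => t; rewrite -Rintegral_indic_itv; last first.
      apply: (@measurableT_comp _ _ _ _ _ _ rho); first exact: mrho.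
      exact: measurable_funB.
    by apply: eq_Rintegral => s _; rewrite /form_kernel/= mulr1 mulrC.
  apply: (@measurable_Rintegral1 _ _ (measurableTypeR R) (measurableTypeR R) R mu (form_kernel rho (\1_(`]a, b] : set R)) (fun=> 1))).
  by apply: measurable_form_kernel => //; exact: mrho.
rewrite (integral2_rho k_ge1 sigma2_even sigma2_0 sigma2_small sigma2_diff rho_locint rho_bounded ab ab').
by rewrite /half_sigma2; ring.
Qed.

(** Both sides are bilinear in the lists, so induction reduces the identity to two intervals, for
    which [ip_increments] and [form_indic] give the same second difference of [sigma2]. *)
Lemma ip_deriv_elementary (u v : elementary) :
  elementary_on_halfline u -> elementary_on_halfline v ->
  ip P (D u) (D v) = form rho (elementary_fun u) (elementary_fun v).
Proof.
move=> hu hv.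
have cons1 (i : R * (R * R)) (w : elementary) : i :: w = [:: i] ++ w by [].
have tail (i : R * (R * R)) (w : elementary) : elementary_on_halfline (i :: w) ->
   elementary_on_halfline [:: i] /\ elementary_on_halfline w.
  move=> h; split=> j; first by rewrite inE => /eqP ->; apply: h; rewrite mem_head.
  by move=> jw; apply: h; rewrite inE jw orbT.
have te w := @test_function_elementary R w.
(* Zero is written as [0 * 0] so that the empty list is handled by homogeneity of [ip] and
   [form]. *)
have e0 : elementary_fun (R := R) [::] = fun s => 0 * 0 by apply/funext => s; rewrite /elementary_fun big_nil mul0r.
have D0 : D [::] = fun w => 0 * 0 by apply/funext => w; rewrite /deriv_elementary big_nil mul0r.
have E1 (i : R * (R * R)) : elementary_fun [:: i] = fun s => i.1 * \1_(`]i.2.1, i.2.2] : set R) s.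
  by apply/funext => s; rewrite /elementary_fun big_seq1.
have D1 (i : R * (R * R)) : D [:: i] = fun w => i.1 * (G i.2.2 w - G i.2.1 w).
  by apply/funext => s; rewrite /deriv_elementary big_seq1.
have t1 (a b : R) : test_function (\1_(`]a, b] : set R)).
  have := te [:: (1, (a, b))]; rewrite E1 (_ : (fun s => _) = \1_(`]a, b] : set R))//=.
  by apply/funext => s; rewrite mul1r.
have H1 (i j : R * (R * R)) : elementary_on_halfline [:: i] -> elementary_on_halfline [:: j] ->
    ip P (D [:: i]) (D [:: j]) = form rho (elementary_fun [:: i]) (elementary_fun [:: j]).
  move=> hi hj; have /andP[i0 i1] := hi i (mem_head _ _); have /andP[j0 j1] := hj j (mem_head _ _).
  have [Gi1 Gi2 Gj1 Gj2] := And4 (gauss_moments_process_Lfun2 i0) (gauss_moments_process_Lfun2 (le_trans i0 i1))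
    (gauss_moments_process_Lfun2 j0) (gauss_moments_process_Lfun2 (le_trans j0 j1)).
  rewrite !D1 !E1 ipZl; [|exact: Lfun2B|by apply: Lfun2Z; exact: Lfun2B].
  rewrite ipZr; [|exact: Lfun2B|exact: Lfun2B].
  rewrite ip_increments//; [|exact: le_trans i1|exact: le_trans j1].
  rewrite formZl//; [|exact: mrho|exact: irho|by apply: test_functionZ].
  rewrite formZr//; [|exact: mrho|exact: irho].
  by rewrite form_indic.
have H2 (i : R * (R * R)) : elementary_on_halfline [:: i] ->
    ip P (D [:: i]) (D v) = form rho (elementary_fun [:: i]) (elementary_fun v).
  move=> hi; elim: v hv => [|j v IH] hv.
    rewrite D0 e0 ipZr; [|exact: Lfun2_0|exact: deriv_elementary_Lfun2].
    by rewrite formZr ?mul0r//; [exact: mrho|exact: irho|exact: test_function0].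
  have [hj hv'] := tail _ _ hv; rewrite cons1.
  rewrite (funext (deriv_elementary_cat [:: j] v)) (funext (elementary_fun_cat [:: j] v)).
  rewrite ipDr; [|exact: deriv_elementary_Lfun2..].
  rewrite formDr//; [|exact: mrho|exact: irho].
  by rewrite IH// H1.
elim: u hu => [|i u IH] hu.
  rewrite D0 e0 ipZl; [|exact: Lfun2_0|exact: deriv_elementary_Lfun2].
  by rewrite formZl ?mul0r//; [exact: mrho|exact: irho|exact: test_function0].
have [hi hu'] := tail _ _ hu; rewrite cons1.
rewrite (funext (deriv_elementary_cat [:: i] u)) (funext (elementary_fun_cat [:: i] u)).
rewrite ipDl; [|exact: deriv_elementary_Lfun2..].
rewrite formDl//; [|exact: mrho|exact: irho].
by rewrite IH// H2.
Qed.

End GaussianField.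

(** * L^2 limits of Gaussian variables *)

Lemma cvgX {R : realType} (I : Type) (F : set_system I) {FF : Filter F} (u : I -> R) (l : R) n :
  u x @[x --> F] --> l -> u x ^+ n @[x --> F] --> l ^+ n.
Proof. by move=> ul; exact: (cvg_comp u _ ul (@exprn_continuous R n l)). Qed.

Section GaussLimit.
Context {d : measure_display} {T : measurableType d} {R : realType}.
Variable P : probability T R.
Local Notation L2 := (Lfun P 2%:E).

Lemma nm_cvg (Zn : nat -> T -> R) (Z : T -> R) : (forall n, Zn n \in L2) -> Z \in L2 ->
  nm P (fun w => Zn n w - Z w) @[n --> \oo] --> (0 : R) ->
  nm P (Zn n) @[n --> \oo] --> nm P Z.
Proof.
move=> Zn2 Z2 Z0; apply/cvgrPdist_le => e e0.
move/cvgrPdist_le : Z0 => /(_ _ e0); apply: filterS => n.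
rewrite sub0r normrN ger0_norm ?nm_ge0//; apply: le_trans.
have A : nm P Z <= nm P (fun w => Zn n w - Z w) + nm P (Zn n).
  rewrite nm_distC; have := nmD (Lfun2B Z2 (Zn2 n)) (Zn2 n).
  by under eq_fun do rewrite subrK.
have B : nm P (Zn n) <= nm P (fun w => Zn n w - Z w) + nm P Z.
  have := nmD (Lfun2B (Zn2 n) Z2) Z2.
  by under eq_fun do rewrite subrK.
by rewrite ler_norml; apply/andP; split; lra.
Qed.

(** Rapidly converging terms are interleaved with copies of [Z]. The combined sequence is fast
    Cauchy, hence converges almost everywhere, and its odd terms identify the limit as [Z]. *)
Lemma ae_cvg_subsequence (Zn : nat -> T -> R) (Z : T -> R) :
  (forall n, Zn n \in L2) -> Z \in L2 ->
  nm P (fun w => Zn n w - Z w) @[n --> \oo] --> (0 : R) ->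
  exists phi : nat -> nat, {ae P, forall w, Zn (phi n) w @[n --> \oo] --> Z w}.
Proof.
move=> Zn2 Z2 Z0.
have /boolp.choice[phi phiP] : forall j, exists n, nm P (fun w => Zn n w - Z w) <= 2 ^- j.
  move=> j; have j0 : 0 < 2 ^- j :> R by rewrite invr_gt0 exprn_gt0.
  move/cvgrPdist_le : Z0 => /(_ _ j0) [n _ /(_ n (leqnn n))] /=.
  by rewrite sub0r normrN ger0_norm ?nm_ge0// => ?; exists n.
pose W j := if odd j then Z else Zn (phi j).
have W2 j : W j \in L2 by rewrite /W; case: ifP.
have Wc j : nm P (fun w => W j w - W j.+1 w) <= 2 ^- j.
  rewrite /W /=; case: (odd j) => /=; last exact: phiP.
  rewrite nm_distC; apply: (le_trans (phiP _)); rewrite lef_pV2 ?posrE ?exprn_gt0//.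
  by rewrite exprS ler_peMl ?exprn_ge0// ler1n.
exists (fun n => phi n.*2); have := cvg_ae_fast_cauchy W2 Wc; apply: filterS => w cW.
have sub (f : nat -> nat) : (forall n, n <= f n)%N -> W (f n) w @[n --> \oo] --> limn (fun n => W n w).
  move=> nf; apply: (@cvg_comp _ _ _ f (fun n => W n w) _ \oo); last exact: cW.
  by move=> A [n _ An]; exists n => // m /= nm; apply: An => /=; exact: leq_trans (nf m).
have h1 : W n.*2.+1 w @[n --> \oo] --> limn (fun n => W n w).
  by apply: sub => n; rewrite -addnn -addnS leq_addr.
have h2 : W n.*2 w @[n --> \oo] --> limn (fun n => W n w).
  by apply: sub => n; rewrite -addnn leq_addr.
have <- : limn (fun n => W n w) = Z w.
  have : W n.*2.+1 w @[n --> \oo] --> Z w.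
    by under eq_fun do rewrite /W /= odd_double; exact: cvg_cst.
  by move=> h; apply: (cvg_unique _ h1 h).
by move: h2; under eq_fun do rewrite /W odd_double.
Qed.

Lemma gauss_moments_bound (X : T -> R) B p : gauss_moments P X -> nm P X <= B ->
  \int[P]_w (X w ^+ p) <= (gauss_moment p)%:R * B ^+ p.
Proof.
move=> [mX gX] XB; have [_ ->] := gX p; apply: ler_wpM2l => //.
by apply: lerXn2r; rewrite ?nnegrE ?nm_ge0// (le_trans (nm_ge0 _ _) XB).
Qed.

(** Fatou's lemma along an almost everywhere convergent choice of terms gives [Z] all its moments.
    Then [Zn ^+ p - Z ^+ p] factors through [Zn - Z], and the Cauchy-Schwarz inequality shows that
    moments converge: the cofactors [Q] stay bounded in L^2, Gaussian moments of all orders being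
    controlled by the norm. *)
Lemma gauss_moments_limit (Zn : nat -> T -> R) (Z : T -> R) :
  (forall n, gauss_moments P (Zn n)) -> Z \in L2 ->
  nm P (fun w => Zn n w - Z w) @[n --> \oo] --> (0 : R) ->
  gauss_moments P Z.
Proof.
move=> Zg Z2 Z0.
have Zn2 n : Zn n \in L2 by exact: gauss_moments_Lfun2.
have mZ : measurable_fun setT Z by exact: Lfun2_measurable Z2.
have mZn n : measurable_fun setT (Zn n) by exact: Lfun2_measurable (Zn2 n).
have nmc := nm_cvg Zn2 Z2 Z0.
have [B ZB] : exists B, forall n, nm P (Zn n) <= B.
  have /cvgP/cvg_seq_bounded [B [_ /(_ (B + 1))]] := nmc.
  rewrite ltrDl ltr01 => /(_ isT) H; exists (B + 1) => n.
  by apply: le_trans (ler_norm _) (H n _).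
have iZn n p : P.-integrable setT (EFin \o (fun w => Zn n w ^+ p)) by have [_ /(_ p)[]] := Zg n.
have i2 p : P.-integrable setT (EFin \o (fun w => Z w ^+ (2 * p))).
  have [phi aephi] := ae_cvg_subsequence Zn2 Z2 Z0.
  have mZp : measurable_fun setT (fun w => (Z w ^+ (2 * p))%:E).
    by apply/measurable_EFinP; exact: measurable_funX.
  have e0 (x : R) : 0 <= x ^+ (2 * p) by rewrite exprM exprn_ge0// sqr_ge0.
  apply/integrableP; split => //.
  apply: (@le_lt_trans _ _ ((gauss_moment (2 * p))%:R * B ^+ (2 * p))%:E); last by rewrite ltry.
  apply: (@fatou_bound _ _ _ P (fun n w => (Zn (phi n) w ^+ (2 * p))%:E) _) => //.
  - by move=> n; apply/measurable_EFinP; exact: measurable_funX.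
  - by move=> n w; rewrite lee_fin.
  - by apply: measurableT_comp.
  - move: aephi; apply: filterS => w cw /=.
    rewrite ger0_norm//; apply: cvg_EFin; first exact: nearW.
    exact: cvgX.
  - move=> n; rewrite -[leLHS]fineK; last by apply: integrable_fin_num => //; exact: iZn.
    by rewrite lee_fin; exact: gauss_moments_bound.
have iZ p : P.-integrable setT (EFin \o (fun w => Z w ^+ p)).
  have i1 : P.-integrable setT (EFin \o (fun w => 1 + Z w ^+ (2 * p))).
    have := integrableD measurableT (finite_measure_integrable_cst P 1 measurableT) (i2 p).
    exact: eq_integrable.
  apply: le_integrable i1 => //; first by apply/measurable_EFinP; exact: measurable_funX.
  move=> w _; rewrite /= lee_fin [leRHS]ger0_norm; last first.
    by rewrite addr_ge0// exprM exprn_ge0// sqr_ge0.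
  rewrite mulnC exprM -real_normK ?num_real//; have := sqr_ge0 (`|Z w ^+ p| - 1); nra.
split => // p; split; first exact: iZ.
suff H : \int[P]_w (Zn n w ^+ p) @[n --> \oo] --> \int[P]_w (Z w ^+ p).
  have H' : (gauss_moment p)%:R * nm P (Zn n) ^+ p @[n --> \oo] --> (gauss_moment p)%:R * nm P Z ^+ p.
    by apply: cvgMr; exact: cvgX.
  have e : (fun n => \int[P]_w (Zn n w ^+ p)) = (fun n => (gauss_moment p)%:R * nm P (Zn n) ^+ p).
    by apply/funext => n; have [_ /(_ p)[]] := Zg n.
  by rewrite e in H; exact: (cvg_unique _ H H').
pose Q n i w := Zn n w ^+ (p.-1 - i) * Z w ^+ i.
(* By [(x * y) ^+ 2 <= x ^+ 4 + y ^+ 4] this bounds the squared norm of [Q n i] independently of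
   [n]. *)
pose C i := (gauss_moment (4 * (p.-1 - i)))%:R * B ^+ (4 * (p.-1 - i)) + \int[P]_w (Z w ^+ (4 * i)).
have QD n i w : Q n i w ^+ 2 <= Zn n w ^+ (4 * (p.-1 - i)) + Z w ^+ (4 * i).
  have H (x y : R) : (x * y) ^+ 2 <= x ^+ 4 + y ^+ 4.
    have h x' : 0 <= x' ^+ 4 :> R by rewrite -[4%N]/(2 * 2)%N exprM sqr_ge0.
    have h2 : 0 <= 2^-1 * ((x ^+ 2 - y ^+ 2) ^+ 2 + (x ^+ 4 + y ^+ 4)).
      by rewrite mulr_ge0// addr_ge0 ?sqr_ge0// addr_ge0.
    by rewrite -subr_ge0; move: h2; congr (0 <= _); field.
  by rewrite /Q mulnC exprM [(4 * i)%N]mulnC exprM; exact: H.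
have iD n i : P.-integrable setT (EFin \o (fun w => Zn n w ^+ (4 * (p.-1 - i)) + Z w ^+ (4 * i))).
  have := integrableD measurableT (iZn n (4 * (p.-1 - i))%N) (iZ (4 * i)%N); exact: eq_integrable.
have Q2 n i : Q n i \in L2.
  by apply: (Lfun2_dominated _ (iD n i)) => //; apply: measurable_funM; exact: measurable_funX.
have Qn n i : nm P (Q n i) <= Num.sqrt (C i).
  apply: ler_wsqrtr; apply: (@le_trans _ _ (\int[P]_w (Zn n w ^+ (4 * (p.-1 - i)) + Z w ^+ (4 * i)))).
    apply: le_Rintegral => //; first exact: Lfun2_mul_integrable.
    by move=> w _; rewrite -expr2; exact: QD.
  rewrite RintegralD//; apply: lerD => //; exact: gauss_moments_bound.
apply/cvgrPdist_le => e e0.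
have lim : nm P (fun w => Zn n w - Z w) * (\sum_(i < p) Num.sqrt (C i)) @[n --> \oo] --> (0 : R).
  by rewrite -[X in _ --> X](mul0r (\sum_(i < p) Num.sqrt (C i))); exact: cvgMl.
move/cvgrPdist_le : lim => /(_ _ e0); apply: filterS => n.
rewrite sub0r normrN => /(le_trans (ler_norm _)); apply: le_trans.
rewrite distrC -RintegralB//.
have -> : \int[P]_w (Zn n w ^+ p - Z w ^+ p) = \sum_(i < p) ip P (Q n i) (fun w => Zn n w - Z w).
  rewrite -ip_suml//; last exact: Lfun2B.
  by apply: eq_Rintegral => w _; rewrite subrXX mulrC.
apply: (le_trans (ler_norm_sum _ _ _)); rewrite mulr_sumr; apply: ler_sum => i _.
apply: (le_trans (ip_CS (Q2 n i) (Lfun2B (Zn2 n) Z2))); rewrite mulrC.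
by apply: ler_wpM2l; [exact: nm_ge0|exact: Qn].
Qed.

End GaussLimit.

Section L2Limits.
Context {d : measure_display} {T : measurableType d} {R : realType}.
Variable P : probability T R.
Local Notation L2 := (Lfun P 2%:E).

Lemma nmZ a X : X \in L2 -> nm P (fun w => a * X w) = `|a| * nm P X.
Proof.
move=> X2; rewrite /nm ipZl ?ipZr//; last exact: Lfun2Z.
by rewrite mulrA -expr2 sqrtrM ?sqr_ge0// sqrtr_sqr.
Qed.

Lemma nmD_cvg (X Y : T -> R) (Xn Yn : nat -> T -> R) s t :
  (forall n, Xn n \in L2) -> (forall n, Yn n \in L2) -> X \in L2 -> Y \in L2 ->
  nm P (fun w => Xn n w - X w) @[n --> \oo] --> (0 : R) ->
  nm P (fun w => Yn n w - Y w) @[n --> \oo] --> (0 : R) ->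
  nm P (fun w => (s * Xn n w + t * Yn n w) - (s * X w + t * Y w)) @[n --> \oo] --> (0 : R).
Proof.
move=> Xn2 Yn2 X2 Y2 X0 Y0.
have lim : `|s| * nm P (fun w => Xn n w - X w) + `|t| * nm P (fun w => Yn n w - Y w) @[n --> \oo] --> (0 : R).
  rewrite [X in _ --> X](_ : 0 = `|s| * 0 + `|t| * 0); last by rewrite !mulr0 addr0.
  by apply: cvgD; exact: cvgMr.
apply: (squeeze_cvgr _ (cvg_cst 0) lim); apply: nearW => n; rewrite nm_ge0/=.
rewrite (_ : (fun w => _) = (fun w => s * (Xn n w - X w) + t * (Yn n w - Y w))); last first.
  by apply/funext => w; ring.
rewrite -!nmZ; [|exact: Lfun2B..].
by apply: nmD; apply: Lfun2Z; exact: Lfun2B.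
Qed.

Lemma ip_cvg (X Y : T -> R) (Xn Yn : nat -> T -> R) :
  (forall n, Xn n \in L2) -> (forall n, Yn n \in L2) -> X \in L2 -> Y \in L2 ->
  nm P (fun w => Xn n w - X w) @[n --> \oo] --> (0 : R) ->
  nm P (fun w => Yn n w - Y w) @[n --> \oo] --> (0 : R) ->
  ip P (Xn n) (Yn n) @[n --> \oo] --> ip P X Y.
Proof.
move=> Xn2 Yn2 X2 Y2 X0 Y0.
have lim : nm P (fun w => Xn n w - X w) * nm P (Yn n) + nm P X * nm P (fun w => Yn n w - Y w) @[n --> \oo] --> (0 : R).
  rewrite [X in _ --> X](_ : 0 = 0 * nm P Y + nm P X * 0); last by rewrite mulr0 mul0r addr0.
  by apply: cvgD; [apply: cvgM => //; exact: nm_cvg|exact: cvgMr].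
apply/cvgrPdist_le => e e0; move/cvgrPdist_le : lim => /(_ _ e0); apply: filterS => n.
rewrite sub0r normrN => /(le_trans (ler_norm _)); apply: le_trans.
rewrite distrC (_ : _ - _ = ip P (fun w => Xn n w - X w) (Yn n) + ip P X (fun w => Yn n w - Y w)).
  by apply: (le_trans (ler_normD _ _)); apply: lerD; apply: ip_CS => //; exact: Lfun2B.
by rewrite ipBl// ipBr//; ring.
Qed.

End L2Limits.

(** * Versions of the generalized derivative *)

Section GenDeriv.
Context {d : measure_display} {T : measurableType d} {R : realType}.
Variable P : probability T R.
Local Notation L2 := (Lfun P 2%:E).
Local Notation mu := (@lebesgue_measure R).
Variables (G : R -> T -> R) (rho : R -> R).
Local Notation D := (deriv_elementary G).
Local Notation form := (form rho).
Hypothesis mrho : measurable_fun setT rho.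
Hypothesis irho : forall N, mu.-integrable `[- N, N] (EFin \o rho).
Hypothesis gD : forall u : elementary, elementary_on_halfline u -> gauss_moments P (D u).
Hypothesis covD : forall u v : elementary, elementary_on_halfline u -> elementary_on_halfline v ->
  ip P (D u) (D v) = form (elementary_fun u) (elementary_fun v).

Let D2 u : elementary_on_halfline u -> D u \in L2.
Proof. by move=> /gD/gauss_moments_Lfun2. Qed.

Lemma restrict_half_elementary (u : elementary (R := R)) : elementary_on_halfline u ->
  restrict_half (elementary_fun u) = elementary_fun u.
Proof.
move=> hu; apply/funext => s; rewrite /restrict_half indicE.
case: (boolP (s \in _)) => [|s0]; rewrite ?mulr1// mulr0 /elementary_fun big_seq big1// => i iu.
rewrite indicE (_ : s \in _ = false) ?mulr0//; apply/negbTE; apply: contra s0 => /set_mem/=.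
have /andP[i0 _] := hu i iu; rewrite in_itv/= => /andP[is_ _].
by apply/mem_set; rewrite /= in_itv/= andbT (le_lt_trans i0).
Qed.

Lemma rho_form_residual (phi : R -> R) (u : elementary) : measurable_fun setT phi ->
  test_function (restrict_half phi) -> elementary_on_halfline u ->
  rho_form rho (fun s => phi s - elementary_fun u s) (fun s => phi s - elementary_fun u s) =
  form (fun s => restrict_half phi s - elementary_fun u s) (fun s => restrict_half phi s - elementary_fun u s).
Proof.
move=> mphi tphi hu.
have [me _] := test_function_elementary u.
have E : restrict_half (fun s => phi s - elementary_fun u s) = (fun s => restrict_half phi s - elementary_fun u s).
  by rewrite -[in RHS](restrict_half_elementary hu); apply/funext => s; rewrite /restrict_half mulrBl.
have mB : measurable_fun halfline (fun s => phi s - elementary_fun u s).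
  by apply: measurable_funTS; exact: measurable_funB.
by rewrite rho_formE// E//; apply: test_functionB => //; exact: test_function_elementary.
Qed.

(** The definition provides some approximating sequence [v]; any step approximation [u] of the same
    kernel leads to the same [Z]. For fixed [n] the squared distance of [D (u m)] and [D (v n)]
    tends to [q n] as [m] grows, and [q n] tends to 0. Explicit approximations thus serve for an
    arbitrary version. *)
Lemma is_gen_deriv_limit phi Z (u : nat -> elementary) : measurable_fun setT phi ->
  is_gen_deriv P G rho phi Z -> step_approx (restrict_half phi) u ->
  Z \in L2 /\ nm P (fun w => D (u n) w - Z w) @[n --> \oo] --> (0 : R).
Proof.
move=> mphi [v [hv vq /L2_cvgP[_ Z2 vZ]]] su; split => //.
have hu : forall n, elementary_on_halfline (u n) by case: su => _ [a [b [e []]]].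
have tphi : test_function (restrict_half phi) by case: su.
pose q n := form (fun s => restrict_half phi s - elementary_fun (v n) s)
                 (fun s => restrict_half phi s - elementary_fun (v n) s).
have q0 : q n @[n --> \oo] --> (0 : R).
  by move: vq; apply: cvg_trans; apply: near_eq_cvg; apply: nearW => n; rewrite /q rho_form_residual.
have DB n m : (fun w => D (u m) w - D (v n) w) = D (u m ++ scale_elementary (-1) (v n)).
  by apply/funext => w; rewrite deriv_elementary_cat deriv_elementary_scale mulN1r.
have lim n : nm P (fun w => D (u m) w - D (v n) w) ^+ 2 @[m --> \oo] --> q n.
  have sB := step_approxB su (step_approx_cst (hv n)).
  have := form_step_approx mrho irho sB sB; apply: cvg_trans; apply: near_eq_cvg.
  apply: nearW => m /=; rewrite DB nm_sqr covD//.
    by apply: elementary_on_halfline_cat => //; exact: elementary_on_halfline_scale.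
  by apply: elementary_on_halfline_cat => //; exact: elementary_on_halfline_scale.
apply/cvgrPdist_lt => e e0; pose e2 := e / 2; have e20 : 0 < e2 by rewrite divr_gt0.
have e220 : 0 < e2 ^+ 2 by rewrite exprn_gt0.
have [n [qn vn]] : exists n, q n < e2 ^+ 2 /\ nm P (fun w => D (v n) w - Z w) < e2.
  have A : \forall n \near \oo, q n < e2 ^+ 2.
    move/cvgrPdist_lt : q0 => /(_ _ e220); apply: filterS => n.
    by rewrite sub0r normrN; exact: le_lt_trans (ler_norm _).
  have B : \forall n \near \oo, nm P (fun w => D (v n) w - Z w) < e2.
    move/cvgrPdist_lt : vZ => /(_ _ e20); apply: filterS => n.
    by rewrite sub0r normrN; exact: le_lt_trans (ler_norm _).
  have [N _ /(_ N (leqnn N))[? ?]] : \forall n \near \oo, q n < e2 ^+ 2 /\ nm P (fun w => D (v n) w - Z w) < e2.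
    by near=> n; split; near: n.
  by exists N.
have gap : 0 < e2 ^+ 2 - q n by rewrite subr_gt0.
move/cvgrPdist_lt : (lim n) => /(_ _ gap); apply: filterS => m.
rewrite distrC => /(le_lt_trans (ler_norm _)); rewrite ltrD2r => h.
rewrite sub0r normrN ger0_norm ?nm_ge0//.
apply: (le_lt_trans (nm_triangle (D2 (hu m)) (D2 (hv n)) Z2)).
rewrite [e](splitr e); apply: ltrD => //.
by rewrite -(@ltr_pXn2r _ 2)// nnegrE ?nm_ge0// ltW.
Unshelve. all: by end_near.
Qed.

Lemma is_gen_deriv_intro phi Z (u : nat -> elementary) : measurable_fun setT phi ->
  step_approx (restrict_half phi) u -> Z \in L2 ->
  nm P (fun w => D (u n) w - Z w) @[n --> \oo] --> (0 : R) -> is_gen_deriv P G rho phi Z.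
Proof.
move=> mphi su Z2 uZ.
have hu : forall n, elementary_on_halfline (u n) by case: su => _ [a [b [e []]]].
have tphi : test_function (restrict_half phi) by case: su.
exists u; split => //; last by apply/L2_cvgP; split => //; apply: nearW => n; exact: D2.
have -> : (fun n => rho_form rho (fun s => phi s - elementary_fun (u n) s) (fun s => phi s - elementary_fun (u n) s)) =
   (fun n => form (fun s => restrict_half phi s - elementary_fun (u n) s) (fun s => restrict_half phi s - elementary_fun (u n) s)).
  by apply/funext => n; exact: rho_form_residual.
have [_ [a [b [e [_ e0 ue]]]]] := su.
have ue' n s : `|0 * 0 - (restrict_half phi s - elementary_fun (u n) s)| <= e n * itv_ind a b s.
  by rewrite mul0r sub0r normrN.
have tn n : test_function (fun s => restrict_half phi s - elementary_fun (u n) s).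
  by apply: test_functionB => //; exact: test_function_elementary.
have t0 : test_function (fun _ : R => 0 * 0 : R) by apply: test_functionZ; exact: test_function0.
have := form_cvg mrho irho t0 t0 tn tn ue' ue' e0 e0.
by rewrite formZl//; [rewrite mul0r|exact: test_function0].
Qed.

Lemma is_gen_deriv_elementary (u : elementary) : elementary_on_halfline u ->
  is_gen_deriv P G rho (elementary_fun u) (D u).
Proof.
move=> hu; apply: (@is_gen_deriv_intro _ _ (fun=> u)).
- by have [] := test_function_elementary u.
- by rewrite restrict_half_elementary//; exact: step_approx_cst.
- exact: D2.
- rewrite (_ : (fun n => _) = fun=> 0); first exact: cvg_cst.
  apply/funext => _; rewrite /nm /ip; under eq_Rintegral do rewrite subrr mul0r.
  by rewrite Rintegral_cst//= mul0r sqrtr0.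
Qed.

Variables (phi psi : R -> R) (Z Z' : T -> R) (u u' : nat -> elementary (R := R)).
Hypotheses (mphi : measurable_fun setT phi) (mpsi : measurable_fun setT psi).
Hypotheses (su : step_approx (restrict_half phi) u) (su' : step_approx (restrict_half psi) u').
Hypotheses (gZ : is_gen_deriv P G rho phi Z) (gZ' : is_gen_deriv P G rho psi Z').

(** Combinations of versions are L^2 limits of increments along combined elementary functions, which
    are Gaussian. This is the joint Gaussianity that [wick_power_ip] asks for. *)
Lemma is_gen_deriv_gauss s t : gauss_moments P (fun w => s * Z w + t * Z' w).
Proof.
have hu : forall n, elementary_on_halfline (u n) by case: su => _ [a [b [e []]]].
have hu' : forall n, elementary_on_halfline (u' n) by case: su' => _ [a [b [e []]]].
have [Z2 uZ] := is_gen_deriv_limit mphi gZ su; have [Z'2 uZ'] := is_gen_deriv_limit mpsi gZ' su'.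
have E n : (fun w => s * D (u n) w + t * D (u' n) w) = D (scale_elementary s (u n) ++ scale_elementary t (u' n)).
  by apply/funext => w; rewrite deriv_elementary_cat !deriv_elementary_scale.
apply: (@gauss_moments_limit _ _ _ P (fun n w => s * D (u n) w + t * D (u' n) w)).
- by move=> n; rewrite E; apply: gD; apply: elementary_on_halfline_cat; exact: elementary_on_halfline_scale.
- by apply: Lfun2D; exact: Lfun2Z.
- by apply: nmD_cvg => // n; exact: D2.
Qed.

Lemma is_gen_deriv_ip : ip P Z Z' = rho_form rho phi psi.
Proof.
have hu : forall n, elementary_on_halfline (u n) by case: su => _ [a [b [e []]]].
have hu' : forall n, elementary_on_halfline (u' n) by case: su' => _ [a [b [e []]]].
have [Z2 uZ] := is_gen_deriv_limit mphi gZ su; have [Z'2 uZ'] := is_gen_deriv_limit mpsi gZ' su'.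
rewrite rho_formE//; [|exact: measurable_funTS|exact: measurable_funTS|by case: su|by case: su'].
have A : ip P (D (u n)) (D (u' n)) @[n --> \oo] --> ip P Z Z'.
  by apply: ip_cvg => // n; exact: D2.
have B : ip P (D (u n)) (D (u' n)) @[n --> \oo] --> form (restrict_half phi) (restrict_half psi).
  have := form_step_approx mrho irho su su'; apply: cvg_trans; apply: near_eq_cvg.
  by apply: nearW => n /=; rewrite covD.
exact: (cvg_unique _ A B).
Qed.

End GenDeriv.

(** [H] is read at [x] rounded down to a multiple of [n.+1%:R^-1]. Preimages under this approximant
    are countable unions of rectangles, and continuity in [x] gives the pointwise limit. *)
Lemma measurable_caratheodory {d : measure_display} {T : measurableType d} {R : realType}
    (H : R -> T -> R) :
  (forall x, measurable_fun setT (H x)) -> (forall w, continuous (fun x => H x w)) ->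
  measurable_fun setT (fun z : measurableTypeR R * T => H z.1 z.2).
Proof.
move=> mH cH.
pose h (n : nat) (z : measurableTypeR R * T) := H ((Num.floor (z.1 * n.+1%:R))%:~R / n.+1%:R) z.2.
apply: (@measurable_fun_cvg _ _ _ setT h) => [n|z _].
  move=> _ B mB; rewrite setTI.
  have -> : h n @^-1` B = \bigcup_(i : int) (`[i%:~R / n.+1%:R, (i + 1)%:~R / n.+1%:R[%classic `*` (H (i%:~R / n.+1%:R) @^-1` B)).
    apply/seteqP; split => [[x w] /= hB|[x w] [i _ [/= + hB]]].
      exists (Num.floor (x * n.+1%:R)) => //; split => //=.
      rewrite in_itv/= ler_pdivrMr ?ltr0n// ltr_pdivlMr ?ltr0n//.
      exact: floor_itv.
    rewrite in_itv/= ler_pdivrMr ?ltr0n// ltr_pdivlMr ?ltr0n// => xi.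
    by rewrite /h/= (floor_def xi).
  apply: countable_bigcupT_measurable => // i; apply: measurableX; first exact: measurable_itv.
  by rewrite -[X in measurable X]setTI; exact: mH.
apply: (@cvg_comp _ _ _ (fun n : nat => (Num.floor (z.1 * n.+1%:R))%:~R / n.+1%:R) (fun x => H x z.2) \oo (nbhs z.1)); last exact: cH.
apply/cvgrPdist_le => e e0.
have lim : n.+1%:R^-1 @[n --> \oo] --> (0 : R) by exact: cvg_harmonic.
move/cvgrPdist_le : lim => /(_ _ e0); apply: filterS => n.
rewrite sub0r normrN => /(le_trans (ler_norm _)); apply: le_trans.
have n0 : 0 < n.+1%:R :> R by rewrite ltr0n.
have /andP[a b] := floor_itv (z.1 * n.+1%:R); rewrite intrD1 in b.
have a' : (Num.floor (z.1 * n.+1%:R))%:~R / n.+1%:R <= z.1 by rewrite ler_pdivrMr.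
have b' : z.1 < (Num.floor (z.1 * n.+1%:R))%:~R / n.+1%:R + n.+1%:R^-1.
  by rewrite -(ltr_pM2r n0) mulrDl divfK ?gt_eqF// mulVf ?gt_eqF.
by rewrite ger0_norm; [rewrite lerBlDl; exact: ltW|rewrite subr_ge0].
Qed.

(** * Integrals of families of random variables *)

Section Mixture.
Context {d : measure_display} {T : measurableType d} {R : realType}.
Variable P : probability T R.
Local Notation L2 := (Lfun P 2%:E).
Local Notation mu := (@lebesgue_measure R).
Local Notation rR := (measurableTypeR R).

Variables (V : R -> T -> R) (C N : R).
Hypothesis mV : measurable_fun setT (fun z : rR * T => V z.1 z.2).
Hypothesis V2 : forall x, V x \in L2.
Hypothesis C0 : 0 <= C.
Hypothesis N0 : 0 <= N.
Hypothesis VN : forall x w, V x w = V x w * itv_ind 0 N x.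
Hypothesis VC : forall x, nm P (V x) <= C * itv_ind 0 N x.

Definition mixture (w : T) : R := \int[mu]_x V x w.

Lemma integrable_mixture W : W \in L2 ->
  (mu \x P)%E.-integrable setT (EFin \o (fun z : rR * T => W z.2 * V z.1 z.2)).
Proof.
move=> W2; have mW : measurable_fun setT W by exact: Lfun2_measurable W2.
apply/integrable12ltyP.
  apply/measurable_EFinP; apply: measurable_funM => //.
  by apply: (@measurableT_comp _ _ _ _ _ _ W) => //; exact: measurable_snd.
pose h := fun z : rR * T => `|(W z.2 * V z.1 z.2)%:E|%E.
have mh : measurable_fun setT (fubini_F P h).
  apply: measurable_fun_fubini_tonelli_F; last by move=> z; exact: abse_ge0.
  apply: measurableT_comp => //; apply/measurable_EFinP.
  apply: measurable_funM => //.
  by apply: (@measurableT_comp _ _ _ _ _ _ W) => //; exact: measurable_snd.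
apply: (@le_lt_trans _ _ (\int[mu]_x (nm P W * C * itv_ind 0 N x)%:E)%E).
  apply: ge0_le_integral => //.
  - by move=> x _; apply: integral_ge0 => w _; exact: abse_ge0.
  - by apply/measurable_EFinP; apply: measurable_funM => //; exact: measurable_itv_ind.
  - move=> x _ /=.
    have A2 X : X \in L2 -> (fun w => `|X w|) \in L2.
      move=> X2; have [mX iX] := (Lfun2P P X).1 X2.
      apply: (Lfun2_dominated _ iX); first exact: measurableT_comp.
      by move=> w; rewrite real_normK// num_real.
    have nA X : X \in L2 -> nm P (fun w => `|X w|) = nm P X.
      by move=> X2; congr Num.sqrt; apply: eq_Rintegral => w _; rewrite -!expr2 real_normK// num_real.
    have iA := Lfun2_mul_integrable (A2 _ W2) (A2 _ (V2 x)).
    rewrite (eq_integral (EFin \o (fun w => `|W w| * `|V x w|))); last by move=> w _ /=; rewrite normrM.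
    rewrite -[leLHS]fineK; last exact: integrable_fin_num.
    rewrite lee_fin -mulrA; apply: (le_trans (le_trans (ler_norm _) (ip_CS (A2 _ W2) (A2 _ (V2 x))))).
    rewrite -/(nm P (fun w => `|W w|)) -/(nm P (fun w => `|V x w|)) !nA//.
    by apply: ler_wpM2l; [exact: nm_ge0|exact: VC].
have := integrableZl measurableT (nm P W * C) (integrable_itv_ind 0 N).
move=> /integrableP[_]; apply: le_lt_trans; rewrite le_eqVlt; apply/orP; left; apply/eqP.
apply: eq_integral => x _ /=; rewrite ger0_norm// mulr_ge0 ?itv_ind_ge0// mulr_ge0//; exact: nm_ge0.
Qed.

Lemma measurable_mixture : measurable_fun setT mixture.
Proof. exact: (@measurable_Rintegral1 _ _ rR T R mu (fun z : rR * T => V z.1 z.2)). Qed.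

Lemma ip_mixture W : W \in L2 -> ip P W mixture = \int[mu]_x ip P W (V x).
Proof.
move=> W2; rewrite /ip /mixture.
transitivity (\int[P]_w (\int[mu]_x (W w * V x w))).
  have mW : measurable_fun setT W by exact: Lfun2_measurable W2.
  have m1 : measurable_fun setT (fun w => \int[mu]_x (W w * V x w)).
    apply: (@measurable_Rintegral1 _ _ rR T R mu (fun z : rR * T => W z.2 * V z.1 z.2)).
    apply: measurable_funM => //.
    by apply: (@measurableT_comp _ _ _ _ _ _ W) => //; exact: measurable_snd.
  (* Testing [integrable_mixture] with the constant 1 shows that [V x w] is integrable in [x] for
     almost every [w], which allows [W w] to be moved inside. *)
  have one2 : (fun _ : T => 1) \in L2.
    by apply/Lfun2P; split => //; apply: finite_measure_integrable_cst.
  rewrite /Rintegral; congr fine; apply: ae_eq_integral => //.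
  - by apply/measurable_EFinP; apply: measurable_funM => //; exact: measurable_mixture.
  - exact/measurable_EFinP.
  have := ae_integrable2 (integrable_mixture one2); apply: filterS => w iw _.
  have e : W w * mixture w = \int[mu]_x (W w * V x w).
    rewrite /mixture RintegralZl//.
    by apply: eq_integrable iw => // x _ /=; rewrite mul1r.
  exact: (congr1 EFin e).
rewrite (Rintegral21 (integrable_mixture W2)) -(Rintegral12 (integrable_mixture W2)).
by apply: eq_Rintegral.
Qed.

(** Jensen's inequality with a uniform weight on [[0, N]] bounds the square of the integral by an
    average of squares, whose expectation is computed by Tonelli's theorem. *)
Lemma mixture_Lfun2 : mixture \in L2.
Proof.
have mm := measurable_mixture.
apply/Lfun2P; split => //; apply/integrableP; split.
  by apply/measurable_EFinP; exact: measurable_funX.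
(* Dividing by [N + 1] keeps the mass at most 1 and makes sense for [N = 0]; the factor is given
   back in [F]. *)
pose wt x := (N + 1)^-1 * itv_ind 0 N x.
have N1 : 0 < N + 1 by rewrite ltr_wpDl.
have N1' : 0 <= (N + 1)^-1 by rewrite invr_ge0 ltW.
have mwt : measurable_fun setT wt by apply: measurable_funM => //; exact: measurable_itv_ind.
have wt0 x : 0 <= wt x by rewrite mulr_ge0// itv_ind_ge0.
have intind : (\int[mu]_x (itv_ind 0 N x)%:E = N%:E)%E.
  have e := integral_itv_ind N0; rewrite subr0 in e.
  rewrite -[LHS]fineK; first exact: (congr1 EFin e).
  exact: (integrable_fin_num measurableT (integrable_itv_ind 0 N)).
have wt1 : (\int[mu]_x (wt x)%:E <= 1)%E.
  under eq_integral do rewrite /wt EFinM.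
  rewrite ge0_integralZl//; last 2 first.
    by apply/measurable_EFinP; exact: measurable_itv_ind.
    by move=> x _; rewrite lee_fin itv_ind_ge0.
  by rewrite intind -EFinM lee_fin mulrC ler_pdivrMr// mul1r; lra.
pose F w x := (N + 1) * V x w.
have mV1 w : measurable_fun setT (fun x => V x w) by exact: (measurableT_comp mV (pair2_measurable w)).
have mF w : measurable_fun setT (F w) by exact: measurable_funM.
have bound w : ((mixture w ^+ 2)%:E <= \int[mu]_x (`|F w x| ^+ 2 * wt x)%:E)%E.
  have := @power_integral_weight _ rR R mu (F w) wt 2 (mF w) mwt wt0 wt1 isT.
  rewrite (_ : \int[mu]_x (F w x * wt x) = mixture w) ?real_normK ?num_real//.
  apply: eq_Rintegral => x _; rewrite /F /wt [RHS]VN.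
  by field; rewrite gt_eqF.
pose h := fun z : rR * T => (`|F z.2 z.1| ^+ 2 * wt z.1)%:E.
have mh : measurable_fun setT h.
  apply/measurable_EFinP; apply: measurable_funM.
    by apply: measurable_funX; apply: measurableT_comp => //; exact: measurable_funM.
  by apply: (@measurableT_comp _ _ _ _ _ _ wt) => //; exact: measurable_fst.
have h0 z : (0 <= h z)%E by rewrite lee_fin mulr_ge0// exprn_ge0.
apply: (@le_lt_trans _ _ (\int[P]_w \int[mu]_x h (x, w))%E).
  apply: ge0_le_integral => //.
  - by apply: measurableT_comp => //; apply/measurable_EFinP; exact: measurable_funX.
  - exact: measurable_fun_fubini_tonelli_G.
  - by move=> w _; rewrite /= ger0_norm ?sqr_ge0//; exact: bound.
have <- : (\int[mu]_x \int[P]_w h (x, w) = \int[P]_w \int[mu]_x h (x, w))%E by exact: fubini_tonelli.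
apply: (@le_lt_trans _ _ (\int[mu]_x ((N + 1) * C ^+ 2 * itv_ind 0 N x)%:E)%E).
  apply: ge0_le_integral => //.
  - by move=> x _; apply: integral_ge0 => w _; exact: h0.
  - exact: measurable_fun_fubini_tonelli_F.
  - by apply/measurable_EFinP; apply: measurable_funM => //; exact: measurable_itv_ind.
  move=> x _; rewrite /h /=.
  rewrite (eq_integral (fun w => ((N + 1) * itv_ind 0 N x)%:E * (V x w ^+ 2)%:E)%E); last first.
    move=> w _; rewrite -EFinM; congr EFin; rewrite /F /wt real_normK ?num_real//.
    by field; rewrite gt_eqF.
  rewrite ge0_integralZl//; last 3 first.
  - by apply/measurable_EFinP; apply: measurable_funX; exact: Lfun2_measurable (V2 x).
  - by move=> w _; rewrite lee_fin sqr_ge0.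
  - by rewrite lee_fin mulr_ge0 ?itv_ind_ge0// ltW.
  rewrite integral_sqr_nm// -EFinM lee_fin.
  have VCx : nm P (V x) <= C.
    by apply: (le_trans (VC x)); rewrite itv_indE; case: (_ && _); rewrite ?mulr1// mulr0.
  rewrite mulrAC; apply: ler_wpM2r; first exact: itv_ind_ge0.
  apply: ler_wpM2l; first exact: ltW.
  by apply: lerXn2r; rewrite ?nnegrE ?nm_ge0.
under eq_integral do rewrite EFinM.
rewrite ge0_integralZl//; last 3 first.
- by apply/measurable_EFinP; exact: measurable_itv_ind.
- by move=> x _; rewrite lee_fin itv_ind_ge0.
- by rewrite lee_fin mulr_ge0 ?sqr_ge0// ltW.
by rewrite intind -EFinM ltry.
Qed.

End Mixture.

(** * Convergence of the mollified kernels *)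

Section PowerInequalities.
Context {R : realType}.
Implicit Types a b c : R.

Lemma normr_power_add a b n : `|a + b| ^+ n <= 2 ^+ n * (`|a| ^+ n + `|b| ^+ n).
Proof.
have h : `|a + b| <= 2 * Num.max `|a| `|b|.
  apply: (le_trans (ler_normD _ _)); rewrite mulr2n mulrDl mul1r.
  by apply: lerD; rewrite le_max lexx ?orbT.
have m0 : 0 <= Num.max `|a| `|b| by rewrite le_max normr_ge0.
apply: (@le_trans _ _ ((2 * Num.max `|a| `|b|) ^+ n)).
  by apply: lerXn2r => //; rewrite nnegrE ?mulr_ge0.
rewrite exprMn; apply: ler_wpM2l; first exact: exprn_ge0.
by case: (leP `|a| `|b|) => _; rewrite ?lerDl ?lerDr exprn_ge0.
Qed.

Lemma normr_subX a b m n : 0 <= m -> `|a| <= m -> `|b| <= m ->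
  `|a ^+ n - b ^+ n| <= n%:R * m ^+ n.-1 * `|a - b|.
Proof.
move=> m0 am bm; rewrite subrXX normrM mulrC; apply: ler_wpM2r => //.
apply: (le_trans (ler_norm_sum _ _ _)).
apply: (@le_trans _ _ (\sum_(i < n) m ^+ n.-1)); last by rewrite sumr_const card_ord mulr_natl.
apply: ler_sum => i _; rewrite normrM !normrX.
have -> : n.-1 = ((n.-1 - i) + i)%N by rewrite subnK//; case: n i => [[]//|n] i; rewrite -ltnS.
by rewrite exprD addnK; apply: ler_pM; rewrite ?exprn_ge0//; apply: lerXn2r; rewrite ?nnegrE.
Qed.

(** This turns closeness in L^k into closeness of k-th powers in L^1, the large term receiving a
    small coefficient. If [a - b] is small relative to [b], the difference of powers is factored;
    otherwise [a] and [b] are both bounded by a multiple of [a - b]. *)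
Lemma power_difference_bound n (theta : R) : 0 < theta -> exists2 C, 0 <= C &
  forall a b, `|a ^+ n - b ^+ n| <= theta * `|b| ^+ n + C * `|a - b| ^+ n.
Proof.
(* [K] bounds the constant given by [normr_subX] when both numbers are at most twice the size of
   [b], and [tau] ensures [tau * K <= theta]. *)
move=> th0; pose K : R := n%:R * 2 ^+ n; pose tau := Num.min 1 (theta / (K + 1)).
have K0 : 0 <= K by rewrite mulr_ge0 ?exprn_ge0.
have K1 : 0 < K + 1 by rewrite ltr_wpDl.
have tau0 : 0 < tau by rewrite lt_min ltr01 divr_gt0.
have tau1 : tau <= 1 by rewrite ge_min lexx.
have tauK : tau * K <= theta.
  apply: (@le_trans _ _ (theta / (K + 1) * K)).
    by apply: ler_wpM2r => //; rewrite ge_min lexx orbT.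
  by rewrite mulrAC ler_pdivrMr//; apply: ler_wpM2l; [exact: ltW|rewrite lerDl].
exists (2 * (1 + tau^-1) ^+ n).
  by rewrite mulr_ge0// exprn_ge0// addr_ge0// invr_ge0 ltW.
move=> a b; have [small|big] := leP `|a - b| (tau * `|b|).
  apply: (@le_trans _ _ (theta * `|b| ^+ n)); last first.
    rewrite lerDl mulr_ge0 ?exprn_ge0// mulr_ge0// exprn_ge0// addr_ge0// invr_ge0 ltW//.
  case: n @K K0 K1 @tau tau0 tau1 tauK small => [|n] K K0 K1 tau tau0 tau1 tauK small.
    by rewrite !expr0 subrr normr0 mulr1 ltW.
  have a2 : `|a| <= 2 * `|b|.
    have -> : a = (a - b) + b by ring.
    apply: (le_trans (ler_normD _ _)); rewrite mulr2n mulrDl mul1r; apply: lerD => //.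
    by apply: (le_trans small); rewrite ler_piMl.
  have b2 : `|b| <= 2 * `|b| by rewrite ler_peMl// ler1n.
  apply: (le_trans (normr_subX n.+1 _ a2 b2)); first exact: mulr_ge0.
  rewrite [n.+1.-1]/=.
  apply: (@le_trans _ _ (n.+1%:R * (2 * `|b|) ^+ n * (tau * `|b|))).
    by apply: ler_wpM2l => //; rewrite mulr_ge0// exprn_ge0// mulr_ge0.
  apply: (@le_trans _ _ (tau * K * `|b| ^+ n.+1)); last by apply: ler_wpM2r => //; exact: exprn_ge0.
  rewrite /K [X in _ <= tau * (_ * X) * _]exprS exprMn [X in _ <= _ * X]exprS.
  rewrite (_ : _ * (tau * _) = tau * (n.+1%:R * 2 ^+ n) * (`|b| * `|b| ^+ n)); last by ring.
  apply: ler_wpM2r; first by rewrite mulr_ge0// exprn_ge0.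
  apply: ler_wpM2l; first exact: ltW.
  by apply: ler_wpM2l => //; rewrite ler_peMl ?exprn_ge0// ler1n.
have bd : `|b| <= tau^-1 * `|a - b| by rewrite mulrC ler_pdivlMr// mulrC ltW.
have ti : 0 <= tau^-1 by rewrite invr_ge0 ltW.
have ad : `|a| <= (1 + tau^-1) * `|a - b|.
  have -> : a = (a - b) + b by ring.
  rewrite subrK; apply: (le_trans _ (y := `|a - b| + `|b|)).
    by have := ler_normD (a - b) b; rewrite subrK.
  by rewrite mulrDl mul1r lerD2l.
have bd' : `|b| <= (1 + tau^-1) * `|a - b|.
  by apply: (le_trans bd); apply: ler_wpM2r => //; rewrite lerDr.
have t1 : 0 <= 1 + tau^-1 by rewrite addr_ge0.
apply: (@le_trans _ _ (2 * (1 + tau^-1) ^+ n * `|a - b| ^+ n)); last first.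
  by rewrite lerDr mulr_ge0 ?exprn_ge0// ltW.
apply: (le_trans (ler_normB _ _)); rewrite !normrX -mulrA mulr2n mulrDl mul1r -exprMn.
by apply: lerD; apply: lerXn2r; rewrite ?nnegrE ?mulr_ge0.
Qed.

End PowerInequalities.

Section ContinuousApproximation.
Context {R : realType}.
Local Notation mu := (@lebesgue_measure R).

Definition clip (m x : R) : R := Num.max (- m) (Num.min m x).

Lemma clip_bound m x : 0 <= m -> `|clip m x| <= m.
Proof.
move=> m0; rewrite ler_norml /clip le_max lexx/= ge_max ge_min lexx/= andbT.
by rewrite lerNl (le_trans _ m0)// oppr_le0.
Qed.

Lemma clip_id m x : `|x| <= m -> clip m x = x.
Proof.
rewrite ler_norml => /andP[a b]; rewrite /clip min_r// max_r//.
Qed.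

Lemma clip_lipschitz m x y : `|clip m x - clip m y| <= `|x - y|.
Proof.
have hmin (z t : R) : `|Num.min m z - Num.min m t| <= `|z - t|.
  have := ler_norm (z - t); have := ler_norm (t - z); rewrite (distrC t z).
  by case: (leP m z) => ?; case: (leP m t) => ? ? ?; rewrite ler_norml; apply/andP; split; lra.
have hmax (z t : R) : `|Num.max (- m) z - Num.max (- m) t| <= `|z - t|.
  have := ler_norm (z - t); have := ler_norm (t - z); rewrite (distrC t z).
  by case: (leP (- m) z) => ?; case: (leP (- m) t) => ? ? ?; rewrite ler_norml; apply/andP; split; lra.
exact: le_trans (hmax _ _) (hmin _ _).
Qed.

Lemma continuous_clip m : continuous (clip m).
Proof.
move=> x; apply/cvgrPdist_le => e e0.
have /cvgrPdist_le/(_ e e0) : id t @[t --> x] --> x by exact: cvg_id.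
by apply: filterS => t; exact: le_trans (clip_lipschitz _ _ _).
Qed.

Variables (rho : R -> R) (k : nat).
Hypothesis k_ge1 : (1 <= k)%N.
Hypothesis mrho : measurable_fun setT rho.
Variable L : R.
Hypothesis ik : mu.-integrable setT (EFin \o (fun u => `|rho u| ^+ k * itv_ind (- L) L u)).

(** The clipping error is dominated by the size of [rho] and vanishes at [u] once the level exceeds
    that of [rho u], so dominated convergence applies. *)
Lemma approximation_clip (eta : R) : 0 < eta -> exists2 m, 0 <= m &
  (\int[mu]_u (`|rho u - clip m (rho u)| ^+ k * itv_ind (- L) L u)%:E <= eta%:E)%E.
Proof.
move=> eta0.
pose h (n : nat) u := (`|rho u - clip n%:R (rho u)| ^+ k * itv_ind (- L) L u)%:E.
have mclip m : measurable_fun setT (fun u => clip m (rho u)).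
  apply: (@measurableT_comp _ _ _ _ _ _ (clip m)) => //.
  by apply: continuous_measurable_fun; exact: continuous_clip.
have mh n : measurable_fun setT (h n).
  apply/measurable_EFinP; apply: measurable_funM; last exact: measurable_itv_ind.
  by apply: measurable_funX; apply: measurableT_comp => //; exact: measurable_funB.
have h0 u : h n u @[n --> \oo] --> (0%:E : \bar R).
  apply: cvg_EFin; first exact: nearW.
  have : \forall n \near \oo, `|rho u| <= n%:R.
    near=> n; near: n; exact: nbhs_infty_ger.
  move=> E; apply: (@cvg_trans _ ((fun=> 0 : R) n @[n --> \oo])); last exact: cvg_cst.
  apply: near_eq_cvg; move: E; apply: filterS => n un /=.
  by rewrite clip_id// subrr normr0 expr0n gtn_eqF// mul0r.
have hd n u : (`|h n u| <= (`|rho u| ^+ k * itv_ind (- L) L u)%:E)%E.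
  rewrite lee_fin ger0_norm ?mulr_ge0 ?exprn_ge0 ?itv_ind_ge0//.
  apply: ler_wpM2r; first exact: itv_ind_ge0.
  apply: lerXn2r; rewrite ?nnegrE//.
  have n0 : 0 <= n%:R :> R by [].
  have := ler_norm (rho u); have := ler_norm (- rho u); rewrite normrN /clip => h1 h2.
  rewrite ler_norml; have [a|a] := leP n%:R (rho u).
    by rewrite max_r; [apply/andP; split; lra|lra].
  by have [b|b] := leP (- n%:R) (rho u); apply/andP; split; lra.
have [_ _ lim] : [/\ mu.-integrable setT (fun=> 0%:E : \bar R),
    (\int[mu]_u `|h n u - 0%:E|)%E @[n --> \oo] --> (0%:E : \bar R) &
    (\int[mu]_u h n u)%E @[n --> \oo] --> (\int[mu]_u (0%:E : \bar R))%E].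
  apply: (@dominated_convergence _ _ _ mu setT measurableT h (fun=> 0%:E) _ mh _ _ ik) => //.
  - by apply: aeW => u _; exact: h0.
  - by apply: aeW => u n _; exact: hd.
rewrite integral0 in lim.
have /fine_cvgP[fin lim'] : (\int[mu]_u h n u)%E @[n --> \oo] --> (0%:E : \bar R) by exact: lim.
move/cvgrPdist_le : lim' => /(_ _ eta0) near_eta.
have [n _ /(_ n (leqnn n)) [hn1 hn2]] : \forall n \near \oo, (\int[mu]_u h n u)%E \is a fin_num /\
    `|0 - fine (\int[mu]_u h n u)%E| <= eta.
  by near=> n; split; near: n.
exists n%:R => //; rewrite -[leLHS]fineK// lee_fin.
by move: hn2; rewrite sub0r normrN; exact: le_trans (ler_norm _).
Unshelve. all: by end_near.
Qed.

(** Density of continuous functions is taken in L^1, for the clipped [rho]. Between functions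
    bounded by [m] the k-th power of the difference is at most a constant times the difference, so
    closeness in L^1 gives closeness in L^k. *)
Lemma approximation_continuous (eta : R) : 0 < eta -> exists c B, [/\ continuous c, 0 <= B,
  forall x, `|c x| <= B &
  (\int[mu]_u (`|rho u - c u| ^+ k * itv_ind (- L) L u)%:E <= eta%:E)%E].
Proof.
(* [2 ^+ k] comes from splitting the k-th power of a sum, the other 2 from the two errors, of
   clipping and of approximation. *)
move=> eta0; pose eta' := eta / (2 ^+ k * 2).
have k20 : 0 < 2 ^+ k * 2 :> R by rewrite mulr_gt0// exprn_gt0.
have eta'0 : 0 < eta' by rewrite divr_gt0.
have [m m0 hm] := approximation_clip eta'0.
pose E : set (measurableTypeR R) := `[- L, L]%classic.
have mE : measurable E by exact: measurable_itv.
have finE : (mu E < +oo)%E.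
  have H : (@lebesgue_measure R (`[(- L)%R, L]%classic : set R) < +oo)%E.
    by rewrite lebesgue_measure_itv/=; case: ifP => _; rewrite ?ltry.
  exact: H.
have mclip (f : R -> R) : measurable_fun setT f -> measurable_fun setT (fun u => clip m (f u)).
  move=> mf; apply: (@measurableT_comp _ _ _ _ _ _ (clip m)) => //.
  by apply: continuous_measurable_fun; exact: continuous_clip.
have iE : mu.-integrable E (EFin \o (fun u => clip m (rho u))).
  apply: measurable_bounded_integrable => //.
    by apply: measurable_funTS; exact: mclip.
  exists m; split; first by rewrite num_real.
  by move=> M mM u _ /=; apply: le_trans (ltW mM); exact: clip_bound.
have [g [cg ig /fine_cvgP[gfin glim]]] := approximation_continuous_integrable mE finE iE.
pose D := (2 * m) ^+ k.-1 + 1.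
have D0 : 0 < D by rewrite ltr_wpDl// exprn_ge0// mulr_ge0.
have gap : 0 < eta' / D by rewrite divr_gt0.
move/cvgrPdist_le : glim => /(_ _ gap) near_eta.
have [n _ /(_ n (leqnn n)) [hn1 hn2]] : \forall n \near \oo,
    (\int[mu]_(z in E) `|(clip m (rho z) - g n z)%:E|)%E \is a fin_num /\
    `|0 - fine (\int[mu]_(z in E) `|(clip m (rho z) - g n z)%:E|)%E| <= eta' / D.
  by near=> n; split; near: n.
have hn : (\int[mu]_(z in E) `|(clip m (rho z) - g n z)%:E| <= (eta' / D)%:E)%E.
  rewrite -[leLHS]fineK// lee_fin.
  by move: hn2; rewrite sub0r normrN; exact: le_trans (ler_norm _).
have cc : continuous (fun u => clip m (g n u)).
  by move=> u; apply: (@continuous_comp _ _ _ (g n) (clip m)); [exact: cg|exact: continuous_clip].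
(* Clipping the approximant as well bounds it by [m] and, since clipping is 1-Lipschitz, takes it no
   farther from the clipped [rho]. *)
exists (fun u => clip m (g n u)), m; split => //.
  by move=> x; exact: clip_bound.
have mg : measurable_fun setT (g n) by exact: continuous_measurable_fun.
pose h1 u := (`|rho u - clip m (rho u)| ^+ k * itv_ind (- L) L u)%:E.
pose h2 u := (`|clip m (rho u) - g n u| * itv_ind (- L) L u)%:E.
have mind := measurable_itv_ind (- L) L.
have m1 : measurable_fun setT h1.
  apply/measurable_EFinP; apply: measurable_funM => //.
  by apply: measurable_funX; apply: measurableT_comp => //; apply: measurable_funB => //; exact: mclip.
have m2 : measurable_fun setT h2.
  apply/measurable_EFinP; apply: measurable_funM => //.
  by apply: measurableT_comp => //; apply: measurable_funB => //; exact: mclip.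
have h10 u : (0 <= h1 u)%E by rewrite lee_fin mulr_ge0 ?exprn_ge0 ?itv_ind_ge0.
have h20 u : (0 <= h2 u)%E by rewrite lee_fin mulr_ge0 ?itv_ind_ge0.
have hn' : (\int[mu]_u h2 u <= (eta' / D)%:E)%E.
  apply: le_trans hn; rewrite [leRHS]integral_mkcond le_eqVlt; apply/orP; left; apply/eqP.
  apply: eq_integral => u _; rewrite patchE /h2 /itv_ind indicE /=.
  by case: (u \in _); rewrite ?mulr1 ?mulr0.
apply: (@le_trans _ _ (\int[mu]_u ((2 ^+ k)%:E * h1 u + (2 ^+ k * D)%:E * h2 u))%E).
  apply: ge0_le_integral => //.
  - by move=> u _; rewrite lee_fin mulr_ge0 ?exprn_ge0 ?itv_ind_ge0.
  - apply/measurable_EFinP; apply: measurable_funM => //.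
    by apply: measurable_funX; apply: measurableT_comp => //; apply: measurable_funB => //; exact: mclip.
  - by apply: emeasurable_funD; exact: measurable_funeM.
  move=> u _; rewrite /h1 /h2 -!EFinM -EFinD lee_fin !mulrA -mulrDl.
  apply: ler_wpM2r; first exact: itv_ind_ge0.
  have -> : rho u - clip m (g n u) = (rho u - clip m (rho u)) + (clip m (rho u) - clip m (g n u)) by ring.
  apply: (le_trans (normr_power_add _ _ _)); rewrite mulrDr -mulrA lerD2l.
  apply: ler_wpM2l; first exact: exprn_ge0.
  have c2 : `|clip m (rho u) - clip m (g n u)| <= 2 * m.
    apply: (le_trans (ler_normB _ _)); rewrite mulr2n mulrDl mul1r.
    by apply: lerD; exact: clip_bound.
  rewrite -{1}(prednK k_ge1) exprSr; apply: ler_pM; rewrite ?exprn_ge0//.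
    by rewrite /D ler_wpDr//; apply: lerXn2r; rewrite ?nnegrE ?mulr_ge0.
  by have e := clip_id (clip_bound (rho u) m0); rewrite -{1}e; exact: clip_lipschitz.
rewrite ge0_integralD//; last 4 first.
- by move=> u _; rewrite mule_ge0// lee_fin exprn_ge0.
- exact: measurable_funeM.
- by move=> u _; rewrite mule_ge0// lee_fin mulr_ge0 ?exprn_ge0 ?ltW.
- exact: measurable_funeM.
rewrite !ge0_integralZl//; last by rewrite lee_fin mulr_ge0 ?exprn_ge0 ?ltW.
have -> : eta%:E = ((2 ^+ k)%:E * eta'%:E + (2 ^+ k * D)%:E * (eta' / D)%:E)%E.
  rewrite -!EFinM -EFinD /eta'; congr EFin; field.
  by rewrite gt_eqF//= gt_eqF// exprn_gt0.
by apply: leeD; apply: lee_wpmul2l => //; rewrite lee_fin ?mulr_ge0 ?exprn_ge0 ?ltW.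
Unshelve. all: by end_near.
Qed.

End ContinuousApproximation.

(** Only [u] is confined to the segment, while [v] may fall outside. Compactness turns the local
    radii of continuity into a common one. *)
Lemma uniform_continuity_segment {R : realType} (c : R -> R) (a b e : R) : continuous c -> 0 < e ->
  exists2 r, 0 < r & forall u v, a <= u <= b -> `|u - v| <= r -> `|c u - c v| <= e.
Proof.
move=> cc e0; have e20 : 0 < e / 2 by rewrite divr_gt0.
have /compact_near_coveringP cov := @segment_compact R a b.
have key (x : R) : `[a, b]%classic x -> \forall u \near x & r \near (0:R)^'+,
    forall v, `|u - v| <= r -> `|c u - c v| <= e.
  move=> _; have /cvgrPdist_le/(_ _ e20) [r /= r0 cr] := cc x.
  have r20 : 0 < r / 2 by rewrite divr_gt0.
  exists (ball x (r / 2), [set t | t < r / 2]) => /=.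
    by split; [exact: nbhsx_ballx|exact: nbhs_right_lt].
  move=> [u t] [/= xu tr] v uv.
  have ux : `|x - u| < r by apply: (lt_trans xu); rewrite ltr_pdivrMr// ltr_pMr// ltr1n.
  have vx : `|x - v| < r.
    have -> : x - v = (x - u) + (u - v) by ring.
    by rewrite (le_lt_trans (ler_normD _ _))// [r]splitr ltrD// (le_lt_trans uv).
  have -> : c u - c v = (c x - c v) - (c x - c u) by ring.
  by apply: (le_trans (ler_normB _ _)); rewrite [e]splitr; apply: lerD; exact: cr.
have H := cov _ _ _ _ key.
have [r /= r0 hr] := H; exists (r / 2); first by rewrite divr_gt0.
move=> u v uab uv; apply: (hr (r / 2)) uv => //=.
- by rewrite sub0r normrN gtr0_norm ?divr_gt0// ltr_pdivrMr// ltr_pMr// ltr1n.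
- by rewrite divr_gt0.
Qed.

(** * Mollifiers cut off at the origin, and averages of a kernel against them *)

Section Mollifier.
Context {R : realType}.
Local Notation mu := (@lebesgue_measure R).
Local Notation rR := (measurableTypeR R).

(** Wide enough to hold both a continuous approximate identity and the normalized indicator of []0,
    h]]. The bound [B] makes the shifted densities test functions. *)
Definition mollifier (delta : R) (p : R -> R) : Prop :=
  [/\ measurable_fun setT p, forall s, 0 <= p s, forall s, delta < `|s| -> p s = 0,
      (\int[mu]_s (p s)%:E = 1)%E & exists B, forall s, p s <= B].

Definition shifted (p : R -> R) (x : R) : R -> R := restrict_half (fun s => p (s - x)).

Lemma integral_prod_mul (f g : R -> R) : measurable_fun setT f -> measurable_fun setT g ->
  (forall x, 0 <= f x) -> (forall x, 0 <= g x) ->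
  (\int[mu \x mu]_z (f z.1 * g z.2)%:E = (\int[mu]_x (f x)%:E) * (\int[mu]_y (g y)%:E))%E.
Proof.
move=> mf mg f0 g0.
have mh : measurable_fun setT (fun z : rR * rR => (f z.1 * g z.2)%:E).
  apply/measurable_EFinP; apply: measurable_funM; [exact: measurable_comp_fst|exact: measurable_comp_snd].
have h0 (z : rR * rR) : (0 <= (f z.1 * g z.2)%:E)%E by rewrite lee_fin mulr_ge0.
rewrite fubini_tonelli1// /fubini_F/=.
rewrite -ge0_integralZr//; last 3 first.
- by apply/measurable_EFinP.
- by move=> x _; rewrite lee_fin.
- by apply: integral_ge0 => y _; rewrite lee_fin.
apply: eq_integral => x _; rewrite -ge0_integralZl//; last 3 first.
- by apply/measurable_EFinP.
- by move=> y _; rewrite lee_fin.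
- by rewrite lee_fin.
Qed.

Variables (delta : R) (p : R -> R).
Hypothesis pm : mollifier delta p.

Let mp : measurable_fun setT p. Proof. by case: pm. Qed.
Let p0 s : 0 <= p s. Proof. by case: pm. Qed.

Lemma mollifier_support s : p s != 0 -> `|s| <= delta.
Proof. by apply: contra_neqT; rewrite -ltNge => h; case: pm => _ _ /(_ _ h). Qed.

Lemma measurable_restrict_half (u : R -> R) : measurable_fun setT u -> measurable_fun setT (restrict_half u).
Proof. by move=> mu_; apply: measurable_funM => //; apply: measurable_indic; exact: measurable_itv. Qed.

Lemma measurable_shift (x : R) : measurable_fun setT (fun s : R => p (s - x)).
Proof. by apply: (@measurableT_comp _ _ _ _ _ _ p) => //; exact: measurable_funB. Qed.

Lemma measurable_shifted x : measurable_fun setT (shifted p x).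
Proof. by apply: measurable_restrict_half; exact: measurable_shift. Qed.

Lemma shifted_ge0 x s : 0 <= shifted p x s.
Proof. by rewrite mulr_ge0// indicE. Qed.

Lemma shifted_le x s : shifted p x s <= p (s - x).
Proof. by rewrite /shifted /restrict_half indicE; case: (s \in _); rewrite ?mulr1// mulr0. Qed.

Lemma shifted_support x s : shifted p x s != 0 -> `|s - x| <= delta.
Proof.
move=> h; apply: mollifier_support; apply: contra_neq h => h.
by rewrite /shifted /restrict_half h mul0r.
Qed.

Lemma shifted_pos x s : shifted p x s != 0 -> 0 < s.
Proof.
rewrite /shifted /restrict_half indicE; case: (boolP (s \in _)); last by rewrite mulr0 eqxx.
by move=> /set_mem/=; rewrite in_itv/= andbT.
Qed.

Lemma shifted_bound B x s : (forall s, p s <= B) ->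
  `|shifted p x s| <= B * itv_ind (x - delta) (x + delta) s.
Proof.
move=> pB; have [->|h] := eqVneq (shifted p x s) 0.
  by rewrite normr0 mulr_ge0 ?itv_ind_ge0// (le_trans (p0 0)).
have := shifted_support h; rewrite ler_norml => /andP[a b].
rewrite itv_indE (_ : _ && _ = true) ?mulr1; last by apply/andP; split; lra.
by rewrite ger0_norm ?shifted_ge0// (le_trans (shifted_le _ _)).
Qed.

Lemma test_function_shifted x : test_function (shifted p x).
Proof.
have [_ _ _ _ [B pB]] := pm.
apply: (test_function_intro (measurable_shifted x)) (fun s => shifted_bound x s pB).
by rewrite (le_trans (p0 0)).
Qed.

Lemma integral_shift x : (\int[mu]_s (p (s - x))%:E = 1)%E.
Proof.
have [_ _ _ <- _] := pm.
apply: (@ge0_integral_translation _ (- x) (fun s => (p s)%:E)) => [|s]; last by rewrite lee_fin.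
exact/measurable_EFinP.
Qed.

Lemma integral_reflected t : (\int[mu]_y (p (t - y))%:E = 1)%E.
Proof.
have [_ _ _ <- _] := pm.
apply: (@ge0_integral_reflection _ t (fun s => (p s)%:E)) => [|s]; last by rewrite lee_fin.
exact/measurable_EFinP.
Qed.

Lemma integral_shifted_le1 x : (\int[mu]_s (shifted p x s)%:E <= 1)%E.
Proof.
rewrite -(integral_shift x); apply: ge0_le_integral => //.
- by move=> s _; rewrite lee_fin shifted_ge0.
- by apply/measurable_EFinP; exact: measurable_shifted.
- by apply/measurable_EFinP; exact: measurable_shift.
- by move=> s _; rewrite lee_fin shifted_le.
Qed.

(** For [delta < x] the support of the shifted density lies in the positive half-line, so the
    cut-off loses no mass. *)
Lemma integral_shifted x : delta < x -> (\int[mu]_s (shifted p x s)%:E = 1)%E.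
Proof.
move=> dx; rewrite -(integral_shift x); apply: eq_integral => s _; congr EFin.
rewrite /shifted /restrict_half indicE; case: (boolP (s \in _)) => [|s0]; rewrite ?mulr1// mulr0.
apply/esym/eqP/negPn/negP => /mollifier_support; rewrite ler_norml => /andP[a _].
by move/negP : s0; apply; apply/mem_set; rewrite /= in_itv/= andbT; lra.
Qed.

End Mollifier.

Section Plane.
Context {R : realType}.
Local Notation mu := (@lebesgue_measure R).
Local Notation rR := (measurableTypeR R).

(* A copy of the product measure: for two Lebesgue measures, instance inference does not find that it is sigma-finite. *)
Definition lebesgue_plane : set (rR * rR) -> \bar R := (mu \x mu)%E.
HB.instance Definition _ := Measure.on lebesgue_plane.

Let sigma_finite_plane : sigma_finite setT lebesgue_plane.
Proof.
have [F TF FF] := sigma_finiteT mu.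
have Fn n : measurable (F n) /\ (mu (F n) < +oo)%E by exact: FF.
have mU (n : nat) : measurable (\big[setU/set0]_(i < n) F i) /\ (mu (\big[setU/set0]_(i < n) F i) < +oo)%E.
  elim: n => [|n [mn fn]]; first by rewrite big_ord0 measure0; split.
  have [mF fF] := Fn n; rewrite big_ord_recr/=; split; first exact: measurableU.
  by apply: le_lt_trans; [exact: (@measureU2 _ _ _ mu)|exact: lte_add_pinfty].
(* The sets [F n] need not increase, so the squares of the [F n] alone could miss points of the
   plane; finite unions are squared instead. *)
exists (fun n => (\big[setU/set0]_(i < n) F i) `*` (\big[setU/set0]_(i < n) F i)).
  apply/esym/seteqP; split => // -[x y] _.
  have [n _ Fx] : (\bigcup_i F i) x by rewrite -TF.
  have [m _ Fy] : (\bigcup_i F i) y by rewrite -TF.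
  exists (maxn n m).+1 => //; split => /=; rewrite -bigcup_mkord.
    by exists n => //=; rewrite ltnS leq_maxl.
  by exists m => //=; rewrite ltnS leq_maxr.
move=> n; have [mn fn] := mU n; split; first exact: measurableX.
have -> : lebesgue_plane ((\big[setU/set0]_(i < n) F i) `*` (\big[setU/set0]_(i < n) F i)) =
   (mu (\big[setU/set0]_(i < n) F i) * mu (\big[setU/set0]_(i < n) F i))%E.
  exact: product_measure1E.
by apply: lte_mul_pinfty => //; rewrite ge0_fin_numE.
Qed.

HB.instance Definition _ := Measure_isSigmaFinite.Build _ _ _ lebesgue_plane sigma_finite_plane.

End Plane.

Section KernelLimit.
Context {R : realType}.
Local Notation mu := (@lebesgue_measure R).
Local Notation rR := (measurableTypeR R).

Lemma measurable_shifted2 (p : R -> R) : measurable_fun setT p ->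
  measurable_fun setT (fun z : rR * rR => shifted p z.1 z.2).
Proof.
move=> mp; apply: measurable_funM; first exact: measurable_difference.
apply: (@measurable_comp_snd _ (\1_(`]0, +oo[ : set R) : R -> R)).
by apply: measurable_indic; exact: measurable_itv.
Qed.

Definition weight (p q : R -> R) (x y : R) (w : rR * rR) : R := shifted p x w.1 * shifted q y w.2.

(** The average at the pair of centres is the integral of this function over the pair of integration
    points. In this form, measurability in the centres and exchanges of integrals follow from
    Tonelli's theorem. *)
Definition lifted (psi p q : R -> R) (zw : (rR * rR) * (rR * rR)) : R :=
  psi (zw.2.2 - zw.2.1) * weight p q zw.1.1 zw.1.2 zw.2.

Lemma measurable_lifted psi p q : measurable_fun setT psi -> measurable_fun setT p ->
  measurable_fun setT q -> measurable_fun setT (lifted psi p q).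
Proof.
move=> mpsi mp mq.
have h1 : measurable_fun setT (fun zw : (rR * rR) * (rR * rR) => zw.1.1) by exact: measurableT_comp.
have h2 : measurable_fun setT (fun zw : (rR * rR) * (rR * rR) => zw.1.2) by exact: measurableT_comp.
have h3 : measurable_fun setT (fun zw : (rR * rR) * (rR * rR) => zw.2.1) by exact: measurableT_comp.
have h4 : measurable_fun setT (fun zw : (rR * rR) * (rR * rR) => zw.2.2) by exact: measurableT_comp.
apply: measurable_funM.
  apply: (@measurableT_comp _ _ _ _ _ _ psi) => //; exact: measurable_funB.
apply: measurable_funM.
  apply: (@measurableT_comp _ _ _ _ _ _ (fun z : rR * rR => shifted p z.1 z.2) _ (fun zw : (rR * rR) * (rR * rR) => (zw.1.1, zw.2.1))).
    exact: measurable_shifted2.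
  exact: measurable_fun_pair.
apply: (@measurableT_comp _ _ _ _ _ _ (fun z : rR * rR => shifted q z.1 z.2) _ (fun zw : (rR * rR) * (rR * rR) => (zw.1.2, zw.2.2))).
  exact: measurable_shifted2.
exact: measurable_fun_pair.
Qed.

Definition mollified (rho p q : R -> R) (z : rR * rR) : R :=
  form rho (shifted p z.1) (shifted q z.2).

Lemma mollifiedE rho p q z : mollified rho p q z = \int[(mu \x mu)%E]_w lifted rho p q (z, w).
Proof. by apply: eq_Rintegral => w _; rewrite /form_kernel /lifted /weight/= mulrA. Qed.

Lemma measurable_mollified rho p q : measurable_fun setT rho -> measurable_fun setT p ->
  measurable_fun setT q -> measurable_fun setT (mollified rho p q).
Proof.
move=> mrho mp mq; have H := @measurable_Rintegral2 _ _ (rR * rR)%type (rR * rR)%type R (@lebesgue_plane R) _ (measurable_lifted mrho mp mq).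
have E : mollified rho p q = (fun z => \int[(mu \x mu)%E]_w lifted rho p q (z, w)).
  by apply/funext => z; exact: mollifiedE.
by rewrite E; exact: H.
Qed.

Section TwoMollifiers.
Variables (delta : R) (p q : R -> R).
Hypotheses (pm : mollifier delta p) (qm : mollifier delta q).

Let mp : measurable_fun setT p. Proof. by case: pm. Qed.
Let mq : measurable_fun setT q. Proof. by case: qm. Qed.

Lemma measurable_weight x y : measurable_fun setT (weight p q x y).
Proof.
by apply: measurable_funM; [apply: measurable_comp_fst (measurable_shifted pm x)|apply: measurable_comp_snd (measurable_shifted qm y)].
Qed.

Lemma weight_ge0 x y w : 0 <= weight p q x y w.
Proof. by rewrite mulr_ge0// (shifted_ge0 pm, shifted_ge0 qm). Qed.

Lemma integral_weight x y : (\int[mu \x mu]_w (weight p q x y w)%:E =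
  (\int[mu]_s (shifted p x s)%:E) * (\int[mu]_t (shifted q y t)%:E))%E.
Proof.
apply: integral_prod_mul.
- exact: measurable_shifted pm x.
- exact: measurable_shifted qm y.
  by move=> s; exact: shifted_ge0 pm _ _.
by move=> s; exact: shifted_ge0 qm _ _.
Qed.

Lemma integral_weight_le1 x y : (\int[mu \x mu]_w (weight p q x y w)%:E <= 1)%E.
Proof.
rewrite integral_weight -(mule1 1%E); apply: lee_pmul.
- by apply: integral_ge0 => s _; rewrite lee_fin (shifted_ge0 pm).
- by apply: integral_ge0 => s _; rewrite lee_fin (shifted_ge0 qm).
- exact: integral_shifted_le1 pm _.
- exact: integral_shifted_le1 qm _.
Qed.

Lemma integral_weight1 x y : delta < x -> delta < y ->
  (\int[mu \x mu]_w (weight p q x y w)%:E = 1)%E.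
Proof. by move=> dx dy; rewrite integral_weight (integral_shifted pm dx) (integral_shifted qm dy) mule1. Qed.

Lemma integrable_weight x y : (mu \x mu)%E.-integrable setT (EFin \o weight p q x y).
Proof.
apply/integrableP; split; first by apply/measurable_EFinP; exact: measurable_weight.
apply: (@le_lt_trans _ _ 1%E); last exact: ltry.
apply: le_trans (integral_weight_le1 x y).
rewrite le_eqVlt; apply/orP; left; apply/eqP; apply: eq_integral => w _ /=.
by rewrite ger0_norm// weight_ge0.
Qed.

Lemma Rintegral_weight_le1 x y : \int[(mu \x mu)%E]_w weight p q x y w <= 1.
Proof.
have h := integral_weight_le1 x y.
rewrite -lee_fin /Rintegral fineK//; exact: (integrable_fin_num measurableT (integrable_weight x y)).
Qed.

(** Averaging creates no mass: integrating over the centre [y] removes [q], the second integration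
    point then contributes the integral of [psi], the first one a mass at most 1, and [x] runs over
    an interval of length [N]. *)
Lemma integral_lifted (psi : R -> R) N : 0 <= N -> measurable_fun setT psi -> (forall u, 0 <= psi u) ->
  (\int[mu \x mu]_z ((itv_ind 0 N z.1)%:E * \int[mu \x mu]_w (lifted psi p q (z, w))%:E)
   <= N%:E * \int[mu]_u (psi u)%:E)%E.
Proof.
move=> N0 mpsi psi0.
have ml := measurable_lifted mpsi mp mq.
have l0 z : 0 <= lifted psi p q z by rewrite mulr_ge0// weight_ge0.
have mlE : measurable_fun setT (fun zw => (lifted psi p q zw)%:E) by exact/measurable_EFinP.
have l0E zw : (0 <= (lifted psi p q zw)%:E)%E by rewrite lee_fin.
have mF : measurable_fun setT (fun z : rR * rR => (\int[mu \x mu]_w (lifted psi p q (z, w))%:E)%E).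
  exact: (@measurable_fun_fubini_tonelli_F _ _ (rR * rR)%type (rR * rR)%type R (@lebesgue_plane R) _ mlE l0E).
have F0 z : (0 <= \int[mu \x mu]_w (lifted psi p q (z, w))%:E)%E by apply: integral_ge0 => w _; exact: l0E.
have mind : measurable_fun setT (fun z : rR * rR => (itv_ind 0 N z.1)%:E).
  by apply/measurable_EFinP; apply: measurable_comp_fst; exact: measurable_itv_ind.
rewrite fubini_tonelli1; last 2 first.
- exact: emeasurable_funM.
- by move=> z; rewrite mule_ge0// lee_fin itv_ind_ge0.
rewrite /fubini_F/=.
have mI : measurable_fun setT (fun u => (psi u)%:E) by exact/measurable_EFinP.
pose I := (\int[mu]_u (psi u)%:E)%E.
have I0 : (0 <= I)%E by apply: integral_ge0 => u _; rewrite lee_fin.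
have inner x : (\int[mu]_y \int[mu \x mu]_w (lifted psi p q ((x, y), w))%:E <= I)%E.
  pose g := fun yw : rR * (rR * rR) => (lifted psi p q ((x, yw.1), yw.2))%:E.
  have mg : measurable_fun setT g.
    have mi : measurable_fun setT (fun yw : rR * (rR * rR) => (((x : rR), yw.1), yw.2)).
      by apply: measurable_fun_pair => //; exact: measurable_fun_pair.
    exact: (measurableT_comp mlE mi).
  have g0 z : (0 <= g z)%E by exact: l0E.
  have -> : (\int[mu]_y \int[mu \x mu]_w (lifted psi p q ((x, y), w))%:E =
     \int[mu \x mu]_w \int[mu]_y (lifted psi p q ((x, y), w))%:E)%E.
    exact: (@fubini_tonelli _ _ rR (rR * rR)%type R mu (@lebesgue_plane R) g mg g0).
  have mP : measurable_fun setT (fun w : rR * rR => psi (w.2 - w.1) * shifted p x w.1).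
    apply: measurable_funM; first exact: measurable_difference.
    exact: measurable_comp_fst (measurable_shifted pm x).
  have P0 (w : rR * rR) : 0 <= psi (w.2 - w.1) * shifted p x w.1 by rewrite mulr_ge0// (shifted_ge0 pm).
  apply: (@le_trans _ _ (\int[mu \x mu]_w (psi (w.2 - w.1) * shifted p x w.1)%:E)%E).
    apply: ge0_le_integral => //.
    - by move=> w _; apply: integral_ge0 => y _; exact: l0E.
    - exact: (@measurable_fun_fubini_tonelli_G _ _ rR (rR * rR)%type R mu g mg g0).
    - exact/measurable_EFinP.
    move=> w _.
    have mq' : measurable_fun setT (fun y : R => q (w.2 - y)).
      by apply: (@measurableT_comp _ _ _ _ _ _ q) => //; exact: measurable_funB.
    have q0 s : 0 <= q s by case: qm.
    apply: (@le_trans _ _ (\int[mu]_y ((psi (w.2 - w.1) * shifted p x w.1)%:E * (q (w.2 - y))%:E))%E).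
      apply: ge0_le_integral => //.
      - exact: (measurableT_comp mg (pair2_measurable w)).
      - by apply: measurable_funeM; exact/measurable_EFinP.
      move=> y _; rewrite -EFinM lee_fin /lifted /weight/= mulrA.
      by apply: ler_wpM2l => //; exact: shifted_le qm _ _.
    rewrite ge0_integralZl//; last 3 first.
    - exact/measurable_EFinP.
    - by move=> y _; rewrite lee_fin.
    - by rewrite lee_fin.
    by rewrite (integral_reflected qm) mule1.
  rewrite fubini_tonelli1//; last exact/measurable_EFinP.
  rewrite /fubini_F/=.
  have H := @integral2_difference R (fun u => (psi u)%:E) (fun s => (shifted p x s)%:E) mI _ _ _.
  under eq_integral do under eq_integral do rewrite EFinM.
  rewrite H//; last 2 first.
  - by apply/measurable_EFinP; exact: measurable_shifted pm x.
  - by move=> s; rewrite lee_fin (shifted_ge0 pm).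
  rewrite -[leRHS]mule1; apply: lee_wpmul2l => //; exact: integral_shifted_le1 pm x.
have -> : (N%:E * I = \int[mu]_x ((itv_ind 0 N x)%:E * I))%E.
  rewrite ge0_integralZr//; last 2 first.
  - by apply/measurable_EFinP; exact: measurable_itv_ind.
  - by move=> x _; rewrite lee_fin itv_ind_ge0.
  congr (_ * _)%E; have e := integral_itv_ind N0; rewrite subr0 in e.
  rewrite -[RHS]fineK; first exact: (congr1 EFin (esym e)).
  exact: (integrable_fin_num measurableT (integrable_itv_ind 0 N)).
have mFm := emeasurable_funM mind mF.
apply: ge0_le_integral => //.
- by move=> x _; apply: integral_ge0 => y _; rewrite mule_ge0// lee_fin itv_ind_ge0.
- apply: (@measurable_fun_fubini_tonelli_F _ _ rR rR R mu (fun z : rR * rR => ((itv_ind 0 N z.1)%:E * \int[mu \x mu]_w (lifted psi p q (z, w))%:E)%E)) => //.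
  by move=> z; rewrite mule_ge0// lee_fin itv_ind_ge0.
- by apply: emeasurable_funM => //; apply/measurable_EFinP; exact: measurable_itv_ind.
move=> x _.
rewrite ge0_integralZl//; last 2 first.
- exact: (measurableT_comp mF (pair1_measurable (x : rR))).
- by rewrite lee_fin itv_ind_ge0.
by apply: lee_wpmul2l => //; rewrite lee_fin itv_ind_ge0.
Qed.

End TwoMollifiers.

End KernelLimit.

Section MollifiedBounds.
Context {R : realType}.
Local Notation mu := (@lebesgue_measure R).
Local Notation rR := (measurableTypeR R).
Variables (delta : R) (p q : R -> R).
Hypotheses (pm : mollifier delta p) (qm : mollifier delta q).

Lemma integrable_itv_continuous (c : R -> R) N : continuous c -> mu.-integrable `[- N, N] (EFin \o c).
Proof.
move=> cc; apply: continuous_compact_integrable; first exact: segment_compact.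
exact: continuous_subspaceT.
Qed.

(** The cut-off keeps both points positive, and they are at most [N + delta <= N + 1]; their
    difference therefore stays in a fixed window. *)
Lemma weight_window N x y w : 0 <= delta <= 1 -> 0 <= x <= N -> 0 <= y <= N -> weight p q x y w != 0 ->
  [/\ `|w.1 - x| <= delta, `|w.2 - y| <= delta & - (N + 1) <= w.2 - w.1 <= N + 1].
Proof.
move=> /andP[d0 d1] /andP[x0 xN] /andP[y0 yN]; rewrite /weight mulf_eq0 negb_or => /andP[hp hq].
have h1 := shifted_support pm hp; have h2 := shifted_support qm hq.
have p1 := shifted_pos hp; have p2 := shifted_pos hq.
split => //; move: h1 h2; rewrite !ler_norml => /andP[a b] /andP[e f].
by apply/andP; split; lra.
Qed.

(** The averages see [rho] only in the window of [weight_window], where it is the sum of [c] and the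
    truncated difference. *)
Lemma mollified_split (rho c : R -> R) N x y :
  measurable_fun setT rho -> (forall N, mu.-integrable `[- N, N] (EFin \o rho)) -> continuous c ->
  0 <= delta <= 1 -> 0 <= x <= N -> 0 <= y <= N ->
  mollified rho p q (x, y) = mollified c p q (x, y) +
    mollified (fun u => (rho u - c u) * itv_ind (- (N + 1)) (N + 1) u) p q (x, y).
Proof.
move=> mrho irho cc d1 xN yN.
set e := fun u => _.
have mc : measurable_fun setT c by exact: continuous_measurable_fun.
have me : measurable_fun setT e.
  by apply: measurable_funM; [exact: measurable_funB|exact: measurable_itv_ind].
have ie M : mu.-integrable `[- M, M] (EFin \o e).
  have mM : measurable (`[- M, M]%classic : set rR) by exact: measurable_itv.
  have iD : mu.-integrable `[- M, M] (EFin \o (fun u => rho u - c u)).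
    by have := integrableB mM (irho M) (integrable_itv_continuous M cc); exact: eq_integrable.
  apply: (le_integrable mM _ _ iD); first by apply/measurable_EFinP; exact: measurable_funTS.
  move=> u _; rewrite /= lee_fin /e normrM itv_indE.
  by case: (_ && _); rewrite ?normr1 ?mulr1// normr0 mulr0.
have tp := test_function_shifted pm x; have tq := test_function_shifted qm y.
rewrite /mollified /form -RintegralD//.
- apply: eq_Rintegral => w _; rewrite /form_kernel/=.
  have E a : a * shifted p x w.1 * shifted q y w.2 = a * weight p q x y w by rewrite /weight mulrA.
  rewrite !E -mulrDl.
  have [->|h] := eqVneq (weight p q x y w) 0; first by rewrite !mulr0.
  have [_ _ win] := weight_window d1 xN yN h.
  by congr (_ * _); rewrite /e itv_indE win mulr1 addrCA subrr addr0.
- by apply: integrable_form => // M; exact: integrable_itv_continuous.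
- exact: integrable_form.
Qed.

Lemma mollified_power (e : R -> R) k z : measurable_fun setT e -> (0 < k)%N ->
  ((`|mollified e p q z| ^+ k)%:E <= \int[mu \x mu]_w (lifted (fun u => `|e u| ^+ k)%R p q (z, w))%:E)%E.
Proof.
move=> me k0; rewrite mollifiedE.
apply: (@power_integral_weight _ _ _ (mu \x mu)%E (fun w : rR * rR => e (w.2 - w.1)) (weight p q z.1 z.2) k) => //.
- exact: measurable_difference.
- exact: measurable_weight pm qm _ _.
- exact: weight_ge0 pm qm _ _.
- exact: integral_weight_le1 pm qm _ _.
Qed.

(** If [x] and [y] exceed [delta], the weight has mass 1 and the average differs from [c (y - x)] by
    at most [omega]; the power is dropped because [omega <= 1]. On the two strips along the axes
    mass may be lost, and the trivial bound [2 * B] is used. *)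
Lemma mollified_continuous (c : R -> R) B r omega N x y k : (0 < k)%N -> continuous c -> 0 <= B ->
  (forall u, `|c u| <= B) -> 0 <= omega <= 1 ->
  (forall u v, - (N + 1) <= u <= N + 1 -> `|u - v| <= r -> `|c u - c v| <= omega) ->
  0 <= delta <= 1 -> delta + delta <= r -> 0 <= x <= N -> 0 <= y <= N ->
  `|mollified c p q (x, y) - c (y - x)| ^+ k <=
  omega + (2 * B) ^+ k * (itv_ind 0 delta x + itv_ind 0 delta y).
Proof.
move=> k0 cc B0 cB /andP[w0 w1] hc d1 dr xN yN.
have mc : measurable_fun setT c by exact: continuous_measurable_fun.
have iW := integrable_weight pm qm x y.
have W0 w := weight_ge0 pm qm x y w.
have W1 := Rintegral_weight_le1 pm qm x y.
have iF (F : rR * rR -> R) b : measurable_fun setT F -> 0 <= b -> (forall w, `|F w| <= b) ->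
    (mu \x mu)%E.-integrable setT (EFin \o (fun w => F w * weight p q x y w)).
  move=> mF b0 Fb.
  have iZ : (mu \x mu)%E.-integrable setT (EFin \o (fun w => b * weight p q x y w)).
    by have := integrableZl measurableT b iW; exact: eq_integrable.
  apply: le_integrable iZ => //.
    by apply/measurable_EFinP; apply: measurable_funM => //; exact: measurable_weight pm qm _ _.
  move=> w _; rewrite /= lee_fin !normrM (ger0_norm b0).
  by apply: ler_wpM2r.
have bF (F : rR * rR -> R) b : measurable_fun setT F -> 0 <= b -> (forall w, weight p q x y w != 0 -> `|F w| <= b) ->
    (mu \x mu)%E.-integrable setT (EFin \o (fun w => F w * weight p q x y w)) ->
    `|\int[(mu \x mu)%E]_w (F w * weight p q x y w)| <= b.
  move=> mF b0 Fb iFW.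
  apply: (le_trans (le_normr_Rintegral measurableT iFW)).
  have iZ : (mu \x mu)%E.-integrable setT (EFin \o (fun w => b * weight p q x y w)).
    by have := integrableZl measurableT b iW; exact: eq_integrable.
  apply: (@le_trans _ _ (\int[(mu \x mu)%E]_w (b * weight p q x y w))).
    apply: le_Rintegral => //; first exact: (integrable_norm iFW).
    move=> w _; rewrite normrM (ger0_norm (W0 w)).
    have [->|h] := eqVneq (weight p q x y w) 0; first by rewrite !mulr0.
    by apply: ler_wpM2r => //; exact: Fb.
  by rewrite RintegralZl// ler_piMr.
have md : measurable_fun setT (fun w : rR * rR => c (w.2 - w.1)) by exact: measurable_difference.
have KE : mollified c p q (x, y) = \int[(mu \x mu)%E]_w (c (w.2 - w.1) * weight p q x y w).
  by rewrite mollifiedE.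
have ic := iF _ B md B0 (fun w => cB _).
have KB : `|mollified c p q (x, y)| <= B by rewrite KE; apply: bF.
have crude : `|mollified c p q (x, y) - c (y - x)| ^+ k <= (2 * B) ^+ k.
  apply: lerXn2r; rewrite ?nnegrE ?mulr_ge0//.
  by apply: (le_trans (ler_normB _ _)); rewrite mulr2n mulrDl mul1r lerD.
have /andP[x0 _] := xN; have /andP[y0 _] := yN.
have B2 : 0 <= (2 * B) ^+ k by rewrite exprn_ge0// mulr_ge0.
rewrite !itv_indE x0 y0 /=.
have [xd|dx] := leP x delta.
  apply: (le_trans crude); rewrite mulrDr mulr1 addrCA lerDl.
  by apply: addr_ge0 => //; apply: mulr_ge0.
have [yd|dy] := leP y delta.
  by apply: (le_trans crude); rewrite add0r mulr1 lerDr.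
rewrite addr0 mulr0 addr0.
apply: (@le_trans _ _ (omega ^+ k)); last first.
  by rewrite -{2}(expr1 omega); apply: ler_wiXn2l.
apply: lerXn2r; rewrite ?nnegrE//.
have W1' : \int[(mu \x mu)%E]_w weight p q x y w = 1.
  by rewrite /Rintegral (integral_weight1 pm qm dx dy).
have -> : mollified c p q (x, y) - c (y - x) = \int[(mu \x mu)%E]_w ((c (w.2 - w.1) - c (y - x)) * weight p q x y w).
  rewrite KE -[X in _ - X]mulr1 -W1' -RintegralZl// -RintegralB//.
    by apply: eq_Rintegral => w _; rewrite mulrBl.
  by have := integrableZl measurableT (c (y - x)) iW; exact: eq_integrable.
apply: bF => //.
- by apply: measurable_funB.
- move=> w h; have [a b win] := weight_window d1 xN yN h.
  apply: hc => //; have -> : w.2 - w.1 - (y - x) = (w.2 - y) - (w.1 - x) by ring.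
  by apply: (le_trans (ler_normB _ _)); apply: le_trans dr; exact: lerD.
- apply: (iF _ (2 * B)); [exact: measurable_funB|exact: mulr_ge0|].
  by move=> w; apply: (le_trans (ler_normB _ _)); rewrite mulr2n mulrDl mul1r lerD.
Qed.

End MollifiedBounds.

Section MollifiedLimit.
Context {R : realType}.
Local Notation mu := (@lebesgue_measure R).
Local Notation rR := (measurableTypeR R).
Variables (rho : R -> R) (k : nat).
Hypothesis k_ge1 : (1 <= k)%N.
Hypothesis mrho : measurable_fun setT rho.
Hypothesis irho : forall N, mu.-integrable `[- N, N] (EFin \o rho).
Hypothesis ik : forall L, mu.-integrable setT (EFin \o (fun u => `|rho u| ^+ k * itv_ind (- L) L u)).
Variable N : R.
Hypothesis N0 : 0 <= N.
Local Notation L := (N + 1).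

Definition square_ind (z : rR * rR) : R := itv_ind 0 N z.1 * itv_ind 0 N z.2.

Lemma measurable_square_ind : measurable_fun setT square_ind.
Proof.
by apply: measurable_funM; [apply: measurable_comp_fst|apply: measurable_comp_snd]; exact: measurable_itv_ind.
Qed.

Lemma square_ind_ge0 z : 0 <= square_ind z.
Proof. by rewrite mulr_ge0 ?itv_ind_ge0. Qed.

Lemma integral_itv_indE (a : R) : 0 <= a -> (\int[mu]_x (itv_ind 0 a x)%:E = a%:E)%E.
Proof.
move=> a0; have e := integral_itv_ind a0; rewrite subr0 in e.
rewrite -[LHS]fineK; first exact: (congr1 EFin e).
exact: (integrable_fin_num measurableT (integrable_itv_ind 0 a)).
Qed.

Lemma integral_rect (a b : R) : 0 <= a -> 0 <= b ->
  (\int[mu \x mu]_z (itv_ind 0 a z.1 * itv_ind 0 b z.2)%:E = (a * b)%:E)%E.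
Proof.
move=> a0 b0; rewrite (integral_prod_mul (measurable_itv_ind 0 a) (measurable_itv_ind 0 b)).
- by rewrite !integral_itv_indE.
- by move=> x; exact: itv_ind_ge0.
- by move=> x; exact: itv_ind_ge0.
Qed.

Let four_terms (f1 f2 f3 f4 : rR * rR -> \bar R) (b1 b2 b3 b4 : \bar R) :
  measurable_fun setT f1 -> measurable_fun setT f2 -> measurable_fun setT f3 -> measurable_fun setT f4 ->
  (forall z, 0 <= f1 z)%E -> (forall z, 0 <= f2 z)%E -> (forall z, 0 <= f3 z)%E -> (forall z, 0 <= f4 z)%E ->
  (\int[mu \x mu]_z f1 z <= b1)%E -> (\int[mu \x mu]_z f2 z <= b2)%E ->
  (\int[mu \x mu]_z f3 z <= b3)%E -> (\int[mu \x mu]_z f4 z <= b4)%E ->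
  (\int[mu \x mu]_z (f1 z + (f2 z + (f3 z + f4 z))) <= b1 + (b2 + (b3 + b4)))%E.
Proof.
move=> m1 m2 m3 m4 p1 p2 p3 p4 h1 h2 h3 h4.
have m34 : measurable_fun setT (fun z => f3 z + f4 z)%E by exact: emeasurable_funD.
have m234 : measurable_fun setT (fun z => f2 z + (f3 z + f4 z))%E by exact: emeasurable_funD.
have p34 z : (0 <= f3 z + f4 z)%E by rewrite adde_ge0.
have p234 z : (0 <= f2 z + (f3 z + f4 z))%E by rewrite adde_ge0.
rewrite ge0_integralD// ge0_integralD// ge0_integralD//.
by apply: leeD => //; apply: leeD => //; apply: leeD.
Qed.

Let scaled_term (f : rR * rR -> \bar R) (a : R) (b c : \bar R) : measurable_fun setT f -> (forall z, 0 <= f z)%E ->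
  0 <= a -> (\int[mu \x mu]_z f z <= b)%E -> (a%:E * b <= c)%E -> (\int[mu \x mu]_z (a%:E * f z) <= c)%E.
Proof.
move=> mf f0 a0 fb bc; rewrite ge0_integralZl//.
by apply: le_trans bc; apply: lee_wpmul2l => //; rewrite lee_fin.
Qed.

(** With [rho = c + e] on the window, the error is the average of [e], plus the error for the
    continuous [c], minus [e]. Applying [normr_power_add] twice gives four terms: [f1] for the
    average of [e], through Jensen's inequality, [f2] for the modulus of continuity, [f3] for the
    strips along the axes, and [f4] for [e] itself. *)
Lemma mollified_limit (eta : R) : 0 < eta -> exists2 delta0, 0 < delta0 <= 1 &
  forall p q, mollifier delta0 p -> mollifier delta0 q ->
  (\int[mu \x mu]_z (square_ind z * `|mollified rho p q z - rho (z.2 - z.1)| ^+ k)%:E <= eta%:E)%E.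
Proof.
move=> eta0.
(* The factor 4 counts the terms [f1] to [f4], [4 ^+ k] comes from the two power splittings, and
   [(N + 1) ^+ 2] dominates the factors [N] and [N * N]. *)
pose C : R := 4 ^+ k * 4 * (N + 1) ^+ 2.
have N1 : 1 <= N + 1 by rewrite lerDr.
have N10 : 0 < N + 1 by exact: lt_le_trans N1.
have k40 : 0 < 4 ^+ k :> R by rewrite exprn_gt0.
have k20 : 0 < 2 ^+ k :> R by rewrite exprn_gt0.
have k24 : 2 ^+ k <= 4 ^+ k :> R by apply: lerXn2r; rewrite ?nnegrE ?ler_nat.
have C0 : 0 < C by rewrite /C !mulr_gt0// exprn_gt0.
pose eta1 := eta / C.
have eta10 : 0 < eta1 by rewrite divr_gt0.
have NC a : 0 <= a <= 4 ^+ k -> forall b, 0 <= b <= (N + 1) ^+ 2 -> a * b * eta1 <= eta / 4.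
  move=> /andP[a0 a1] b /andP[b0 b1].
  have -> : eta / 4 = (4 ^+ k * (N + 1) ^+ 2) * eta1.
    by rewrite /eta1 /C; field; rewrite !gt_eqF.
  by apply: ler_wpM2r; [exact: ltW|apply: ler_pM].
have NN : N <= (N + 1) ^+ 2.
  apply: (@le_trans _ _ (N + 1)); first by rewrite lerDl.
  by rewrite expr2 ler_peMl// ltW.
have NN2 : N * N <= (N + 1) ^+ 2.
  by rewrite expr2; apply: ler_pM => //; rewrite lerDl.
have [c [B [cc B0 cB hc]]] := approximation_continuous k_ge1 mrho (ik L) eta10.
pose omega := Num.min 1 eta1.
have w0 : 0 < omega by rewrite lt_min ltr01.
have w1 : omega <= 1 by rewrite ge_min lexx.
have we : omega <= eta1 by rewrite ge_min lexx orbT.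
have [r r0 hr] := @uniform_continuity_segment R c (- L) L omega cc w0.
pose B2 := (2 * B) ^+ k + 1.
have B20 : 0 < B2 by rewrite ltr_wpDl// exprn_ge0// mulr_ge0.
(* The three bounds serve, in turn, the window, the modulus of continuity at distance
   [delta0 + delta0], and the area of the strips. *)
pose delta0 := Num.min 1 (Num.min (r / 2) (eta1 / (2 * B2))).
have d0 : 0 < delta0 by rewrite !lt_min ltr01 !divr_gt0// mulr_gt0.
have d1 : delta0 <= 1 by rewrite ge_min lexx.
have dr : delta0 + delta0 <= r.
  have : delta0 <= r / 2 by rewrite !ge_min lexx /= orbT.
  by rewrite ler_pdivlMr// => h; apply: le_trans h; rewrite mulr2n mulrDr mulr1.
have de : 2 * B2 * delta0 <= eta1.
  have : delta0 <= eta1 / (2 * B2) by rewrite !ge_min lexx /= !orbT.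
  by rewrite ler_pdivlMr ?mulr_gt0// mulrC.
exists delta0; first by rewrite d0.
move=> p q pm qm.
have [mp p0 _ _ _] := pm; have [mq q0 _ _ _] := qm.
pose e u := (rho u - c u) * itv_ind (- L) L u.
have mc : measurable_fun setT c by exact: continuous_measurable_fun.
have me : measurable_fun setT e.
  by apply: measurable_funM; [exact: measurable_funB|exact: measurable_itv_ind].
pose ek u := `|e u| ^+ k.
have mek : measurable_fun setT ek by apply: measurable_funX; exact: measurableT_comp.
have ek0 u : 0 <= ek u by rewrite exprn_ge0.
have iek : (\int[mu]_u (ek u)%:E <= eta1%:E)%E.
  apply: le_trans hc; rewrite le_eqVlt; apply/orP; left; apply/eqP; apply: eq_integral => u _.
  rewrite /ek /e normrM itv_indE; case: (_ && _); rewrite ?normr1 ?mulr1// normr0 !mulr0 expr0n.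
  by rewrite gtn_eqF.
pose ml z := (\int[mu \x mu]_w (lifted ek p q (z, w))%:E)%E.
have l0 z : (0 <= (lifted ek p q z)%:E)%E by rewrite lee_fin mulr_ge0// (weight_ge0 pm qm).
have mml : measurable_fun setT ml.
  apply: (@measurable_fun_fubini_tonelli_F _ _ (rR * rR)%type (rR * rR)%type R (@lebesgue_plane R) (fun zw => (lifted ek p q zw)%:E)) => //.
  by apply/measurable_EFinP; exact: measurable_lifted.
have ml0 z : (0 <= ml z)%E by apply: integral_ge0 => w _; exact: l0.
pose f1 z := ((2 ^+ k)%:E * ((itv_ind 0 N z.1)%:E * ml z))%E.
pose f2 z := ((4 ^+ k * omega)%:E * (itv_ind 0 N z.1 * itv_ind 0 N z.2)%:E)%E.
pose f3 z := ((4 ^+ k * B2)%:E * ((itv_ind 0 delta0 z.1 * itv_ind 0 N z.2)%:E + (itv_ind 0 N z.1 * itv_ind 0 delta0 z.2)%:E))%E.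
pose f4 z := ((4 ^+ k)%:E * (ek (z.2 - z.1) * itv_ind 0 N z.1)%:E)%E.
have mi1 a : measurable_fun setT (fun z : rR * rR => itv_ind 0 a z.1).
  by apply: measurable_comp_fst; exact: measurable_itv_ind.
have mi2 a : measurable_fun setT (fun z : rR * rR => itv_ind 0 a z.2).
  by apply: measurable_comp_snd; exact: measurable_itv_ind.
have i0 := @itv_ind_ge0 R.
have mrect a b : measurable_fun setT (fun z : rR * rR => (itv_ind 0 a z.1 * itv_ind 0 b z.2)%:E).
  by apply/measurable_EFinP; exact: measurable_funM.
have mek2 : measurable_fun setT (fun z : rR * rR => (ek (z.2 - z.1) * itv_ind 0 N z.1)%:E).
  by apply/measurable_EFinP; apply: measurable_funM => //; exact: measurable_difference.
have mf1 : measurable_fun setT (fun z : rR * rR => (itv_ind 0 N z.1)%:E * ml z)%E.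
  by apply: emeasurable_funM => //; exact/measurable_EFinP.
have g10 z : (0 <= (itv_ind 0 N z.1)%:E * ml z)%E by rewrite mule_ge0// lee_fin i0.
have g20 a b (z : rR * rR) : (0 <= (itv_ind 0 a z.1 * itv_ind 0 b z.2)%:E)%E by rewrite lee_fin mulr_ge0.
have g40 (z : rR * rR) : (0 <= (ek (z.2 - z.1) * itv_ind 0 N z.1)%:E)%E by rewrite lee_fin mulr_ge0.
have -> : eta = eta / 4 + (eta / 4 + (eta / 4 + eta / 4)) by field.
apply: (@le_trans _ _ (\int[mu \x mu]_z (f1 z + (f2 z + (f3 z + f4 z))))%E); last first.
  rewrite !EFinD; apply: four_terms.
  - exact: measurable_funeM.
  - exact: measurable_funeM.
  - by apply: measurable_funeM; exact: emeasurable_funD.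
  - exact: measurable_funeM.
  - by move=> z; rewrite mule_ge0// lee_fin ltW.
  - by move=> z; rewrite mule_ge0// lee_fin mulr_ge0// ltW.
  - by move=> z; rewrite mule_ge0 ?adde_ge0// lee_fin mulr_ge0// ltW.
  - by move=> z; rewrite mule_ge0// lee_fin ltW.
  - apply: (@scaled_term _ _ (N%:E * eta1%:E)%E); [exact: mf1|exact: g10|exact: ltW| |].
      apply: (le_trans (integral_lifted pm qm N0 mek ek0)).
      by apply: lee_wpmul2l => //; rewrite lee_fin.
    by rewrite -!EFinM lee_fin mulrA; apply: NC; rewrite ?k24 ?N0 ?NN ?ltW.
  - apply: (@scaled_term _ _ (N * N)%:E); [exact: mrect|exact: g20|by rewrite mulr_ge0// ltW| |].
      by rewrite integral_rect.
    rewrite -!EFinM lee_fin mulrAC; apply: (@le_trans _ _ (4 ^+ k * (N * N) * eta1)).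
      by apply: ler_wpM2l => //; rewrite mulr_ge0 ?mulr_ge0// ltW.
    by apply: NC; rewrite ?lexx ?NN2 ?mulr_ge0// ltW.
  - apply: (@scaled_term _ _ (delta0 * N + N * delta0)%:E).
    + exact: emeasurable_funD.
    + by move=> z; rewrite adde_ge0.
    + by rewrite mulr_ge0// ltW.
    + rewrite ge0_integralD// !integral_rect ?EFinD//; exact: ltW.
    rewrite -!EFinM lee_fin.
    have -> : 4 ^+ k * B2 * (delta0 * N + N * delta0) = 4 ^+ k * N * (2 * B2 * delta0) by ring.
    apply: (@le_trans _ _ (4 ^+ k * N * eta1)).
      by apply: ler_wpM2l => //; rewrite mulr_ge0// ltW.
    by apply: NC; rewrite ?lexx ?NN ?N0// ltW.
  - apply: (@scaled_term _ _ (eta1%:E * N%:E)%E); [exact: mek2|exact: g40|exact: ltW| |].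
      rewrite fubini_tonelli1// /fubini_F/=.
      under eq_integral do under eq_integral do rewrite EFinM.
      rewrite (@integral2_difference R (fun u => (ek u)%:E) (fun s => (itv_ind 0 N s)%:E)).
      + rewrite integral_itv_indE//; apply: lee_wpmul2r; last exact: iek.
        by rewrite lee_fin.
      + exact/measurable_EFinP.
      + by move=> u; rewrite lee_fin.
      + by apply/measurable_EFinP; exact: measurable_itv_ind.
      + by move=> u; rewrite lee_fin.
    rewrite -!EFinM lee_fin.
    have -> : 4 ^+ k * (eta1 * N) = 4 ^+ k * N * eta1 by ring.
    by apply: NC; rewrite ?lexx ?NN ?N0// ltW.
have mK : measurable_fun setT (mollified rho p q) by exact: measurable_mollified.
apply: ge0_le_integral => //.
- by move=> z _; rewrite lee_fin mulr_ge0 ?square_ind_ge0 ?exprn_ge0.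
- apply/measurable_EFinP; apply: measurable_funM; first exact: measurable_square_ind.
  apply: measurable_funX; apply: measurableT_comp => //; apply: measurable_funB => //.
  exact: measurable_difference.
- apply: emeasurable_funD; first exact: measurable_funeM.
  apply: emeasurable_funD; first exact: measurable_funeM.
  apply: emeasurable_funD; last exact: measurable_funeM.
  by apply: measurable_funeM; exact: emeasurable_funD.
have pos z : (0 <= f1 z + (f2 z + (f3 z + f4 z)))%E.
  rewrite !adde_ge0//.
  - by rewrite mule_ge0// lee_fin ltW.
  - by rewrite mule_ge0// lee_fin mulr_ge0// ltW.
  - by rewrite mule_ge0 ?adde_ge0// lee_fin mulr_ge0// ltW.
  - by rewrite mule_ge0// lee_fin ltW.
move=> [x y] _; have [xN|xN] := boolP (0 <= x <= N); last first.
  by apply: le_trans (pos (x, y)); rewrite /square_ind (itv_indE 0 N x) (negbTE xN) !mul0r.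
have [yN|yN] := boolP (0 <= y <= N); last first.
  by apply: le_trans (pos (x, y)); rewrite /square_ind (itv_indE 0 N y) (negbTE yN) mulr0 mul0r.
have ix : itv_ind 0 N x = 1 by rewrite itv_indE xN.
have iy : itv_ind 0 N y = 1 by rewrite itv_indE yN.
have d01 : 0 <= delta0 <= 1 by rewrite d1 ltW.
have tailE : (f2 (x, y) + (f3 (x, y) + f4 (x, y)))%E = (4 ^+ k * omega * (1 * 1) +
    (4 ^+ k * B2 * (itv_ind 0 delta0 x * 1 + 1 * itv_ind 0 delta0 y) + 4 ^+ k * (ek (y - x) * 1)))%:E.
  by rewrite /f2 /f3 /f4/= ix iy.
rewrite tailE /f1 /square_ind/= ix iy !mulr1 !mul1r mul1e.
pose Ke := mollified e p q (x, y).
have split : mollified rho p q (x, y) = mollified c p q (x, y) + Ke.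
  exact: (mollified_split pm qm mrho irho cc d01 xN yN).
have win : - L <= y - x <= L.
  have /andP[x0 xN'] := xN; have /andP[y0 yN'] := yN; rewrite lerNl opprB.
  apply/andP; split; first by rewrite (le_trans _ (ltW (ltr_pwDr ltr01 xN')))// lerBlDr lerDl.
  by rewrite (le_trans _ (ltW (ltr_pwDr ltr01 yN')))// lerBlDr lerDl.
have eE : e (y - x) = rho (y - x) - c (y - x) by rewrite /e itv_indE win mulr1.
have E : mollified rho p q (x, y) - rho (y - x) = Ke + ((mollified c p q (x, y) - c (y - x)) - e (y - x)).
  by rewrite split eE; ring.
have h1 := normr_power_add Ke ((mollified c p q (x, y) - c (y - x)) - e (y - x)) k.
have h2 := normr_power_add (mollified c p q (x, y) - c (y - x)) (- e (y - x)) k.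
rewrite normrN in h2.
have w01 : 0 <= omega <= 1 by rewrite w1 ltW.
have h3 := mollified_continuous pm qm k_ge1 cc B0 cB w01 hr d01 dr xN yN.
have h4 := mollified_power pm qm (x, y) me k_ge1.
have k4 : 4 ^+ k = 2 ^+ k * 2 ^+ k :> R by rewrite -exprMn -natrM.
have real_bound : `|mollified rho p q (x, y) - rho (y - x)| ^+ k <=
   2 ^+ k * `|Ke| ^+ k + (4 ^+ k * omega + (4 ^+ k * B2 * (itv_ind 0 delta0 x + itv_ind 0 delta0 y) + 4 ^+ k * ek (y - x))).
  rewrite E; apply: (le_trans h1); rewrite mulrDr lerD2l.
  apply: (@le_trans _ _ (2 ^+ k * (2 ^+ k * (`|mollified c p q (x, y) - c (y - x)| ^+ k + `|e (y - x)| ^+ k)))).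
    by apply: ler_wpM2l => //; exact: ltW.
  rewrite mulrA -k4 mulrDr !addrA lerD2r -mulrA -mulrDr.
  apply: ler_wpM2l; first exact: ltW.
  apply: (le_trans h3); rewrite lerD2l.
  by apply: ler_wpM2r; [rewrite addr_ge0|rewrite /B2 lerDl].
apply: (@le_trans _ _ ((2 ^+ k * `|Ke| ^+ k)%:E + (4 ^+ k * omega + (4 ^+ k * B2 * (itv_ind 0 delta0 x + itv_ind 0 delta0 y) + 4 ^+ k * ek (y - x)))%:E)%E).
  by rewrite -EFinD lee_fin.
apply: leeD => //.
by rewrite EFinM; apply: lee_wpmul2l; [rewrite lee_fin ltW|exact: h4].
Qed.

End MollifiedLimit.

Section PowerLimit.
Context {R : realType}.
Local Notation mu := (@lebesgue_measure R).
Local Notation rR := (measurableTypeR R).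
Variables (rho : R -> R) (k : nat).
Hypothesis k_ge1 : (1 <= k)%N.
Hypothesis mrho : measurable_fun setT rho.
Hypothesis irho : forall N, mu.-integrable `[- N, N] (EFin \o rho).
Hypothesis ik : forall L, mu.-integrable setT (EFin \o (fun u => `|rho u| ^+ k * itv_ind (- L) L u)).
Variables (g : R -> R) (M N : R).
Hypothesis N0 : 0 <= N.
Hypothesis M0 : 0 <= M.
Hypothesis mg : measurable_fun setT g.
Hypothesis gM : forall x, `|g x| <= M * itv_ind 0 N x.

Definition tested_power (K : rR * rR -> R) : R :=
  \int[(mu \x mu)%E]_z (g z.1 * g z.2 * K z ^+ k).

Let Pz (z : rR * rR) : R := square_ind N z * `|rho (z.2 - z.1)| ^+ k.

Let iP : (mu \x mu)%E.-integrable setT (EFin \o Pz).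
Proof.
have id := integrable_difference (ik N) (integrable_itv_ind 0 N).
apply: le_integrable id => //.
  apply/measurable_EFinP; apply: measurable_funM; first exact: measurable_square_ind.
  by apply: measurable_funX; apply: measurableT_comp => //; exact: measurable_difference.
move=> [x y] _; rewrite /= lee_fin /Pz /square_ind/= !normrM !normrX !normr_id.
rewrite !(ger0_norm (itv_ind_ge0 _ _ _)) !itv_indE.
case: (boolP (0 <= x <= N)) => [/andP[x0 xN]|_]; last by rewrite !mul0r !mulr0.
case: (boolP (0 <= y <= N)) => [/andP[y0 yN]|_]; last first.
  by rewrite mulr0 mul0r !mulr_ge0 ?exprn_ge0.
rewrite (_ : _ <= y - x <= _) ?mulr1 ?mul1r//; apply/andP; split.
  by rewrite lerNl opprB (le_trans _ xN)// lerBlDr lerDl.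
by rewrite (le_trans _ yN)// lerBlDr lerDl.
Qed.

Let gg_bound z : `|g z.1 * g z.2| <= M ^+ 2 * square_ind N z.
Proof.
rewrite normrM /square_ind expr2 mulrACA; apply: ler_pM => //.
Qed.

Let mgg : measurable_fun setT (fun z : rR * rR => g z.1 * g z.2).
Proof. by apply: measurable_funM; [exact: measurable_comp_fst|exact: measurable_comp_snd]. Qed.

Lemma integrable_tested_rho :
  (mu \x mu)%E.-integrable setT (EFin \o (fun z : rR * rR => g z.1 * g z.2 * rho (z.2 - z.1) ^+ k)).
Proof.
have iP' : (mu \x mu)%E.-integrable setT (EFin \o (fun z => M ^+ 2 * Pz z)).
  by have := integrableZl measurableT (M ^+ 2) iP; exact: eq_integrable.
apply: le_integrable iP' => //.
  apply/measurable_EFinP; apply: measurable_funM => //.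
  by apply: measurable_funX; exact: measurable_difference.
move=> z _; rewrite /= lee_fin normrM normrX /Pz mulrA [leRHS]ger0_norm; last first.
  by rewrite mulr_ge0 ?exprn_ge0// mulr_ge0 ?sqr_ge0// square_ind_ge0.
by apply: ler_wpM2r => //; exact: exprn_ge0.
Qed.

(** [power_difference_bound] compares the powers of the average and of [rho]. The part with [theta]
    is controlled by the fixed integral [A], the part with [C] by [mollified_limit], each giving
    half of [eps]; hence [theta] is chosen first, then [C], then [eta]. *)
Lemma tested_power_limit (eps : R) : 0 < eps -> exists2 delta0, 0 < delta0 <= 1 &
  forall p q, mollifier delta0 p -> mollifier delta0 q ->
  (mu \x mu)%E.-integrable setT (EFin \o (fun z : rR * rR => g z.1 * g z.2 * mollified rho p q z ^+ k)) /\
  `|tested_power (mollified rho p q) - tested_power (fun z => rho (z.2 - z.1))| <= eps.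
Proof.
move=> eps0; pose A := \int[(mu \x mu)%E]_z Pz z.
have A0 : 0 <= A by apply: Rintegral_ge0 => z _; rewrite mulr_ge0 ?exprn_ge0 ?square_ind_ge0.
have M20 : 0 <= M ^+ 2 by exact: sqr_ge0.
pose theta := eps / (2 * (M ^+ 2 * A + 1)).
have D0 : 0 < 2 * (M ^+ 2 * A + 1) by rewrite mulr_gt0// ltr_wpDl// mulr_ge0.
have theta0 : 0 < theta by rewrite divr_gt0.
have [C C0 hC] := @power_difference_bound R k theta theta0.
pose eta := eps / (2 * (M ^+ 2 * C + 1)).
have D'0 : 0 < 2 * (M ^+ 2 * C + 1) by rewrite mulr_gt0// ltr_wpDl// mulr_ge0.
have eta0 : 0 < eta by rewrite divr_gt0.
have [delta0 d01 hd] := mollified_limit k_ge1 mrho irho ik N0 eta0.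
exists delta0 => // p q pm qm.
have [mp _ _ _ _] := pm; have [mq _ _ _ _] := qm.
have mK : measurable_fun setT (mollified rho p q) by exact: measurable_mollified.
pose Hz z := square_ind N z * `|mollified rho p q z - rho (z.2 - z.1)| ^+ k.
have md : measurable_fun setT (fun z : rR * rR => rho (z.2 - z.1)) by exact: measurable_difference.
have mH : measurable_fun setT Hz.
  apply: measurable_funM; first exact: measurable_square_ind.
  by apply: measurable_funX; apply: measurableT_comp => //; exact: measurable_funB.
have H0 z : 0 <= Hz z by rewrite mulr_ge0 ?exprn_ge0 ?square_ind_ge0.
have Hle := hd _ _ pm qm.
have iH : (mu \x mu)%E.-integrable setT (EFin \o Hz).
  apply/integrableP; split; first exact/measurable_EFinP.
  apply: le_lt_trans (ltry eta); apply: le_trans Hle.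
  rewrite le_eqVlt; apply/orP; left; apply/eqP; apply: eq_integral => z _ /=.
  by rewrite ger0_norm.
have Heta : \int[(mu \x mu)%E]_z Hz z <= eta.
  by rewrite -lee_fin /Rintegral fineK//; exact: (integrable_fin_num measurableT iH).
have iB : (mu \x mu)%E.-integrable setT (EFin \o (fun z => M ^+ 2 * (theta * Pz z + C * Hz z))).
  have h := integrableD measurableT (integrableZl measurableT theta iP) (integrableZl measurableT C iH).
  have := integrableZl measurableT (M ^+ 2) h; exact: eq_integrable.
have bound z : `|g z.1 * g z.2 * mollified rho p q z ^+ k - g z.1 * g z.2 * rho (z.2 - z.1) ^+ k| <=
    M ^+ 2 * (theta * Pz z + C * Hz z).
  rewrite -mulrBr normrM.
  apply: (@le_trans _ _ (M ^+ 2 * square_ind N z * (theta * `|rho (z.2 - z.1)| ^+ k + C * `|mollified rho p q z - rho (z.2 - z.1)| ^+ k))).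
    by apply: ler_pM => //; exact: gg_bound.
  by rewrite /Pz /Hz le_eqVlt; apply/orP; left; apply/eqP; ring.
have iD : (mu \x mu)%E.-integrable setT (EFin \o (fun z : rR * rR =>
    g z.1 * g z.2 * mollified rho p q z ^+ k - g z.1 * g z.2 * rho (z.2 - z.1) ^+ k)).
  apply: le_integrable iB => //.
    by apply/measurable_EFinP; apply: measurable_funB; apply: measurable_funM => //; exact: measurable_funX.
  by move=> z _; rewrite /= lee_fin; apply: (le_trans (bound z)); exact: ler_norm.
have ir := integrable_tested_rho.
have iK : (mu \x mu)%E.-integrable setT (EFin \o (fun z : rR * rR => g z.1 * g z.2 * mollified rho p q z ^+ k)).
  have := integrableD measurableT iD ir; apply: eq_integrable => // z _ /=.
  by rewrite -EFinD subrK.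
split => //; rewrite /tested_power -RintegralB//.
apply: (le_trans (le_normr_Rintegral measurableT iD)).
apply: (@le_trans _ _ (\int[(mu \x mu)%E]_z (M ^+ 2 * (theta * Pz z + C * Hz z)))).
  by apply: le_Rintegral => //; exact: (integrable_norm iD).
have i1 : (mu \x mu)%E.-integrable setT (EFin \o (fun z => theta * Pz z)).
  by have := integrableZl measurableT theta iP; exact: eq_integrable.
have i2 : (mu \x mu)%E.-integrable setT (EFin \o (fun z => C * Hz z)).
  by have := integrableZl measurableT C iH; exact: eq_integrable.
rewrite RintegralZl//; last first.
  by have := integrableD measurableT i1 i2; exact: eq_integrable.
rewrite RintegralD// !RintegralZl// -/A.
apply: (@le_trans _ _ (M ^+ 2 * (theta * A + C * eta))).
  by apply: ler_wpM2l => //; rewrite lerD2l; exact: ler_wpM2l.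
have -> : M ^+ 2 * (theta * A + C * eta) = (M ^+ 2 * A) * theta + (M ^+ 2 * C) * eta by ring.
rewrite [eps]splitr; apply: lerD.
  rewrite /theta mulrA ler_pdivrMr//.
  have -> : eps / 2 * (2 * (M ^+ 2 * A + 1)) = (M ^+ 2 * A + 1) * eps by field.
  by apply: ler_wpM2r; [exact: ltW|rewrite lerDl].
rewrite /eta mulrA ler_pdivrMr//.
have -> : eps / 2 * (2 * (M ^+ 2 * C + 1)) = (M ^+ 2 * C + 1) * eps by field.
by apply: ler_wpM2r; [exact: ltW|rewrite lerDl].
Qed.

End PowerLimit.

(** The combination is [f * (a - 2 * b + c)], in which the common limit [j] cancels. It is the
    squared distance of two Wick integrals when [f] is the factorial and [a], [b], [c] are the
    tested powers of their covariance kernels. *)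
Lemma second_difference_bound {R : realType} (f a b c j t : R) : 0 <= f ->
  `|a - j| <= t -> `|b - j| <= t -> `|c - j| <= t -> f * a - f * b - (f * b - f * c) <= f * (4 * t).
Proof.
rewrite !ler_norml => f0 /andP[a1 a2] /andP[b1 b2] /andP[c1 c2].
by rewrite -!mulrBr; apply: ler_wpM2l => //; lra.
Qed.

(** * Integrals of Wick powers *)

Section WickIntegral.
Context {d : measure_display} {T : measurableType d} {R : realType}.
Variable P : probability T R.
Local Notation L2 := (Lfun P 2%:E).
Local Notation mu := (@lebesgue_measure R).
Local Notation rR := (measurableTypeR R).
Variables (G : R -> T -> R) (rho : R -> R) (k : nat).
Hypothesis k_ge1 : (1 <= k)%N.
Local Notation D := (deriv_elementary G).
Hypothesis mrho : measurable_fun setT rho.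
Hypothesis irho : forall N, mu.-integrable `[- N, N] (EFin \o rho).
Hypothesis ik : forall L, mu.-integrable setT (EFin \o (fun u => `|rho u| ^+ k * itv_ind (- L) L u)).
Hypothesis gD : forall u : elementary, elementary_on_halfline u -> gauss_moments P (D u).
Hypothesis covD : forall u v : elementary, elementary_on_halfline u -> elementary_on_halfline v ->
  ip P (D u) (D v) = form rho (elementary_fun u) (elementary_fun v).
Variables (g gb : R -> R) (M N : R).
Hypothesis N0 : 0 <= N.
Hypothesis M0 : 0 <= M.
Hypothesis mgb : measurable_fun setT gb.
Hypothesis gM : forall x, `|gb x| <= M * itv_ind 0 N x.
Hypothesis g_gb : forall F : R -> R, measurable_fun (@halfline R) F ->
  lebesgue_int halfline (fun x => F x * g x) = \int[mu]_(x in halfline) (F x * gb x).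

(** The common form of the two approximations: versions of G'(p(. - x)) for a density [p]
    concentrated in [[-delta, delta]]. The last clause supplies the elementary approximations from
    which covariances are computed, whatever the version. *)
Definition smoothing (delta : R) (p : R -> R) (Y : R -> T -> R) : Prop :=
  [/\ mollifier delta p,
      measurable_fun (halfline `*` [set: T]) (fun z : R * T => Y z.1 z.2),
      forall x, 0 <= x -> is_gen_deriv P G rho (fun s => p (s - x)) (Y x) &
      forall x, 0 <= x -> exists u, step_approx (shifted p x) u].

Lemma mollifier_le (delta delta' : R) (p : R -> R) : delta <= delta' -> mollifier delta p -> mollifier delta' p.
Proof.
move=> dd [mp p0 ps p1 pB]; split => // s ds; apply: ps; exact: le_lt_trans ds.
Qed.

Lemma smoothing_le delta delta' p Y : delta <= delta' -> smoothing delta p Y -> smoothing delta' p Y.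
Proof. by move=> dd [pm mY gY sY]; split => //; exact: mollifier_le pm. Qed.

Definition wick_integral (Y : R -> T -> R) (w : T) : R :=
  lebesgue_int halfline (fun x => wick_power P k (Y x) w * g x).

Let gb_neg x : ~ (0 <= x) -> gb x = 0.
Proof.
move=> x0; apply/eqP; rewrite -normr_le0; apply: (le_trans (gM x)).
by rewrite itv_indE; move/negP/negbTE : x0 => ->; rewrite mulr0.
Qed.

Definition wick_kernel (Y : R -> T -> R) (x : R) (w : T) : R := gb x * wick_power P k (Y x) w.

(** [Y] is measurable over the half-line only; the values put elsewhere are harmless because [gb]
    vanishes there. *)
Let Yh (Y : R -> T -> R) : R * T -> R := ((fun z : R * T => Y z.1 z.2) \_ (halfline `*` [set: T]))%function.

Let mhalf : measurable ((halfline `*` [set: T]) : set (rR * T)).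
Proof. by apply: measurableX => //; exact: measurable_halfline. Qed.

Let YhE Y x w : 0 <= x -> Yh Y (x, w) = Y x w.
Proof.
move=> x0; rewrite /Yh patchE mem_set//=; split => //.
by rewrite /halfline /= in_itv/= x0.
Qed.

Let wick_powerE (X : T -> R) w : wick_power P k X w = \sum_(j < k./2.+1)
    (-1) ^+ j * 'C(k, j.*2)%:R * (\int[P]_v (X v ^+ j.*2)) * X w ^+ (k - j.*2).
Proof. by apply: eq_bigr => j _; rewrite unlock. Qed.

Lemma measurable_wick_kernel Y :
  measurable_fun (halfline `*` [set: T]) (fun z : R * T => Y z.1 z.2) ->
  measurable_fun setT (fun z : rR * T => wick_kernel Y z.1 z.2).
Proof.
move=> mY.
have mYh : measurable_fun setT (Yh Y : rR * T -> R) by exact/(measurable_restrictT _ mhalf).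
have -> : (fun z : rR * T => wick_kernel Y z.1 z.2) = (fun z : rR * T =>
    gb z.1 * \sum_(j < k./2.+1) (-1) ^+ j * 'C(k, j.*2)%:R * (\int[P]_v (Yh Y (z.1, v) ^+ j.*2)) * Yh Y z ^+ (k - j.*2)).
  apply/funext => -[x w]; rewrite /wick_kernel/=.
  have [x0|x0] := pselect (0 <= x); last by rewrite gb_neg// !mul0r.
  congr (_ * _); rewrite wick_powerE; apply: eq_bigr => j _; rewrite YhE//.
  congr (_ * _ * _); apply: eq_Rintegral => v _; by rewrite YhE.
apply: measurable_funM.
  by apply: (@measurableT_comp _ _ _ _ _ _ gb) => //; exact: measurable_fst.
apply: measurable_sum => j; apply: measurable_funM; last exact: measurable_funX.
apply: measurable_funM => //.
apply: (@measurableT_comp _ _ _ _ _ _ (fun x : rR => \int[P]_v (Yh Y (x, v) ^+ j.*2))); last exact: measurable_fst.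
apply: (@measurable_Rintegral2 _ _ rR T R P (fun z => Yh Y z ^+ j.*2)).
exact: measurable_funX.
Qed.

Lemma wick_integralE Y w :
  measurable_fun (halfline `*` [set: T]) (fun z : R * T => Y z.1 z.2) ->
  wick_integral Y w = mixture (wick_kernel Y) w.
Proof.
move=> mY; rewrite /wick_integral g_gb; last first.
  have mYh : measurable_fun setT (Yh Y : rR * T -> R) by exact/(measurable_restrictT _ mhalf).
  pose F (x : rR) := \sum_(j < k./2.+1) (-1) ^+ j * 'C(k, j.*2)%:R * (\int[P]_v (Yh Y (x, v) ^+ j.*2)) * Yh Y (x, w) ^+ (k - j.*2).
  have mF : measurable_fun setT F.
    apply: measurable_sum => j; apply: measurable_funM; last first.
      by apply: measurable_funX; exact: (measurableT_comp mYh (pair2_measurable w)).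
    apply: measurable_funM => //.
    apply: (@measurable_Rintegral2 _ _ rR T R P (fun z => Yh Y z ^+ j.*2)).
    exact: measurable_funX.
  apply: (@eq_measurable_fun _ _ _ _ _ F); last exact: measurable_funTS.
  move=> x /set_mem; rewrite /halfline/= in_itv/= andbT => x0.
  rewrite /F wick_powerE; apply: eq_bigr => j _; rewrite YhE//.
  by congr (_ * _ * _); apply: eq_Rintegral => v _; rewrite YhE.
rewrite /mixture /Rintegral; congr fine; rewrite integral_mkcond; apply: eq_integral => x _.
rewrite patchE /wick_kernel; case: (boolP (x \in _)) => [_|xh]; first by rewrite mulrC.
rewrite gb_neg ?mul0r// => x0; move/negP : xh; apply; apply/mem_set.
by rewrite /halfline/= in_itv/= x0.
Qed.

Lemma smoothing_ip p q Y Y' delta delta' x y : smoothing delta p Y -> smoothing delta' q Y' ->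
  0 <= x -> 0 <= y -> wick_power P k (Y x) \in L2 /\
  ip P (wick_power P k (Y x)) (wick_power P k (Y' y)) = k`!%:R * mollified rho p q (x, y) ^+ k.
Proof.
move=> [pm _ gY sY] [qm _ gY' sY'] x0 y0.
have [u su] := sY x x0; have [u' su'] := sY' y y0.
have mp := measurable_shift pm x; have mq := measurable_shift qm y.
have gXY s t := is_gen_deriv_gauss mrho irho gD covD mp mq su su' (gY x x0) (gY' y y0) s t.
split; first exact: wick_power_Lfun2 gXY k.
rewrite (wick_power_ip gXY); congr (_ * _ ^+ _).
rewrite (is_gen_deriv_ip mrho irho gD covD mp mq su su' (gY x x0) (gY' y y0)).
rewrite rho_formE//; [exact: measurable_funTS|exact: measurable_funTS|exact: test_function_shifted pm x|exact: test_function_shifted qm y].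
Qed.

Lemma wick_kernel_Lfun2 delta p Y x : smoothing delta p Y -> wick_kernel Y x \in L2.
Proof.
move=> sp; have [x0|x0] := pselect (0 <= x).
  by apply: Lfun2Z; have [] := smoothing_ip sp sp x0 x0.
rewrite (_ : wick_kernel Y x = fun=> 0); first exact: Lfun2_0.
by apply/funext => w; rewrite /wick_kernel gb_neg// mul0r.
Qed.

(** The variance of the Wick power is a factorial times the k-th power of a value of [form], which
    [form_bound] estimates over an interval of length [2 * delta], hence uniformly in [x]. *)
Lemma wick_kernel_nm delta p Y : 0 <= delta -> smoothing delta p Y -> exists2 C, 0 <= C &
  forall x, nm P (wick_kernel Y x) <= C * itv_ind 0 N x.
Proof.
move=> d0 sp; have [pm _ _ _] := sp; have [_ p0 _ _ [B pB]] := pm.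
have B0 : 0 <= B by exact: le_trans (p0 0) (pB 0).
pose kap := B * B * (2 * delta) * abs_rho_mass rho (2 * delta).
have kap0 : 0 <= kap by rewrite !mulr_ge0// abs_rho_mass_ge0.
exists (M * Num.sqrt (k`!%:R * kap ^+ k)); first by rewrite mulr_ge0// sqrtr_ge0.
move=> x; have [x0|x0] := pselect (0 <= x); last first.
  rewrite (_ : wick_kernel Y x = fun w => 0 * 0); last first.
    by apply/funext => w; rewrite /wick_kernel gb_neg// !mul0r.
  by rewrite nmZ ?Lfun2_0// normr0 mul0r mulr_ge0 ?itv_ind_ge0// mulr_ge0// sqrtr_ge0.
have [W2 e] := smoothing_ip sp sp x0 x0.
rewrite nmZ// mulrAC; apply: ler_pM => //; first exact: nm_ge0.
rewrite /nm e; apply: ler_wsqrtr; apply: ler_wpM2l => //.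
apply: (le_trans (ler_norm _)); rewrite normrX; apply: lerXn2r; rewrite ?nnegrE//.
have := @form_bound _ rho mrho irho (shifted p x) (shifted p x) B B (x - delta) (x + delta) (2 * delta).
have -> : x + delta - (x - delta) = 2 * delta by ring.
apply => //; try exact: test_function_shifted pm x; last 2 first.
- by move=> s; exact: shifted_bound pm _ _ _ pB.
- by move=> s; exact: shifted_bound pm _ _ _ pB.
by lra.
Qed.

Lemma wick_kernel_supp Y x w : wick_kernel Y x w = wick_kernel Y x w * itv_ind 0 N x.
Proof.
have := gM x; rewrite /wick_kernel itv_indE; case: (_ && _); rewrite ?mulr1// mulr0 normr_le0 => /eqP ->.
by rewrite !mul0r.
Qed.

Lemma wick_integral_Lfun2 delta p Y : 0 <= delta -> smoothing delta p Y -> wick_integral Y \in L2.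
Proof.
move=> d0 sp; have [_ mY _ _] := sp; have [C C0 hC] := wick_kernel_nm d0 sp.
rewrite (_ : wick_integral Y = mixture (wick_kernel Y)); last first.
  by apply/funext => w; exact: wick_integralE.
by apply: (mixture_Lfun2 (measurable_wick_kernel mY) _ C0 N0 (wick_kernel_supp Y) hC) => x; exact: wick_kernel_Lfun2 sp.
Qed.

(** [ip_mixture] exchanges expectation and integration, first over [y] and then over [x]; the
    covariance of two Wick powers is left under the double integral. *)
Lemma wick_integral_ip delta p q Y Y' : 0 <= delta -> smoothing delta p Y -> smoothing delta q Y' ->
  (mu \x mu)%E.-integrable setT (EFin \o (fun z : rR * rR => gb z.1 * gb z.2 * mollified rho p q z ^+ k)) ->
  ip P (wick_integral Y) (wick_integral Y') = k`!%:R * tested_power k gb (mollified rho p q).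
Proof.
move=> d0 sp sq iK; have [_ mY _ _] := sp; have [_ mY' _ _] := sq.
have [C C0 hC] := wick_kernel_nm d0 sp; have [C' C'0 hC'] := wick_kernel_nm d0 sq.
have A2 := wick_integral_Lfun2 d0 sp.
have E : wick_integral Y = mixture (wick_kernel Y) by apply/funext => w; exact: wick_integralE.
have E' : wick_integral Y' = mixture (wick_kernel Y') by apply/funext => w; exact: wick_integralE.
have K2 x := wick_kernel_Lfun2 x sp; have K'2 y := wick_kernel_Lfun2 y sq.
rewrite E' (ip_mixture (measurable_wick_kernel mY') K'2 C'0 hC' A2) E.
rewrite /tested_power -RintegralZl// -(Rintegral21 (f := fun z : rR * rR => k`!%:R * (gb z.1 * gb z.2 * mollified rho p q z ^+ k))); last first.
  by have := integrableZl measurableT k`!%:R iK; exact: eq_integrable.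
apply: eq_Rintegral => y _; rewrite ipC (ip_mixture (measurable_wick_kernel mY) K2 C0 hC (K'2 y)).
apply: eq_Rintegral => x _ /=.
have [y0|y0] := pselect (0 <= y); last first.
  rewrite (gb_neg y0) mulr0 mul0r mulr0 (_ : wick_kernel Y' y = fun w => 0 * 0).
    by rewrite ipZl ?mul0r// Lfun2_0.
  by apply/funext => w; rewrite /wick_kernel gb_neg// !mul0r.
have [x0|x0] := pselect (0 <= x); last first.
  rewrite (gb_neg x0) !mul0r mulr0 (_ : wick_kernel Y x = fun w => 0 * 0).
    by rewrite ipZr ?mul0r// Lfun2_0.
  by apply/funext => w; rewrite /wick_kernel gb_neg// !mul0r.
have [W2 e] := smoothing_ip sp sq x0 y0; have [W'2 _] := smoothing_ip sq sp y0 x0.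
rewrite ipC /wick_kernel ipZl//; last exact: Lfun2Z.
by rewrite ipZr// e; ring.
Qed.

Lemma wick_integral_cauchy (eps : R) : 0 < eps -> exists2 delta, 0 < delta <= 1 &
  forall p q Y Y', smoothing delta p Y -> smoothing delta q Y' ->
  nm P (fun w => wick_integral Y w - wick_integral Y' w) <= eps.
Proof.
(* [second_difference_bound] loses a factor 4 and the factorial stands in front; the quotient makes
   the squared norm at most [eps ^+ 2]. *)
move=> eps0; have e1 : 0 < eps ^+ 2 / (4 * k`!%:R) by rewrite divr_gt0 ?exprn_gt0// mulr_gt0// ltr0n fact_gt0.
have [delta d01 hd] := tested_power_limit k_ge1 mrho irho ik N0 mgb gM e1.
exists delta => // p q Y Y' sp sq.
have d0 : 0 <= delta by case/andP : d01 => /ltW.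
have [pm _ _ _] := sp; have [qm _ _ _] := sq.
have [ipp hpp] := hd _ _ pm pm; have [ipq hpq] := hd _ _ pm qm; have [iqq hqq] := hd _ _ qm qm.
have A2 := wick_integral_Lfun2 d0 sp; have A'2 := wick_integral_Lfun2 d0 sq.
rewrite -(@ler_pXn2r _ 2)// ?nnegrE ?nm_ge0//; last exact: ltW.
rewrite nm_sqr ipBl//; last exact: Lfun2B.
rewrite !ipBr// (ipC P (wick_integral Y') (wick_integral Y)).
rewrite (wick_integral_ip d0 sp sp ipp) (wick_integral_ip d0 sp sq ipq) (wick_integral_ip d0 sq sq iqq).
have kf : 0 < k`!%:R :> R by rewrite ltr0n fact_gt0.
apply: (le_trans (second_difference_bound (ltW kf) hpp hpq hqq)).
by rewrite le_eqVlt; apply/orP; left; apply/eqP; field; rewrite gt_eqF.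
Qed.

End WickIntegral.

(** * Difference quotients and continuous kernels as smoothings *)

Section Smoothings.
Context {d : measure_display} {T : measurableType d} {R : realType}.
Variable P : probability T R.
Local Notation L2 := (Lfun P 2%:E).
Local Notation mu := (@lebesgue_measure R).
Local Notation rR := (measurableTypeR R).
Variables (G : R -> T -> R) (rho : R -> R).
Local Notation D := (deriv_elementary G).
Hypothesis mrho : measurable_fun setT rho.
Hypothesis irho : forall N, mu.-integrable `[- N, N] (EFin \o rho).
Hypothesis gD : forall u : elementary, elementary_on_halfline u -> gauss_moments P (D u).
Hypothesis covD : forall u v : elementary, elementary_on_halfline u -> elementary_on_halfline v ->
  ip P (D u) (D v) = form rho (elementary_fun u) (elementary_fun v).
Hypothesis mG : forall x, 0 <= x -> measurable_fun setT (G x).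
Hypothesis G_continuous : forall w, {within halfline, continuous (fun x => G x w)}.

(** Path continuity is given on the half-line; freezing the process to the left of 0 yields paths
    continuous on the whole line, as [measurable_caratheodory] requires. *)
Definition extended_process (x : R) (w : T) : R := G (Num.max 0 x) w.

Lemma measurable_extended_process :
  measurable_fun setT (fun z : rR * T => extended_process z.1 z.2).
Proof.
apply: measurable_caratheodory => [x|w]; first by apply: mG; rewrite le_max lexx.
have /continuous_within_itvcyP[cG c0] : {within `[0, +oo[, continuous (fun x => G x w)} by exact: G_continuous.
move=> x; have [x0|x0|x0] := ltgtP x 0.
- apply: (@near_cst_continuous _ _ (G 0 w)).
  by near=> y; rewrite /extended_process max_l// ltW//; near: y; exact: lt_nbhsl.
- apply/cvgrPdist_le => e e0; have xp : x \in `]0, +oo[ by rewrite in_itv/= x0.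
  have /cvgrPdist_le/(_ _ e0) := cG x xp; rewrite /extended_process (max_r (ltW x0)) => h.
  near=> y; rewrite max_r; first by near: y.
  by rewrite ltW//; near: y; exact: lt_nbhsr.
- apply/cvgrPdist_le => e e0; rewrite x0 /extended_process maxxx.
  have /cvgrPdist_le/(_ _ e0) := c0; rewrite /at_right near_withinE; apply: filterS => y hy.
  case: (leP y 0) => [_|y0]; last exact: hy.
  by rewrite subrr normr0 ltW.
Unshelve. all: by end_near.
Qed.

Lemma measurable_extended_shift (a : R) :
  measurable_fun setT (fun z : rR * T => extended_process (z.1 + a) z.2).
Proof.
have mi : measurable_fun setT (fun z : rR * T => (z.1 + a, z.2)).
  apply: measurable_fun_pair; last exact: measurable_snd.
  by apply: measurable_funD => //; exact: measurable_fst.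
exact: (measurableT_comp measurable_extended_process mi).
Qed.

Definition quotient_kernel (h s : R) : R := h^-1 * \1_(`]0, h] : set R) s.

Definition difference_quotient (h x : R) (w : T) : R := (G (x + h) w - G x w) / h.

(** Shifted by [x], the kernel is the elementary function of the single interval []x, x + h]], so a
    constant sequence approximates it. *)
Lemma smoothing_difference_quotient h : 0 < h ->
  smoothing P G rho h (quotient_kernel h) (difference_quotient h).
Proof.
move=> h0; have hi0 : 0 <= h^-1 by rewrite invr_ge0 ltW.
have mind : measurable_fun setT (\1_(`]0, h] : set R) : R -> R).
  by apply: measurable_indic; exact: measurable_itv.
pose u (x : R) : elementary := [:: (h^-1, (x, x + h))].
have hu x : 0 <= x -> elementary_on_halfline (u x).
  by move=> x0 i; rewrite inE => /eqP -> /=; rewrite x0 lerDl ltW.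
have uE (x : R) : (fun s => quotient_kernel h (s - x)) = elementary_fun (u x).
  apply/funext => s; rewrite /elementary_fun big_seq1 /quotient_kernel !indicE /= !mem_setE !in_itv/=.
  by rewrite subr_gt0 lerBlDl.
have YE x : difference_quotient h x = D (u x).
  by apply/funext => w; rewrite /deriv_elementary big_seq1 /difference_quotient /= mulrC.
split.
- split.
  + exact: measurable_funM.
  + by move=> s; rewrite mulr_ge0// indicE.
  + move=> s hs; rewrite /quotient_kernel indicE mem_setE in_itv/=.
    case: (boolP (0 < s <= h)); rewrite ?mulr0// => /andP[s0 sh].
    by move: hs; rewrite gtr0_norm// ltNge sh.
  + rewrite /quotient_kernel; under eq_integral do rewrite EFinM.
    rewrite ge0_integralZl//; last exact/measurable_EFinP.
    rewrite (@integral_indic _ _ _ mu setT measurableT `]0, h]%classic (measurable_itv _)).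
    have H : (@lebesgue_measure R `]0%R, h]%classic = h%:E)%E.
      by rewrite lebesgue_measure_itv/= lte_fin h0 sube0.
    transitivity ((h^-1)%:E * h%:E)%E; last by rewrite -EFinM mulVf ?gt_eqF.
    by congr (_ * _)%E; rewrite setIT; exact: H.
  + by exists h^-1 => s; rewrite /quotient_kernel ler_piMr// indicE lern1 leq_b1.
- apply: (@eq_measurable_fun _ _ _ _ _ (fun z : rR * T => (extended_process (z.1 + h) z.2 - extended_process (z.1 + 0) z.2) / h)).
    move=> [x w] /set_mem/= []; rewrite /halfline/= in_itv/= andbT => x0 _.
    by rewrite /difference_quotient /extended_process addr0 !max_r// addr_ge0// ltW.
  apply: measurable_funTS; apply: measurable_funM => //.
  by apply: measurable_funB; exact: measurable_extended_shift.
- move=> x x0; rewrite uE YE.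
  by apply: is_gen_deriv_elementary => //; exact: hu.
- move=> x x0; exists (fun=> u x).
  by rewrite /shifted uE restrict_half_elementary; [apply: step_approx_cst|]; exact: hu.
Qed.

Section ContinuousKernel.
Variables (delta : R) (q : R -> R).
Hypothesis d01 : 0 < delta <= 1.
Hypothesis cq : continuous q.
Hypothesis qm : mollifier delta q.

(* The grid is centred at x, so that the coefficients do not depend on x and the approximation is uniform in x. *)
Definition grid (m j : nat) : R := - 2 + 4 * (j%:R / m.+1%:R).

(** As [delta <= 1], the grid over [[-2, 2]] covers the support of [q] with a margin. End points are
    cut at 0 to stay on the half-line, and cells to the left of 0 become empty. *)
Definition grid_elementary (m : nat) (x : R) : elementary :=
  [seq (q (grid m j), (Num.max 0 (x + grid m j), Num.max 0 (x + grid m j.+1))) | j <- iota 0 m.+1].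

(** Written as a difference of two step functions so that the sum over the grid telescopes. *)
Definition cell (m j : nat) (v : R) : R := (grid m j < v)%R%:R - (grid m j.+1 < v)%R%:R.

Lemma grid_le m j : grid m j <= grid m j.+1.
Proof.
rewrite /grid lerD2l; apply: ler_wpM2l => //.
by apply: ler_wpM2r; rewrite ?invr_ge0// ler_nat.
Qed.

Lemma grid_step m j : grid m j.+1 - grid m j = 4 / m.+1%:R.
Proof. by rewrite /grid -(natr1 j) mulrDl mul1r; ring. Qed.

Lemma cellE m j v : cell m j v = (grid m j < v <= grid m j.+1)%R%:R.
Proof.
rewrite /cell (leNgt v); have := grid_le m j.
case: (ltP (grid m j) v) => a; case: (ltP (grid m j.+1) v) => b h /=; rewrite ?subrr ?subr0//.
by have := le_lt_trans h b; rewrite ltNge a.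
Qed.

Lemma sum_cell m v : \sum_(j <- iota 0 m.+1) cell m j v = (- 2 < v)%R%:R - (2 < v)%R%:R.
Proof.
rewrite -[iota 0 m.+1]/(index_iota 0 m.+1).
have -> : \sum_(0 <= j < m.+1) cell m j v = - \sum_(0 <= j < m.+1) ((grid m j.+1 < v)%R%:R - (grid m j < v)%R%:R).
  by rewrite -sumrN; apply: eq_bigr => j _; rewrite opprB.
rewrite (@telescope_sumr _ 0 m.+1 (fun j => (grid m j < v)%R%:R))// opprB.
by rewrite /grid mul0r mulr0 addr0 divff ?pnatr_eq0// mulr1 (_ : - 2 + 4 = 2 :> R); last by ring.
Qed.

Lemma grid_elementary_on_halfline m x : elementary_on_halfline (grid_elementary m x).
Proof.
move=> i /mapP[j _ ->] /=; rewrite le_max lexx/= ge_max le_max lexx/= le_max.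
by rewrite lerD2l grid_le orbT.
Qed.

Lemma grid_elementary_fun m x s : elementary_fun (grid_elementary m x) s =
  restrict_half (fun s => \sum_(j <- iota 0 m.+1) q (grid m j) * cell m j (s - x)) s.
Proof.
rewrite /elementary_fun big_map /restrict_half mulr_suml; apply: eq_bigr => j _ /=.
rewrite -mulrA; congr (_ * _); rewrite cellE !indicE !mem_setE !in_itv/= andbT.
rewrite gt_max ltrBrDl le_max lerBlDl.
case: (ltP 0 s) => s0 /=; last by rewrite mulr0.
by rewrite mulr1.
Qed.

Lemma grid_approximation m e r x s : 0 <= e -> 4 / m.+1%:R <= r ->
  (forall u v, - 2 <= u <= 2 -> `|u - v| <= r -> `|q u - q v| <= e) ->
  `|shifted q x s - elementary_fun (grid_elementary m x) s| <= e * itv_ind (x - 2) (x + 2) s.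
Proof.
move=> e0 mr hq; rewrite grid_elementary_fun /shifted /restrict_half -mulrBl normrM.
set v := s - x.
have [qm1 q0 qs _ _] := qm; have /andP[d0 d1] := d01.
(* The cells partition []-2, 2]], outside which [q v] is 0 because [delta <= 1]. *)
have sup : q v = \sum_(j <- iota 0 m.+1) q v * cell m j v.
  rewrite -mulr_sumr sum_cell; have [v1|v1] := ltP (- 2) v; have [v2|v2] := ltP 2 v; rewrite ?subr0 ?mulr1//.
  - by rewrite subrr mulr0 qs// gtr0_norm; lra.
  - by rewrite qs ?mul0r// ger0_norm; lra.
  - by rewrite qs ?mul0r// ltr0_norm; lra.
have bound : `|q v - \sum_(j <- iota 0 m.+1) q (grid m j) * cell m j v| <= e * itv_ind (- 2) 2 v.
  rewrite [X in X - _]sup -sumrB.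
  apply: (@le_trans _ _ (\sum_(j <- iota 0 m.+1) (e * itv_ind (- 2) 2 v) * cell m j v)).
    apply: (le_trans (ler_norm_sum _ _ _)).
    rewrite !big_seq; apply: ler_sum => j; rewrite mem_iota add0n => /= jm.
    rewrite -mulrBl normrM cellE; case: (boolP (_ < v <= _)) => [/andP[a b]|_]; last by rewrite normr0 !mulr0.
    rewrite normr1 !mulr1.
    have g1 : - 2 <= grid m j by rewrite /grid lerDl mulr_ge0// divr_ge0.
    have g2 : grid m j.+1 <= 2.
      rewrite /grid [leRHS](_ : _ = - 2 + 4 * 1); last by ring.
      by rewrite lerD2l; apply: ler_wpM2l => //; rewrite ler_pdivrMr// mul1r ler_nat.
    have w : - 2 <= v <= 2 by apply/andP; split; [apply: ltW; exact: le_lt_trans a|exact: le_trans g2].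
    rewrite itv_indE w mulr1; apply: hq => //.
    have := grid_step m j => h; rewrite ger0_norm ?subr_ge0 ?(ltW a)//.
    by apply: le_trans mr; rewrite -h lerD2r.
  rewrite -mulr_sumr ler_piMr ?mulr_ge0 ?itv_ind_ge0//.
  by rewrite sum_cell; case: (_ < v); case: (_ < v); rewrite ?subrr ?subr0// sub0r lerNl (le_trans (lerN10 R)).
apply: (@le_trans _ _ (e * itv_ind (- 2) 2 v)).
  by apply: (le_trans _ bound); rewrite ler_piMr// indicE normr_nat lern1 leq_b1.
have -> : itv_ind (x - 2) (x + 2) s = itv_ind (- 2) 2 v; last by [].
by rewrite !itv_indE /v; congr ((_ && _)%:R); apply/idP/idP => ?; lra.
Qed.

(** The version is the upper limit of elementary approximations converging at rate [2 ^- n],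
    uniformly in [x]. Each of them is jointly measurable, being a finite combination of shifts of
    the process, and so is the upper limit. *)
Lemma smoothing_continuous : exists Y, smoothing P G rho delta q Y.
Proof.
pose kap := abs_rho_mass rho 4.
have kap0 : 0 <= kap by exact: abs_rho_mass_ge0.
(* With differences bounded by [2 * e i] on an interval of length 4, [form_bound] gives a squared
   distance of at most [(2 ^- i) ^+ 2]; adding 1 to [kap] allows for [kap = 0]. *)
pose e n : R := 2 ^- n / (4 * (kap + 1)).
have k1 : 0 < 4 * (kap + 1) by rewrite mulr_gt0// ltr_wpDl.
have e0 n : 0 < e n by rewrite divr_gt0// invr_gt0 exprn_gt0.
have /boolp.choice[m hm] : forall n, exists m : nat, forall x s,
    `|shifted q x s - elementary_fun (grid_elementary m x) s| <= e n * itv_ind (x - 2) (x + 2) s.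
  move=> n; have [r r0 hr] := @uniform_continuity_segment R q (- 2) 2 (e n) cq (e0 n).
  pose m := Num.truncn (4 / r); exists m => x s.
  apply: (@grid_approximation m (e n) r) => //; first exact: ltW.
  by rewrite ler_pdivrMr// mulrC -ler_pdivrMr// ltW// truncnS_gt.
pose Z n x := D (grid_elementary (m n) x).
pose Y x := limsup_fun (fun n => Z n x).
have hu n x := @grid_elementary_on_halfline (m n) x.
have Z2 n x : Z n x \in L2 by apply: gauss_moments_Lfun2; exact: gD.
have su x : step_approx (shifted q x) (fun n => grid_elementary (m n) x).
  split; first exact: test_function_shifted qm x.
  exists (x - 2), (x + 2), e; split; [by move=> n; exact: hu| |by move=> n s; exact: hm].
  have lim : 2^-1 ^+ n @[n --> \oo] --> (0 : R) by apply: cvg_expr; rewrite ger0_norm// invf_lt1// ltr1n.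
  rewrite -[X in _ --> X](mul0r (4 * (kap + 1))^-1).
  by apply: cvgMl; under eq_fun do rewrite -exprVn.
have e_dec i j : (i <= j)%N -> e j <= e i.
  move=> ij; apply: ler_wpM2r; first by rewrite invr_ge0 ltW.
  by rewrite lef_pV2 ?posrE ?exprn_gt0// ler_eXn2l// ltr1n.
have cauchy x i j : (i <= j)%N -> nm P (fun w => Z i x w - Z j x w) <= 2 ^- i.
  move=> ij; pose ui := grid_elementary (m i) x; pose uj := grid_elementary (m j) x.
  have E : (fun w => Z i x w - Z j x w) = D (ui ++ scale_elementary (-1) uj).
    by apply/funext => w; rewrite deriv_elementary_cat deriv_elementary_scale mulN1r.
  have huij : elementary_on_halfline (ui ++ scale_elementary (-1) uj).
    by apply: elementary_on_halfline_cat; [exact: hu|apply: elementary_on_halfline_scale; exact: hu].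
  have bd s : `|elementary_fun (ui ++ scale_elementary (-1) uj) s| <= (2 * e i) * itv_ind (x - 2) (x + 2) s.
    rewrite elementary_fun_cat elementary_fun_scale.
    have -> : elementary_fun ui s + -1 * elementary_fun uj s =
      (shifted q x s - elementary_fun uj s) - (shifted q x s - elementary_fun ui s) by ring.
    apply: (le_trans (ler_normB _ _)); rewrite mulr2n !mulrDl !mul1r; apply: lerD; last exact: hm.
    by apply: (le_trans (hm _ _ _)); apply: ler_wpM2r; [exact: itv_ind_ge0|exact: e_dec].
  have pi : 0 <= 2 ^- i :> R by rewrite invr_ge0 exprn_ge0.
  rewrite -(@ler_pXn2r _ 2)// ?nnegrE ?nm_ge0// nm_sqr E covD//.
  apply: (le_trans (ler_norm _)).
  have te := test_function_elementary (ui ++ scale_elementary (-1) uj).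
  have ei2 : 0 <= 2 * e i by rewrite mulr_ge0// ltW.
  apply: (le_trans (@form_bound _ rho mrho irho _ _ (2 * e i) (2 * e i) (x - 2) (x + 2) 4 _ _ ei2 ei2 te te bd bd)).
  - lra.
  - lra.
  have -> : x + 2 - (x - 2) = 4 by ring.
  rewrite -/kap /e.
  have -> : 2 * (2 ^- i / (4 * (kap + 1))) * (2 * (2 ^- i / (4 * (kap + 1)))) * 4 * kap =
     (2 ^- i) ^+ 2 * (kap / (kap + 1) ^+ 2).
    have kn : kap + 1 != 0 by rewrite gt_eqF// ltr_wpDl.
    by field; rewrite kn expf_neq0.
  rewrite ler_piMr ?sqr_ge0// ler_pdivrMr ?exprn_gt0 ?ltr_wpDl// mul1r.
  by rewrite sqrrD1; have := sqr_ge0 kap; lra.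
have rf x := riesz_fischer (fun n => Z2 n x) (cauchy x).
exists Y; split => //.
- have mZ n : measurable_fun setT (fun z : rR * T => Z n z.1 z.2).
    have -> : (fun z : rR * T => Z n z.1 z.2) = (fun z : rR * T => \sum_(j <- iota 0 (m n).+1)
        q (grid (m n) j) * (extended_process (z.1 + grid (m n) j.+1) z.2 - extended_process (z.1 + grid (m n) j) z.2)).
      by apply/funext => z; rewrite /Z /deriv_elementary big_map.
    apply: measurable_sum => j; apply: measurable_funM => //.
    by apply: measurable_funB; exact: measurable_extended_shift.
  apply: measurable_funTS.
  exact: (@measurable_limsup_fun _ (rR * T)%type R setT (fun n z => Z n z.1 z.2)).
- move=> x x0; have [Y2 YZ] := rf x.
  apply: (is_gen_deriv_intro mrho irho gD (measurable_shift qm x) (su x) Y2).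
  have lim : 2^-1 ^+ n @[n --> \oo] --> (0 : R) by apply: cvg_expr; rewrite ger0_norm// invf_lt1// ltr1n.
  apply: (squeeze_cvgr _ (cvg_cst 0) lim); apply: nearW => n; rewrite nm_ge0/= exprVn.
  exact: YZ.
- by move=> x _; exists (fun n => grid_elementary (m n) x).
Qed.

End ContinuousKernel.

End Smoothings.

Lemma integrable_rho_power {R : realType} (rho : R -> R) (k : nat) (L : R) :
  locally_integrable setT (fun x => rho x ^+ k) ->
  (@lebesgue_measure R).-integrable setT (EFin \o (fun u => `|rho u| ^+ k * itv_ind (- L) L u)).
Proof.
move=> [mk _ /(_ `[- L, L]%classic (@subsetT _ _) (@segment_compact _ _ _)) fk].
apply/integrableP; split.
  apply/measurable_EFinP; apply: measurable_funM; last exact: measurable_itv_ind.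
  rewrite (_ : (fun u => `|rho u| ^+ k) = (fun u => `|rho u ^+ k|)); first exact: measurableT_comp.
  by apply/funext => u; rewrite normrX.
apply: le_lt_trans fk; rewrite [leRHS]integral_mkcond le_eqVlt; apply/orP; left; apply/eqP.
apply: eq_integral => u _; rewrite patchE /= /itv_ind indicE normrM normrX normr_id -normrX.
by case: (u \in _); rewrite ?normr1 ?mulr1 ?normr0 ?mulr0.
Qed.

Lemma approximate_identity_mollifier {R : realType} (f : R -> R -> R) (delta : R) :
  approximate_identity f -> 0 < delta <= 1 -> mollifier delta (f delta).
Proof.
move=> fa d01; have [cf f0 _ fs f1] := fa _ d01; have /andP[d0 d1] := d01.
have mf : measurable_fun setT (f delta) by exact: continuous_measurable_fun.
split => //.
(* Infinite values have [fine] equal to 0, so [fine x = 1] forces [x] to be finite. *)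
- have fine1 (x : \bar R) : fine x = 1 -> x = 1%E.
    by case: x => [r /= ->|/= h|/= h]//; have := oner_neq0 R; rewrite -h eqxx.
  by apply: fine1; move: f1; rewrite /lebesgue_int /Rintegral integral_completed//; exact/measurable_EFinP.
- have dd : - delta <= delta by rewrite (le_trans _ (ltW d0))// oppr_le0 ltW.
  have [c _ hc] := @EVT_max _ (f delta) (- delta) delta dd (continuous_subspaceT cf).
  exists (f delta c) => s; have [sd|ds] := leP `|s| delta; last by rewrite fs.
  by apply: hc; rewrite in_itv/= -ler_norml.
Qed.

(** * Existence of the Wick chaos and the limit of the difference quotients *)

Section Assemble.
Context {d : measure_display} {T : measurableType d} {R : realType}.
Variable P : probability T R.
Local Notation L2 := (Lfun P 2%:E).
Variables (k : nat) (G : R -> T -> R) (rho : R -> R) (f : R -> R -> R) (g : R -> R).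
Local Notation A Y := (wick_integral P k g Y).
Hypothesis A2 : forall delta p Y, 0 <= delta -> smoothing P G rho delta p Y -> A Y \in L2.
Hypothesis cauchy : forall eps : R, 0 < eps -> exists2 delta, 0 < delta <= 1 &
  forall p q Y Y', smoothing P G rho delta p Y -> smoothing P G rho delta q Y' ->
  nm P (fun w => A Y w - A Y' w) <= eps.
Hypothesis canonical : forall delta : R, 0 < delta <= 1 -> exists Y, smoothing P G rho delta (f delta) Y.
Hypothesis quotient : forall h : R, 0 < h -> smoothing P G rho h (quotient_kernel h) (difference_quotient G h).

(** Along radii [s n] at which the Cauchy estimate holds with [2 ^- n], completeness gives a limit;
    every small [delta] is then compared with a fixed [s n]. *)
Lemma wick_chaos_exists : exists X, is_wick_chaos P G rho f k g X.
Proof.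
have /boolp.choice[Y hY] : forall delta : R, exists Y, 0 < delta <= 1 -> smoothing P G rho delta (f delta) Y.
  move=> delta; case: (boolP (0 < delta <= 1)) => [d01|_]; last by exists (fun _ _ => 0).
  by have [Y sY] := canonical d01; exists Y.
have pos2 n : 0 < 2 ^- n :> R by rewrite invr_gt0 exprn_gt0.
have /boolp.choice[dd hdd] : forall n, exists delta : R, 0 < delta <= 1 /\
  forall p q Y Y', smoothing P G rho delta p Y -> smoothing P G rho delta q Y' ->
  nm P (fun w => A Y w - A Y' w) <= 2 ^- n.
  by move=> n; have [delta d01 h] := cauchy (pos2 n); exists delta.
pose s := fix s n := if n is m.+1 then Num.min (s m) (dd m.+1) else dd 0%N.
(* [s] is a running minimum of the [dd n]: the radii decrease, so all later ones satisfy the [n]-th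
   estimate. *)
have s_le n : s n <= dd n by case: n => [|n]/=; rewrite ?lexx// ge_min lexx orbT.
have s_dec n m : (n <= m)%N -> s m <= s n.
  move=> /subnK <-; elim: (m - n)%N => [|j IH]; first by rewrite add0n.
  by rewrite addSn /=; apply: le_trans IH; rewrite ge_min lexx.
have s01 n : 0 < s n <= 1.
  have [/andP[h0 h1] _] := hdd n; rewrite (le_trans (s_le n) h1) andbT.
  elim: n {h0 h1} => [|n IH] /=; first by have [/andP[]] := hdd 0%N.
  by rewrite lt_min IH; have [/andP[]] := hdd n.+1.
have close n delta delta' : 0 < delta <= dd n -> 0 < delta' <= dd n ->
    nm P (fun w => A (Y delta) w - A (Y delta') w) <= 2 ^- n.
  move=> /andP[a0 a1] /andP[b0 b1]; have [/andP[_ h1] h] := hdd n.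
  apply: (h (f delta) (f delta')).
    by apply: (smoothing_le a1 (hY _ _)); rewrite a0 (le_trans a1).
  by apply: (smoothing_le b1 (hY _ _)); rewrite b0 (le_trans b1).
have AY2 delta : 0 < delta <= 1 -> A (Y delta) \in L2.
  by move=> d01; apply: (A2 _ (hY _ d01)); case/andP : d01 => /ltW.
have Z2 n : A (Y (s n)) \in L2 by exact: AY2.
have sn n : 0 < s n <= dd n by rewrite s_le andbT; case/andP : (s01 n).
have fast n m : (n <= m)%N -> nm P (fun w => A (Y (s n)) w - A (Y (s m)) w) <= 2 ^- n.
  move=> nm_; apply: close => //; have /andP[-> _] := s01 m.
  by rewrite (le_trans (s_dec _ _ nm_)).
have [X2 XZ] := riesz_fischer Z2 fast.
exists (limsup_fun (fun n => A (Y (s n)))), Y; split.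
  by move=> delta d01; have [_ mY gY _] := hY _ d01.
apply/L2_cvgP; split => //.
  near=> delta; apply: AY2; apply/andP; split; near: delta; first exact: nbhs_right_gt.
  exact: nbhs_right_le.
apply/cvgrPdist_le => e e0.
have [n hn] : exists n, 2 * 2 ^- n <= e.
  have lim : 2^-1 ^+ n @[n --> \oo] --> (0 : R) by apply: cvg_expr; rewrite ger0_norm// invf_lt1// ltr1n.
  have e20 : 0 < e / 2 by rewrite divr_gt0.
  move/cvgrPdist_le : lim => /(_ _ e20) [n _ /(_ n (leqnn n))] /=.
  rewrite sub0r normrN ger0_norm ?exprn_ge0// exprVn => h; exists n.
  by rewrite mulrC -ler_pdivlMr.
have dn0 : 0 < dd n by have [/andP[]] := hdd n.
near=> delta.
have dpos : 0 < delta by near: delta; exact: nbhs_right_gt.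
have dle : delta <= dd n by near: delta; exact: nbhs_right_le.
have d01 : 0 < delta <= 1 by rewrite dpos (le_trans dle)//; have [/andP[]] := hdd n.
rewrite sub0r normrN ger0_norm ?nm_ge0//; apply: le_trans hn.
apply: (le_trans (nm_triangle (AY2 _ d01) (Z2 n) X2)).
rewrite mulr2n mulrDl mul1r; apply: lerD; last exact: XZ.
by apply: close => //; rewrite dpos.
Unshelve. all: by end_near.
Qed.

(** One member [Y t] of the given family, with [t] small, is close to its limit [X] and, by the
    Cauchy property, to every difference quotient of small step. *)
Lemma wick_chaos_difference_quotient X : is_wick_chaos P G rho f k g X ->
  L2_cvg P 0^'+ (fun h => A (difference_quotient G h)) X.
Proof.
move=> [Y [hY /L2_cvgP[_ X2 YX]]].
(* The versions in the definition of the chaos are arbitrary, but the step approximations concern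
   only the kernel [f delta], so they are borrowed from the constructed version. *)
have sY delta : 0 < delta <= 1 -> smoothing P G rho delta (f delta) (Y delta).
  move=> d01; have [mY gY] := hY _ d01; have [Y' [pm _ _ sY']] := canonical d01.
  by split.
apply/L2_cvgP; split; [|exact: X2|].
  near=> h; have h0 : 0 < h by near: h; exact: nbhs_right_gt.
  exact: (A2 (ltW h0) (quotient h0)).
apply/cvgrPdist_le => e e0; have e20 : 0 < e / 2 by rewrite divr_gt0.
have [delta d01 hd] := cauchy e20; have /andP[d0 d1] := d01.
have [t [/andP[t0 td] ht]] : exists t, 0 < t <= delta /\
    nm P (fun w => A (Y t) w - X w) <= e / 2.
  move/cvgrPdist_le : YX => /(_ _ e20) near_e.
  have [t ht] : exists t, (0 < t <= delta) /\ `|0 - nm P (fun w => A (Y t) w - X w)| <= e / 2.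
    apply: (@filter_ex _ ((0:R)^'+)); near=> t; split; last by near: t.
    by apply/andP; split; near: t; [exact: nbhs_right_gt|exact: nbhs_right_le].
  by case: ht; rewrite sub0r normrN (ger0_norm (nm_ge0 _ _)) => ? ?; exists t.
have st : smoothing P G rho t (f t) (Y t) by apply: sY; rewrite t0 (le_trans td).
near=> h.
have h0 : 0 < h by near: h; exact: nbhs_right_gt.
have hdl : h <= delta by near: h; exact: nbhs_right_le.
have B2 : A (difference_quotient G h) \in L2 by exact: (A2 (ltW h0) (quotient h0)).
have At2 : A (Y t) \in L2 by exact: (A2 (ltW t0) st).
rewrite sub0r normrN ger0_norm ?nm_ge0//.
apply: (le_trans (nm_triangle B2 At2 X2)); rewrite [e]splitr; apply: lerD => //.
exact: hd (smoothing_le hdl (quotient h0)) (smoothing_le td st).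
Unshelve. all: by end_near.
Qed.

End Assemble.

Theorem theorem3p1 (d : measure_display) (T : measurableType d) (R : realType)
    (P : probability T R) (k : nat) (G : R -> T -> R) (sigma2 : R -> R)
    (f : R -> R -> R)
    (k_ge1 : (1 <= k)%N)
    (G_gaussian : gaussian_process P G)
    (G_mean_zero : mean_zero P G)
    (G0 : forall w, G 0 w = 0)
    (G_continuous : forall w, {within halfline, continuous (fun x => G x w)})
    (G_stationary : stationary_increments P G)
    (G_sigma2 : increments_variance P G sigma2)
    (sigma2_small : sigma2 h / h @[h --> 0^'+] --> (0 : R))
    (sigma2_diff : forall s : R, s != 0 ->
       derivable sigma2 s 1 /\ derivable (sigma2^`())%classic s 1)
    (rho_locint : locally_integrable setT (fun x => rho_of sigma2 x ^+ k))
    (rho_bounded : forall delta M : R, 0 < delta -> delta < M ->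
       exists C : R, forall x, delta <= x <= M -> `|rho_of sigma2 `|x| | <= C)
    (f_approx : approximate_identity f)
    (g : R -> R) (g_B0 : B0 g) :
  (exists X : T -> R, is_wick_chaos P G (rho_of sigma2) f k g X) /\
  (forall X : T -> R, is_wick_chaos P G (rho_of sigma2) f k g X ->
     L2_cvg P 0^'+
       (fun h w => lebesgue_int halfline (fun x =>
          wick_power P k (fun v => (G (x + h) v - G x v) / h) w * g x))
       X).
Proof.
have mrho := measurable_rho_of G_sigma2 sigma2_small sigma2_diff.
have irho := integrable_rho_of G_sigma2 k_ge1 sigma2_small sigma2_diff rho_locint.
have ik L := integrable_rho_power L rho_locint.
have gD u (hu : elementary_on_halfline u) := gauss_moments_deriv_elementary G_gaussian G_mean_zero hu.
have covD u v (hu : elementary_on_halfline u) (hv : elementary_on_halfline v) :=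
  ip_deriv_elementary G_gaussian G_mean_zero G0 G_sigma2 k_ge1 sigma2_small sigma2_diff rho_locint rho_bounded hu hv.
have mG x (x0 : 0 <= x) := Lfun2_measurable (gauss_moments_process_Lfun2 G_gaussian G_mean_zero x0).
(* From here on [g] is represented by the Borel function [gb], bounded by [M] and supported in
   [[0, N]]. *)
have [gb [mgb [M gbM] [N N0 gbN] g_gb]] := B0_Borel g_B0.
have M0 : 0 <= M by exact: le_trans (normr_ge0 _) (gbM 0).
have gM x : `|gb x| <= M * itv_ind 0 N x.
  have [->|gx] := eqVneq (gb x) 0; first by rewrite normr0 mulr_ge0// itv_ind_ge0.
  by rewrite itv_indE (gbN _ gx) mulr1.
have A2 delta p Y (d0 : 0 <= delta) sY := @wick_integral_Lfun2 _ _ _ P G _ k mrho irho gD covD g gb M N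
  (ltW N0) M0 mgb gM g_gb delta p Y d0 sY.
have cauchy eps (eps0 : 0 < eps) := @wick_integral_cauchy _ _ _ P G _ k k_ge1 mrho irho ik gD covD g gb M N
  (ltW N0) M0 mgb gM g_gb eps eps0.
have canonical delta (d01 : 0 < delta <= 1) :
    exists Y, smoothing P G (rho_of sigma2) delta (f delta) Y.
  have [cf _ _ _ _] := f_approx _ d01.
  exact: (smoothing_continuous mrho irho gD covD mG G_continuous d01 cf (approximate_identity_mollifier f_approx d01)).
have quotient h (h0 : 0 < h) := smoothing_difference_quotient mrho irho gD mG G_continuous h0.
split; first exact: wick_chaos_exists A2 cauchy canonical.
move=> X hX; have H := wick_chaos_difference_quotient A2 cauchy canonical quotient hX.
exact: H.
Qed.
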